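(* Let $n,a,t,k$ be positive integers with $a\ge 2$, $1\le t\le n-1$, and put $\alpha_c:=\max\left\{\frac{t}{k},\frac{n-t}{an-k}\right\}$ (in both cases below $k<an$). Suppose that one of the following holds: (a) $at\le k<an$, $(a-1)t\le a(an-k)+(a-2)n$ and $G(\alpha_c;n-t,a(n-t),k-at)\ne\emptyset$; (b) $k\le at$, $t\le (a+1)k-n$ and $G(\alpha_c;t,(a-1)t,k)\ne\emptyset$. Then $G(\alpha_c^+;n,an-t,k)\ne\emptyset$.
   Context: We work over $\mathbb{C}$ on the projective line $\mathbb{P}^1$. A coherent system of type $(n,d,k)$ is a pair $(E,V)$ where $E$ is a vector bundle on $\mathbb{P}^1$ of rank $n$ and degree $d$ and $V\subset H^0(E)$ is a linear subspace of dimension $k$ ($k=0$ is allowed). A subsystem of $(E,V)$ is a coherent system $(E',V')$ with $E'\subset E$ a nonzero subbundle and $V'\subset V\cap H^0(E')$; it is proper if $(E',V')\ne(E,V)$. For $\alpha\in\mathbb{R}$ the $\alpha$-slope is $\mu_\alpha(E,V)=\frac{d+\alpha k}{n}$, and $(E,V)$ is $\alpha$-stable if $\mu_\alpha(E',V')<\mu_\alpha(E,V)$ for every proper subsystem $(E',V')$. $G(\alpha;n,d,k)$ denotes the moduli space of $\alpha$-stable coherent systems of type $(n,d,k)$ on $\mathbb{P}^1$; its points are the isomorphism classes of such systems. For fixed $(n,d,k)$ there are only finitely many distinct moduli spaces $G(\alpha;n,d,k)$ as $\alpha$ varies; $G(\alpha'^+;n,d,k)$ denotes the moduli space $G(\alpha;n,d,k)$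 for $\alpha$ in a suitable open interval $]\alpha',\alpha''[$ (with $\alpha''>\alpha'$ close enough to $\alpha'$ that $G(\alpha;n,d,k)$ is constant on this interval). *)

(* Defs.v *)
From HB Require Import structures.
From mathcomp Require Import all_boot all_order all_algebra.
From mathcomp Require Import classical_sets reals complex.

Set Implicit Arguments.
Unset Strict Implicit.
Unset Printing Implicit Defensive.

Import Order.TTheory GRing.Theory Num.Theory.
Local Open Scope classical_set_scope.
Local Open Scope ring_scope.

(* P^1 over an algebraically closed field C is covered by two affine lines,   *)
(* U0 with coordinate z and U1 with coordinate w = 1/z.  Functions on U0 and  *)
(* on U1 are both represented by {poly C}, the formal variable being z on U0  *)
(* and w on U1; they are compared in the function field C(z).                 *)

Definition ratfun (C : closedFieldType) := {fraction {poly C}}.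

Definition zcoord (C : closedFieldType) : ratfun C := FracField.tofrac 'X.

Definition chart0 (C : closedFieldType) (p : {poly C}) : ratfun C :=
  FracField.tofrac p.

Definition chart1 (C : closedFieldType) (p : {poly C}) : ratfun C :=
  (map_poly (fun c : C => FracField.tofrac c%:P) p).[(zcoord C)^-1].

(* regular functions on the overlap: C[z, 1/z] *)
Definition laurent (C : closedFieldType) (x : ratfun C) : Prop :=
  exists p : {poly C}, exists m : nat, x = chart0 p / zcoord C ^+ m.

Definition laurent_mx (C : closedFieldType) (m n : nat)
    (A : 'M[ratfun C]_(m, n)) : Prop :=
  forall i j, laurent (A i j).

(* A vector bundle of rank n on P^1, given by its transition matrix in        *)
(* GL_n(C[z, 1/z]) for the cover {U0, U1}.  This covers all vector bundles,   *)
(* since every vector bundle on an affine line is trivial.                    *)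
Record vbundle (C : closedFieldType) (n : nat) := VBundle {
  trans : 'M[ratfun C]_n;
  trans_unit : trans \in unitmx;
  trans_laurent : laurent_mx trans;
  trans_inv_laurent : laurent_mx (invmx trans)
}.

(* deg E is the degree of the line bundle det E.  Sections are glued below by *)
(* s0 = (trans E) s1, so O(d) is the line bundle with transition function z^d *)
(* and the transition functions c z^d are those of line bundles of degree d.  *)
Definition has_degree (C : closedFieldType) (n : nat) (E : vbundle C n)
    (d : int) : Prop :=
  exists2 c : C, c != 0 & \det (trans E) = chart0 c%:P * zcoord C ^ d.

(* pairs (s0, s1): coordinates on U0 (in C[z]^n) and on U1 (in C[w]^n).       *)
(* C acts on them through constant polynomials.                               *)
Definition chart_vec (C : closedFieldType) (n : nat) : Type :=
  ('cV[{poly C}]_n * 'cV[{poly C}]_n)%type.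

Definition cscale (C : closedFieldType) (n : nat) (c : C) (s : chart_vec C n) :
  chart_vec C n := (c%:P *: s.1, c%:P *: s.2).

Definition H0 (C : closedFieldType) (n : nat) (E : vbundle C n) :
    set (chart_vec C n) :=
  [set s | map_mx (@chart0 C) s.1 = trans E *m map_mx (@chart1 C) s.2].

Record bhom (C : closedFieldType) (m n : nat)
    (E' : vbundle C m) (E : vbundle C n) := BHom {
  hom0 : 'M[{poly C}]_(n, m);
  hom1 : 'M[{poly C}]_(n, m);
  hom_glue :
    map_mx (@chart0 C) hom0 *m trans E' = trans E *m map_mx (@chart1 C) hom1
}.

Definition on_sections (C : closedFieldType) (m n : nat)
    (E' : vbundle C m) (E : vbundle C n) (f : bhom E' E)
    (s : chart_vec C m) : chart_vec C n :=
  (hom0 f *m s.1, hom1 f *m s.2).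

Definition bhom_iso (C : closedFieldType) (m n : nat)
    (E' : vbundle C m) (E : vbundle C n) (f : bhom E' E) : Prop :=
  exists g : bhom E E',
    [/\ hom0 g *m hom0 f = 1%:M, hom1 g *m hom1 f = 1%:M,
        hom0 f *m hom0 g = 1%:M & hom1 f *m hom1 g = 1%:M].

(* f embeds E' as a subbundle: it is injective on the fibre at every point of *)
(* U0 and of U1 (column vectors, so the rank must be that of E').             *)
Definition subbundle_map (C : closedFieldType) (m n : nat)
    (E' : vbundle C m) (E : vbundle C n) (f : bhom E' E) : Prop :=
  forall x : C,
    \rank (map_mx (fun p : {poly C} => p.[x]) (hom0 f)) = m /\
    \rank (map_mx (fun p : {poly C} => p.[x]) (hom1 f)) = m.

Record cohsys (C : closedFieldType) (n : nat) := CohSys {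
  cs_bundle : vbundle C n;
  cs_space : set (chart_vec C n);
  cs_space_sub : cs_space `<=` H0 cs_bundle;
  cs_space0 : cs_space 0;
  cs_space_lin : forall (c : C) (s t : chart_vec C n),
    cs_space s -> cs_space t -> cs_space (cscale c s + t)
}.

Definition has_dim (C : closedFieldType) (n : nat) (V : set (chart_vec C n))
    (k : nat) : Prop :=
  exists b : 'I_k -> chart_vec C n,
    (forall s, V s <-> exists c : 'I_k -> C, s = \sum_i cscale (c i) (b i)) /\
    (forall c : 'I_k -> C, \sum_i cscale (c i) (b i) = 0 -> forall i, c i = 0).

Definition has_type (C : closedFieldType) (n : nat) (X : cohsys C n)
    (d : int) (k : nat) : Prop :=
  has_degree (cs_bundle X) d /\ has_dim (cs_space X) k.

Definition cs_iso_map (C : closedFieldType) (m n : nat)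
    (X : cohsys C m) (Y : cohsys C n)
    (f : bhom (cs_bundle X) (cs_bundle Y)) : Prop :=
  bhom_iso f /\ on_sections f @` cs_space X = cs_space Y.

Definition cs_isomorphic (C : closedFieldType) (n : nat) (X Y : cohsys C n) :
    Prop :=
  exists f : bhom (cs_bundle X) (cs_bundle Y), cs_iso_map f.

(* f exhibits X' as a subsystem of X *)
Definition subsystem (C : closedFieldType) (m n : nat)
    (X' : cohsys C m) (X : cohsys C n)
    (f : bhom (cs_bundle X') (cs_bundle X)) : Prop :=
  [/\ (0 < m)%N, subbundle_map f &
      on_sections f @` cs_space X' `<=` cs_space X].

Definition slope (R : realType) (alpha : R) (n : nat) (d : int) (k : nat) : R :=
  (d%:~R + alpha * k%:R) / n%:R.

(* The degree of a bundle and the dimension of a space of sections always     *)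
(* exist and are unique, so quantifying over types is no restriction.         *)
Definition stable (R : realType) (alpha : R) (n : nat) (X : cohsys R[i] n) :
    Prop :=
  forall (m : nat) (X' : cohsys R[i] m)
         (f : bhom (cs_bundle X') (cs_bundle X)),
    subsystem f -> ~ cs_iso_map f ->
    forall (d' : int) (k' : nat) (d : int) (k : nat),
      has_type X' d' k' -> has_type X d k ->
      slope alpha m d' k' < slope alpha n d k.

(* the set of isomorphism classes of alpha-stable systems of type (n, d, k) *)
Definition G (R : realType) (alpha : R) (n : nat) (d : int) (k : nat) :
    set (set (cohsys R[i] n)) :=
  [set cs_isomorphic X | X in [set X | has_type X d k /\ stable alpha X]].

Arguments G {R} alpha n d k.

(* M is the common value of G(alpha; n, d, k) for alpha in some ]a', a''[ *)
Definition is_Gplus (R : realType) (a' : R) (n : nat) (d : int) (k : nat)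
    (M : set (set (cohsys R[i] n))) : Prop :=
  exists2 a'' : R, a' < a'' &
    forall alpha : R, a' < alpha -> alpha < a'' -> G alpha n d k = M.

(* Main.v *)
(* Put X1 (case (a)), resp. X2 (case (b)), for a point of the given moduli     *)
(* space.  In case (a), (E,V) is an extension of (O(a-1), H^0)^t by X1; in    *)
(* case (b), an extension of X2 by (O(a), 0)^(n-t).  At alpha_c the two outer *)
(* terms have the same slope, X1 and X2 are stable and the copies of the line *)
(* systems are too, so (E,V) is alpha_c-semistable.  The numerical hypothesis *)
(* says that the space of extensions by (resp. of) one line system has        *)
(* dimension at least t (resp. n-t), so the classes of the extension can be   *)
(* chosen linearly independent.  A subsystem of equal slope then either has   *)
(* a smaller ratio k'/m, and does not destabilise for alpha > alpha_c, or     *)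
(* splits some combination of the classes, which is impossible.  The moduli   *)
(* spaces are constant just above alpha_c because the walls are zeros of      *)
(* D + alpha K with D, K integers and K bounded.                              *)

From HB Require Import structures.
Require Import Defs.
From mathcomp Require Import all_boot all_order all_algebra.
From mathcomp Require Import boolp classical_sets reals complex.
From mathcomp Require Import ring lra zify.

Set Implicit Arguments.
Unset Strict Implicit.
Unset Printing Implicit Defensive.

Import Order.TTheory GRing.Theory Num.Theory.
Local Open Scope ring_scope.

(** * Laurent polynomials *)

(** Write n = r + t. The system is an extension whose outer terms have equal slope at alpha_c, the
    maximum in alpha_c being the value that balances them. Two things must meet: enough independent
    extension classes, and control of all subsheaves of that same slope.

    The classes are a matter of linear algebra. [birkhoff_grothendieck] splits bundles into line
    bundles, so H^0(E1(1)) and Hom(E2, O(a)) are counted by degrees. The numerical hypotheses then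
    say that there are at least r' + p independent vectors, where r' classes must be independent
    modulo p given vectors; [independent_mod_family] finds them. [nonsplit_extension] (case (a)) and
    [nonsplit_graph] (case (b)) turn them into explicit transition matrices and spaces of sections.

    For stability, [subext_exists] cuts a subsheaf E' into a part K in the sub and an image I in the
    quotient, with d' = dK + dI and k' <= kK + kI. [stable_weak0] bounds the part lying in the given
    stable system and [sub_linesum] the part lying in the sum of line bundles. Equality of slopes
    forces equality in every bound: the first part is zero or everything, the second is a constant
    subspace tensored with the line bundle, and all sections lift. Either E' is the whole system, or
    k'/m < k/n, or some combination of the classes splits, which independence excludes.

    [Gplus_nonempty] concludes: on a small interval above alpha_c no slope comparison changes sign,
    so strict inequalities persist, and ties with a smaller ratio k'/m become strict. *)

Section Charts.
Variable C : closedFieldType.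
Local Notation F := (ratfun C).
Local Notation z := (zcoord C).
Local Notation c0 := (@chart0 C).
Local Notation c1 := (@chart1 C).

HB.instance Definition _ :=
  GRing.RMorphism.copy c0 (@FracField.tofrac {poly C}).

Let const1 : C -> F := fun c => FracField.tofrac c%:P.
HB.instance Definition _ :=
  GRing.RMorphism.copy const1 (@FracField.tofrac {poly C} \o polyC).

HB.instance Definition _ :=
  GRing.RMorphism.copy c1 (horner_eval z^-1 \o map_poly const1).

Let chart1E p : c1 p = (map_poly const1 p).[z^-1].
Proof. by []. Qed.

Lemma chart0_eq0 p : (c0 p == 0) = (p == 0).
Proof. by rewrite /chart0 tofrac_eq0. Qed.

Lemma chart0_inj : injective c0.
Proof. by move=> p q /eqP; rewrite /chart0 tofrac_eq => /eqP. Qed.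

Lemma zcoord_neq0 : z != 0.
Proof. by rewrite /zcoord tofrac_eq0 polyX_eq0. Qed.

Lemma chart0X : c0 'X = z. Proof. by []. Qed.

Lemma chart1C c : c1 c%:P = c0 c%:P.
Proof. by rewrite chart1E map_polyC hornerC. Qed.

Lemma chart1X : c1 'X = z^-1.
Proof. by rewrite chart1E map_polyX hornerX. Qed.

(** For q of degree at most N this is z^N q(1/z). The reversal is taken at a prescribed N, so that
    it exchanges the two coordinates of a section of O(N). *)
Definition revpoly (N : nat) (q : {poly C}) : {poly C} :=
  \poly_(i < N.+1) q`_(N - i).

Lemma chart1_rev N (q : {poly C}) :
  (size q <= N.+1)%N -> c0 (revpoly N q) = z ^+ N * c1 q.
Proof.
move=> sq; rewrite /revpoly poly_def rmorph_sum /= chart1E.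
rewrite (@horner_coef_wide _ N.+1) ?(leq_trans (size_poly _ _)) //.
rewrite mulr_sumr (reindex_inj rev_ord_inj) /=; apply: eq_bigr => i _.
have iN : (i <= N)%N by rewrite -ltnS.
rewrite subSS subKn // coef_map /= -mul_polyC rmorphM rmorphXn /= chart0X.
rewrite mulrCA; congr (_ * _); rewrite exprVn.
have zi : z ^+ i != 0 by rewrite expf_neq0 ?zcoord_neq0.
by apply: (mulIf zi); rewrite mulfVK // -exprD subnK.
Qed.

Lemma rev_chart0 N (p : {poly C}) :
  (size p <= N.+1)%N -> c0 p = z ^+ N * c1 (revpoly N p).
Proof.
move=> sp; rewrite -chart1_rev ?size_poly //; congr c0.
apply/polyP => i; rewrite !coef_poly.
case: ltnP => [iN|]; last by move=> ?; rewrite nth_default // (leq_trans sp).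
by rewrite ltnS leq_subr subKn // -ltnS.
Qed.

(** Such pairs are the sections of O(e): z^i on [U0] corresponds to w^(e-i) on [U1]. Multiplying by
    a large power of z makes both sides polynomials, whose coefficients are compared. *)
Lemma glue_coef (e : int) (p q : {poly C}) : c0 p = z ^ e * c1 q ->
  [/\ forall i j : nat, e = i%:Z + j%:Z -> p`_i = q`_j,
      forall i : nat, e < i%:Z -> p`_i = 0 &
      forall j : nat, e < j%:Z -> q`_j = 0].
Proof.
move=> epq; have [N sN] : exists N, (size q <= N)%N by exists (size q).
have [M hM] : exists M : nat, 0 <= M%:Z + e by exists (absz e); lia.
have [K eK] : exists K : nat, (K%:Z = M%:Z + e)%R.
  by exists (absz (M%:Z + e)); lia.
have E : 'X^(N + M) * p = 'X^K * revpoly N q.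
  apply: chart0_inj; rewrite !rmorphM !rmorphXn /= !chart0X epq.
  rewrite (chart1_rev (leqW sN)) exprD !exprnP eK expfzDr ?zcoord_neq0 //.
  by ring.
have coE i : ('X^(N + M) * p)`_i = ('X^K * revpoly N q)`_i by rewrite E.
have p_i i : p`_i = if (i + (N + M) < K)%N then 0
    else if (i + (N + M) - K < N.+1)%N then q`_(N - (i + (N + M) - K)) else 0.
  by have := coE (i + (N + M))%N;
    rewrite !coefXnM ltnNge leq_addl /= addnK coef_poly.
split=> [i j ij|i ei|j ej].
- rewrite p_i; case: ltnP => h1.
    by rewrite nth_default // (leq_trans sN) //; lia.
  rewrite ifT; last by lia.
  rewrite (_ : (N - _)%N = j) //; lia.
- by rewrite p_i; case: ltnP => h1 //; rewrite ifF //; lia.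
have [sj|sj] := ltnP j N; last by rewrite nth_default // (leq_trans sN).
have := coE (K + (N - j))%N; rewrite !coefXnM ifT; last by lia.
rewrite ifF; last by lia.
rewrite addKn coef_poly ifT; last by lia.
by rewrite subKn 1?ltnW // => ->.
Qed.

Lemma chart1_eq0 q : (c1 q == 0) = (q == 0).
Proof.
apply/eqP/eqP => [q0|->]; last by rewrite rmorph0.
apply/polyP => j; rewrite coef0.
have /glue_coef[_ _] : c0 0 = z ^ (-1) * c1 q by rewrite q0 mulr0 rmorph0.
by apply.
Qed.

Lemma chart1_inj : injective c1.
Proof.
move=> p q /eqP; rewrite -subr_eq0 -rmorphB /= chart1_eq0 subr_eq0.
by move/eqP.
Qed.

Lemma glue_const (p q : {poly C}) : c0 p = c1 q -> p = (p`_0)%:P /\ q = (p`_0)%:P.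
Proof.
move=> pq; have /glue_coef[h1 h2 h3] : c0 p = z ^ 0 * c1 q.
  by rewrite expr0z mul1r.
split; apply/polyP => -[|i]; rewrite coefC //=; first exact: h2.
  by rewrite (h1 0%N 0%N).
exact: h3.
Qed.

Lemma glue_unit (e : int) (p q : {poly C}) :
  c0 p = z ^ e * c1 q -> p != 0 -> 0 <= e.
Proof.
move=> /glue_coef[_ h _] p0; rewrite leNgt; apply/negP => e0.
by move/eqP: p0; apply; apply/polyP=> i; rewrite coef0; apply: h; lia.
Qed.

Lemma glue_size (e : int) (p q : {poly C}) (N : nat) :
  c0 p = z ^ e * c1 q -> e < N%:Z -> (size p <= N)%N /\ (size q <= N)%N.
Proof.
move=> /glue_coef[_ h1 h2] eN; split; apply/leq_sizeP => i iN.
  by apply: h1; lia.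
by apply: h2; lia.
Qed.

Lemma laurentP (x : F) : laurent x <-> exists p m, x * z ^+ m = c0 p.
Proof.
by split=> -[p [m e]]; exists p, m; [rewrite e divfK|rewrite -e mulfK];
  rewrite // expf_neq0 ?zcoord_neq0.
Qed.

Lemma laurent0 p : laurent (c0 p).
Proof. by apply/laurentP; exists p, 0%N; rewrite mulr1. Qed.

Lemma laurent1 p : laurent (c1 p).
Proof.
apply/laurentP; exists (revpoly (size p) p), (size p).
by rewrite chart1_rev ?leqW // mulrC.
Qed.

Lemma laurentM (x y : F) : laurent x -> laurent y -> laurent (x * y).
Proof.
move=> /laurentP[p [m h]] /laurentP[q [l h']]; apply/laurentP.
by exists (p * q), (m + l)%N; rewrite rmorphM /= -h -h' exprD mulrACA.
Qed.

Lemma laurentD (x y : F) : laurent x -> laurent y -> laurent (x + y).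
Proof.
move=> /laurentP[p [m h]] /laurentP[q [l h']]; apply/laurentP.
exists (p * 'X^l + q * 'X^m), (m + l)%N.
by rewrite rmorphD !rmorphM /= -h -h' !rmorphXn /= chart0X exprD; ring.
Qed.

Lemma laurentN (x : F) : laurent x -> laurent (- x).
Proof.
by move=> /laurentP[p [m h]]; apply/laurentP; exists (- p), m;
  rewrite mulNr h rmorphN.
Qed.

Lemma laurentXz (e : int) : laurent (z ^ e).
Proof.
case: e => n; rewrite /exprz -?chart0X -?rmorphXn; first exact: laurent0.
by exists 1, n.+1; rewrite rmorph1 mul1r rmorphXn.
Qed.

Lemma laurent_sum (I : finType) (f : I -> F) :
  (forall i, laurent (f i)) -> laurent (\sum_i f i).
Proof.
move=> h; apply: (big_ind (laurent (C:=C))) => //; last exact: laurentD.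
by rewrite -(rmorph0 c0); exact: laurent0.
Qed.

Lemma laurent_mulmx m n p (A : 'M[F]_(m, n)) (B : 'M_(n, p)) :
  laurent_mx A -> laurent_mx B -> laurent_mx (A *m B).
Proof. by move=> hA hB i j; rewrite mxE; apply: laurent_sum => k; apply: laurentM. Qed.

Lemma laurent_mx0 m n (A : 'M[{poly C}]_(m, n)) : laurent_mx (map_mx c0 A).
Proof. by move=> i j; rewrite mxE; apply: laurent0. Qed.

Lemma laurent_mx1 m n (A : 'M[{poly C}]_(m, n)) : laurent_mx (map_mx c1 A).
Proof. by move=> i j; rewrite mxE; apply: laurent1. Qed.

Lemma laurent_mxN m n (A : 'M[F]_(m, n)) : laurent_mx A -> laurent_mx (- A).
Proof. by move=> h i j; rewrite mxE; apply: laurentN. Qed.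

Lemma laurent_block m1 m2 n1 n2 (A : 'M[F]_(m1, n1)) (B : 'M_(m1, n2))
    (D : 'M_(m2, n1)) (E : 'M_(m2, n2)) :
  laurent_mx (block_mx A B D E) <->
  [/\ laurent_mx A, laurent_mx B, laurent_mx D & laurent_mx E].
Proof.
split=> [h|[hA hB hD hE] i j].
  split=> i j.
  - by rewrite -(block_mxEul A B D E).
  - by rewrite -(block_mxEur A B D E).
  - by rewrite -(block_mxEdl A B D E).
  - by rewrite -(block_mxEdr A B D E).
rewrite -(splitK i) -(splitK j); case: (split i) => ?; case: (split j) => ? /=.
- by rewrite block_mxEul.
- by rewrite block_mxEur.
- by rewrite block_mxEdl.
- by rewrite block_mxEdr.
Qed.

Definition zdiag n (e : 'I_n -> int) : 'M[F]_n := diag_mx (\row_i z ^ e i).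

Lemma laurent_zdiag n (e : 'I_n -> int) : laurent_mx (zdiag e).
Proof.
move=> i j; rewrite !mxE; case: eqP => _; rewrite ?mulr1n ?mulr0n.
  exact: laurentXz.
by rewrite -(rmorph0 c0); exact: laurent0.
Qed.

Lemma zdiagV n (e : 'I_n -> int) : zdiag e *m zdiag (fun i => - e i) = 1%:M.
Proof.
rewrite mulmx_diag -diag_const_mx; congr diag_mx; apply/rowP => i.
by rewrite !mxE -expfzDr ?zcoord_neq0 // subrr.
Qed.

Lemma det_zdiag n (e : 'I_n -> int) : \det (zdiag e) = z ^ (\sum_i e i).
Proof.
rewrite det_diag; under eq_bigr do rewrite mxE.
elim/big_ind2: _ => [|x1 x2 y1 y2 -> ->|//]; first by rewrite expr0z.
by rewrite expfzDr ?zcoord_neq0.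
Qed.

End Charts.

(** * Row reduction over C[z] *)

Section RowReduction.
Variable C : closedFieldType.
Local Notation c0 := (@chart0 C).
Local Notation c1 := (@chart1 C).

Definition rowsize m n (M : 'M[{poly C}]_(m, n)) (i : 'I_m) : nat :=
  \max_j size (M i j).

(** Coefficients are taken at the degree of the whole row, not entry by entry; for a zero row the
    predecessor gives index 0 and the row stays zero. *)
Definition leadmx m n (M : 'M[{poly C}]_(m, n)) : 'M[C]_(m, n) :=
  \matrix_(i, j) (M i j)`_(rowsize M i).-1.

(** Independence of the leading rows of the nonzero rows; zero rows are left unconstrained, since M
    may have dependent rows. *)
Definition row_reduced m n (M : 'M[{poly C}]_(m, n)) : Prop :=
  forall c : 'rV[C]_m, c *m leadmx M = 0 ->
    forall i, rowsize M i != 0%N -> c 0 i = 0.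

Lemma rowsize_le m n (M : 'M[{poly C}]_(m, n)) i j :
  (size (M i j) <= rowsize M i)%N.
Proof. exact: (leq_bigmax (F := fun j => size (M i j))). Qed.

Lemma rowsize_eq0 m n (M : 'M[{poly C}]_(m, n)) i j :
  rowsize M i = 0%N -> M i j = 0.
Proof.
by move=> h; apply/eqP; rewrite -size_poly_eq0 -leqn0 -h rowsize_le.
Qed.

(* The row of maximal size in the support of a relation between leading rows  *)
(* is replaced by the combination of shifted rows whose leading terms cancel. *)
Lemma row_reduce_step m n (M : 'M[{poly C}]_(m, n)) :
  ~ row_reduced M ->
  exists2 P, P \in unitmx & (\sum_i rowsize (P *m M) i < \sum_i rowsize M i)%N.
Proof.
move=> /existsNP[c /not_implyP[cM /existsNP[i0 /not_implyP[s0 /eqP c0n]]]].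
pose Q i := (rowsize M i != 0%N) && (c 0 i != 0).
have Qi0 : Q i0 by rewrite /Q s0.
case: (arg_maxnP (fun i => rowsize M i) Qi0) => i /andP[si ci] maxi.
pose d j : {poly C} :=
  if Q j && (j != i) then (c 0 j / c 0 i)%:P * 'X^(rowsize M i - rowsize M j) else 0.
pose D : 'M[{poly C}]_m := \matrix_(k, j) if k == i then d j else 0.
have di : d i = 0 by rewrite /d eqxx andbF.
(* Only row i of [D] is nonzero and its diagonal entry vanishes, so 1 + D is unimodular with inverse
   1 - D. *)
have DD : D *m D = 0.
  apply/matrixP => k l; rewrite !mxE big1 // => j _; rewrite !mxE.
  case: (k == i); rewrite ?mul0r //.
  by case: (j =P i) => [->|_]; rewrite ?di ?mul0r ?mulr0.
have PM k l : ((1%:M + D) *m M) k l =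
    if k == i then \sum_j (if j == i then 1 else d j) * M j l else M k l.
  rewrite mulmxDl mul1mx !mxE; case: eqP => [->|/eqP ki].
    rewrite [RHS](bigD1 i) //= eqxx mul1r (bigD1 i) //= mxE eqxx di mul0r add0r.
    by congr (_ + _); apply: eq_bigr => j /negPf ->; rewrite mxE eqxx.
  by rewrite big1 ?addr0 // => j _; rewrite mxE (negPf ki) mul0r.
exists (1%:M + D).
  suff: (1%:M + D) *m (1%:M - D) = 1%:M by case/mulmx1_unit.
  by rewrite mulmxDl mul1mx mulmxBr mulmx1 DD subr0 addrNK.
rewrite [X in (X < _)%N](bigD1 i) //= [X in (_ < X)%N](bigD1 i) //=.
rewrite [X in (_ + X < _)%N](eq_bigr (rowsize M)) => [|k /negPf ki]; last first.
  by apply: eq_bigr => l _; rewrite PM ki.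
rewrite ltn_add2r -(prednK (n := rowsize M i)) ?lt0n // ltnS.
apply/bigmax_leqP => l _; rewrite PM eqxx.
have sz j : (size (((if j == i then 1 else d j) * M j l)%R : {poly C}) <= rowsize M i)%N.
  case: eqP => [->|/eqP ji]; first by rewrite mul1r rowsize_le.
  rewrite /d ji andbT; case: ifP => [/[dup] Qj /andP[sj cj]|]; last first.
    by rewrite mul0r size_poly0.
  rewrite -mulrA mul_polyC (leq_trans (size_scale_leq _ _)) //.
  have [->|Mn0] := eqVneq (M j l) 0; first by rewrite mulr0 size_poly0.
  rewrite mulrC size_mulXn //.
  have := rowsize_le M j l; have := maxi j Qj; lia.
apply/leq_sizeP => e; rewrite leq_eqVlt => /orP[/eqP<-|le].
  have /matrixP/(_ 0 l) := cM; rewrite !mxE => /(congr1 (fun x => x / c 0 i)).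
  rewrite mul0r mulr_suml => E; rewrite -[RHS]E coef_sum; apply: eq_bigr => j _.
  rewrite mxE; case: eqP => [->|/eqP ji].
    by rewrite mul1r mulrAC divff // mul1r.
  rewrite /d ji andbT; case: ifP => [/[dup] Qj /andP[sj cj]|/negbT].
    rewrite -mulrA mul_polyC coefZ coefXnM mulrAC; have := maxi j Qj.
    move: sj si => /= sj si h; rewrite ifF; last by lia.
    by congr (_ * _); rewrite (_ : (_.-1 - _)%N = (rowsize M j).-1) //; lia.
  rewrite /Q negb_and !negbK => /orP[/eqP h|/eqP ->].
    by rewrite (rowsize_eq0 l h) mulr0 !coef0 mulr0 mul0r.
  by rewrite !mul0r coef0.
rewrite coef_sum big1 // => j _; apply/(leq_sizeP _ (rowsize M i)) => //.
by move: si le => /=; lia.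
Qed.

Lemma row_reduce m n (M : 'M[{poly C}]_(m, n)) :
  exists2 P, P \in unitmx & row_reduced (P *m M).
Proof.
have [N] := ubnP (\sum_i rowsize M i)%N; elim: N => // N IH in M *.
rewrite ltnS => le; have [r|/row_reduce_step[P uP lt]] := pselect (row_reduced M).
  by exists 1%:M; rewrite ?unitmx1 ?mul1mx.
have [Q uQ rQ] := IH _ (leq_trans lt le).
by exists (Q *m P); rewrite ?unitmx_mul ?uQ // -mulmxA.
Qed.

(** The rows of M read on [U1], each reversed at its own degree. Its value at w = 0 is the leading
    matrix, so row reducedness becomes a rank condition at infinity. *)
Definition revmx m n (M : 'M[{poly C}]_(m, n)) : 'M[{poly C}]_(m, n) :=
  \matrix_(i, j) revpoly (rowsize M i).-1 (M i j).

Lemma revmxE m n (M : 'M[{poly C}]_(m, n)) :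
  map_mx c0 M = zdiag C (fun i => (rowsize M i).-1%:Z) *m map_mx c1 (revmx M).
Proof.
apply/matrixP => i j; rewrite mul_diag_mx !mxE -rev_chart0 //.
have := rowsize_le M i j; case: (rowsize M i) => //= .
by rewrite leqn0 => /eqP ->.
Qed.

Lemma revmx0 m n (M : 'M[{poly C}]_(m, n)) :
  map_mx (horner^~ 0) (revmx M) = leadmx M.
Proof.
by apply/matrixP => i j; rewrite !mxE horner_coef0 coef_poly /= subn0.
Qed.

End RowReduction.

(** * Generic injectivity and unimodular splittings over C[z] *)

Section Decompositions.
Variable C : closedFieldType.
Local Notation F := (ratfun C).
Local Notation z := (zcoord C).
Local Notation c0 := (@chart0 C).
Local Notation c1 := (@chart1 C).

(* generic injectivity, with a witness that survives both c0 and c1 *)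
Definition minj m n (A : 'M[{poly C}]_(m, n)) : Prop :=
  exists L : 'M_(n, m), exists2 d, d != 0 & L *m A = d%:M.

Lemma minj_mulI (f : {rmorphism {poly C} -> F}) m n p (A : 'M_(m, n))
    (X Y : 'M_(n, p)) :
  injective f -> minj A -> map_mx f A *m X = map_mx f A *m Y -> X = Y.
Proof.
move=> fI [L [d d0 LA]] /(congr1 (mulmx (map_mx f L))).
rewrite !mulmxA -map_mxM LA map_scalar_mx !mul_scalar_mx.
by apply: scalerI; rewrite -(rmorph0 f) (inj_eq fI).
Qed.

Lemma minj_chart0I m n p (A : 'M_(m, n)) (X Y : 'M_(n, p)) :
  minj A -> map_mx c0 A *m X = map_mx c0 A *m Y -> X = Y.
Proof. by apply: (minj_mulI (f := c0)); apply: chart0_inj. Qed.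

Lemma map_chart0_inj m n : injective (map_mx c0 : 'M_(m, n) -> 'M_(m, n)).
Proof.
move=> A B /matrixP E; apply/matrixP => i j.
by have := E i j; rewrite !mxE => /chart0_inj.
Qed.

Lemma map_chart1_inj m n : injective (map_mx c1 : 'M_(m, n) -> 'M_(m, n)).
Proof.
move=> A B /matrixP E; apply/matrixP => i j.
by have := E i j; rewrite !mxE => /chart1_inj.
Qed.

Lemma minjI m n p (A : 'M_(m, n)) (X Y : 'M_(n, p)) :
  minj A -> A *m X = A *m Y -> X = Y.
Proof.
move=> iA /(congr1 (map_mx c0)); rewrite !map_mxM => /(minj_chart0I iA).
exact: map_chart0_inj.
Qed.

Lemma minjM m n p (A : 'M_(m, n)) (B : 'M_(n, p)) :
  minj A -> minj B -> minj (A *m B).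
Proof.
move=> [L [d d0 LA]] [L' [d' d0' LB]]; exists (L' *m L).
exists (d * d'); first by rewrite mulf_neq0.
rewrite mulmxA -(mulmxA L') LA scalar_mxC -mulmxA LB.
by rewrite -scalar_mxM.
Qed.

Lemma minj_mulr m n p (A : 'M_(m, n)) (B : 'M_(n, p)) :
  minj (A *m B) -> minj B.
Proof. by move=> [L [d d0 LA]]; exists (L *m A); exists d; rewrite // -mulmxA. Qed.

Lemma minj_linv m n (A : 'M_(m, n)) (L : 'M_(n, m)) : L *m A = 1%:M -> minj A.
Proof. by move=> e; exists L; exists 1; rewrite ?oner_neq0. Qed.

Lemma minj_unit n (A : 'M_n) : A \in unitmx -> minj A.
Proof. by move=> /mulVmx; apply: minj_linv. Qed.

Lemma minj_det n (A : 'M_n) : minj A <-> \det A != 0.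
Proof.
split=> [[L [d d0 /(congr1 determinant)]]|d0].
  rewrite det_mulmx det_scalar => E; apply: contraNneq (expf_neq0 n d0) => dA.
  by rewrite -E dA mulr0.
by exists (\adj A); exists (\det A); rewrite ?mul_adj_mx.
Qed.

Lemma minj_rank (f : {rmorphism {poly C} -> F}) m n (A : 'M_(m, n)) :
  injective f -> minj A -> \rank (map_mx f A) = n.
Proof.
move=> fI [L [d d0 LA]]; apply/eqP; rewrite eqn_leq rank_leq_col /=.
have fd : f d != 0 by rewrite -(rmorph0 f) (inj_eq fI).
have : \rank ((f d)%:M : 'M_n) = n.
  by rewrite -scalemx1 mxrank_scale_nz // mxrank1.
by rewrite -(map_scalar_mx f) -LA map_mxM => {1}<-; rewrite mxrankM_maxr.
Qed.

Lemma minj_rank0 m n (A : 'M_(m, n)) : minj A -> \rank (map_mx c0 A) = n.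
Proof. by apply: (minj_rank (f := c0)); apply: chart0_inj. Qed.

Lemma minj_leq m n (A : 'M_(m, n)) : minj A -> (n <= m)%N.
Proof. by move/minj_rank0 => <-; rewrite rank_leq_row. Qed.

Lemma minj_eval m n (A : 'M[{poly C}]_(m, n)) (x : C) :
  \rank (map_mx (horner^~ x) A) = n -> minj A.
Proof.
move=> rA; have /row_fullP[B BA] : row_full (map_mx (horner^~ x) A).
  by rewrite /row_full rA.
have /minj_det/minj_mulr// : \det (map_mx polyC B *m A) != 0.
apply/eqP => /(congr1 (horner_eval x)); rewrite -det_map_mx map_mxM /=.
rewrite -map_mx_comp (_ : map_mx _ B = B) ?rmorph0; last first.
  by apply/matrixP => i j; rewrite !mxE /= /horner_eval hornerC.
rewrite (_ : map_mx _ A = map_mx (horner^~ x) A) // BA det1.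
by move/eqP; rewrite oner_eq0.
Qed.

(** The leading matrix has a right inverse B, so the determinant of [revmx M] times B is 1 at w = 0,
    hence nonzero; [revmxE] carries this over to M times B. *)
Lemma row_reduced_minj m n (M : 'M[{poly C}]_(m, n)) :
  row_reduced M -> (forall i, rowsize M i != 0%N) -> minj M^T.
Proof.
move=> rM nz.
have /row_freeP[B LB] : row_free (leadmx M).
  rewrite -kermx_eq0; apply/eqP/row_matrixP => k; rewrite row0.
  apply/rowP => i; rewrite [RHS]mxE; apply: (rM) => //.
  by rewrite -row_mul mulmx_ker row0.
pose B' : 'M[{poly C}]_(n, m) := map_mx polyC B.
have dZ : \det (revmx M *m B') != 0.
  apply/eqP => /(congr1 (horner_eval 0)); rewrite -det_map_mx map_mxM /=.
  rewrite -map_mx_comp (_ : map_mx _ B = B) ?rmorph0; last first.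
    by apply/matrixP => i j; rewrite !mxE /= /horner_eval hornerC.
  rewrite (_ : map_mx _ (revmx M) = leadmx M) ?LB ?det1 -?revmx0 //.
  by move/eqP; rewrite oner_eq0.
have B'E : map_mx c1 B' = map_mx c0 B'.
  by apply/matrixP => i j; rewrite !mxE chart1C.
have dMB : \det (M *m B') != 0.
  rewrite -chart0_eq0 -(det_map_mx c0) map_mxM revmxE -B'E -mulmxA -map_mxM.
  rewrite det_mulmx mulf_neq0 //; last by rewrite det_map_mx chart1_eq0.
  by rewrite det_zdiag expfz_neq0 // zcoord_neq0.
exists (B' *m \adj (M *m B'))^T; exists (\det (M *m B')) => //.
by rewrite -trmx_mul mulmxA mul_mx_adj tr_scalar_mx.
Qed.

Lemma mulmx_slices (m n p : nat) (V : 'M[{poly C}]_(m, n)) (U : 'M_(n, p))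
    (Z : {set 'I_n}) :
  colsub (enum_val (A := mem Z)) V *m rowsub (enum_val (A := mem Z)) U +
  colsub (enum_val (A := mem (~: Z))) V *m rowsub (enum_val (A := mem (~: Z))) U
  = V *m U.
Proof.
apply/matrixP => i j; rewrite !mxE.
under eq_bigr do rewrite !mxE; under [X in _ + X]eq_bigr do rewrite !mxE.
rewrite -(big_enum_val (A := mem Z) (fun k => V i k * U k j)).
rewrite -(big_enum_val (A := mem (~: Z)) (fun k => V i k * U k j)) /=.
rewrite [RHS](bigID (mem Z)) /=; congr (_ + _).
by apply: eq_bigl => k; rewrite inE.
Qed.

(** A splitting of C[z]^m by a unimodular P that row reduces M: [Pk] and [Pg] are the rows of P
    giving zero and nonzero rows of the product, [Ik] and [Ig] the matching columns of the inverse
    of P. *)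
Variant compress_spec m n (M : 'M[{poly C}]_(m, n)) : Prop :=
  CompressSpec m1 m2 (Pk : 'M_(m1, m)) (Pg : 'M_(m2, m)) (Ik : 'M_(m, m1))
    (Ig : 'M_(m, m2)) of Ik *m Pk + Ig *m Pg = 1%:M & Pk *m Ik = 1%:M
    & Pg *m Ig = 1%:M & Pk *m Ig = 0 & Pg *m Ik = 0
    & Pk *m M = 0 & minj (Pg *m M)^T & (m1 + m2 = m)%N.

Lemma compress m n (M : 'M[{poly C}]_(m, n)) : compress_spec M.
Proof.
have [P uP rP] := row_reduce M; set N := P *m M in rP.
pose Z := [set i | rowsize N i == 0%N].
pose f := enum_val (A := mem Z); pose g := enum_val (A := mem (~: Z)).
have fI : injective f := enum_val_inj (A := mem Z).
have gI : injective g := enum_val_inj (A := mem (~: Z)).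
have fg i j : (f i == g j) = false.
  apply/eqP => fgE; have := enum_valP (A := mem Z) i.
  have := enum_valP (A := mem (~: Z)) j; rewrite -/(f i) -/(g j) fgE /= inE.
  by move/negP.
have sub1 q (h : 'I_q -> 'I_m) : injective h -> rowsub h P *m colsub h (invmx P) = 1%:M.
  move=> hI; rewrite mulmx_colsub mul_rowsub_mx mulmxV //.
  by apply/matrixP => i j; rewrite !mxE (inj_eq hI).
apply: (@CompressSpec _ _ _ _ _ (rowsub f P) (rowsub g P)
  (colsub f (invmx P)) (colsub g (invmx P))).
- by rewrite mulmx_slices mulVmx.
- exact: sub1.
- exact: sub1.
- rewrite mulmx_colsub mul_rowsub_mx mulmxV //.
  by apply/matrixP => i j; rewrite !mxE fg.
- rewrite mulmx_colsub mul_rowsub_mx mulmxV //.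
  by apply/matrixP => i j; rewrite !mxE eq_sym fg.
- apply/matrixP => i j; rewrite mul_rowsub_mx -/N mxE [RHS]mxE.
  by apply: rowsize_eq0; apply/eqP; have := enum_valP (A := mem Z) i; rewrite /= inE.
- have rgN i : rowsize (rowsub g N) i = rowsize N (g i).
    by apply: eq_bigr => j _; rewrite mxE.
  rewrite mul_rowsub_mx -/N; apply: row_reduced_minj => [c cN i _|i]; last first.
    by have := enum_valP (A := mem (~: Z)) i; rewrite rgN /= !inE.
  have := rP (c *m rowsub g 1%:M); rewrite -mulmxA mul_rowsub_mx mul1mx.
  rewrite (_ : rowsub g _ = leadmx (rowsub g N)); last first.
    by apply/matrixP => a b; rewrite !mxE rgN.
  move/(_ cN (g i)); have := enum_valP (A := mem (~: Z)) i.
  rewrite /= !inE -/(g i) => h /(_ h); rewrite mxE (bigD1 i) //= big1 ?addr0.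
    by rewrite !mxE eqxx mulr1.
  by move=> k ki; rewrite !mxE (inj_eq gI) (negPf ki) mulr0.
rewrite -[RHS](card_ord m) -(cardC (mem Z)); congr (_ + _)%N.
by apply: eq_card => i; rewrite !inE.
Qed.

Lemma laurent_clear m n (A : 'M[F]_(m, n)) : laurent_mx A ->
  exists N M, z ^+ N *: A = map_mx c0 M.
Proof.
move=> lA.
have /choice[f fP] : forall ij, exists pm : {poly C} * nat,
    A ij.1 ij.2 * z ^+ pm.2 = c0 pm.1.
  by move=> [i j]; have /laurentP[p [k h]] := lA i j; exists (p, k).
pose N := \max_ij (f ij).2; exists N.
exists (\matrix_(i, j) ('X^(N - (f (i, j)).2) * (f (i, j)).1)).
apply/matrixP => i j; rewrite !mxE rmorphM rmorphXn /= chart0X -fP /=.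
rewrite mulrCA -exprD subnK 1?mulrC //.
exact: (leq_bigmax (F := fun ij => (f ij).2) (i, j)).
Qed.

(** After clearing denominators, x gives a polynomial dividing a power of z, hence a constant times
    a power of z. *)
Lemma laurent_unit (x y : F) : laurent x -> laurent y -> x * y = 1 ->
  exists2 c : C, c != 0 & exists e : int, x = c0 c%:P * z ^ e.
Proof.
move=> /laurentP[p [m xp]] /laurentP[q [l yq]] xy.
have pq : p * q = 'X^(m + l).
  apply: chart0_inj; rewrite rmorphM rmorphXn /= chart0X -xp -yq mulrACA xy.
  by rewrite mul1r exprD.
have : p %| ('X - 0%:P) ^+ (m + l) by rewrite subr0 -pq dvdp_mulr.
move=> /dvdp_exp_XsubCP[k _ /eqpf_eq[c c0n pE]].
exists c => //; exists (k%:Z - m%:Z).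
apply: (mulIf (expf_neq0 m (zcoord_neq0 C))); rewrite xp pE -mul_polyC subr0.
rewrite rmorphM rmorphXn /= chart0X -mulrA; congr (_ * _).
by rewrite exprnP exprnP -expfzDr ?zcoord_neq0 // subrK.
Qed.

End Decompositions.

(** * Finite-dimensional subspaces *)

Section Dimension.
Variable K : fieldType.

Lemma complement_rows p q r (A : 'M[K]_(p, q)) : (r + p <= q)%N ->
  exists B : 'M[K]_(r, q), forall c : 'rV_r, (c *m B <= A)%MS -> c = 0.
Proof.
move=> rpq; exists (pid_mx r *m row_base A^C%MS) => c cA.
have cC : (c *m (pid_mx r *m row_base A^C%MS) <= A^C)%MS.
  by rewrite mulmxA (submx_trans (submxMl _ _)) // eq_row_base.
have : (c *m (pid_mx r *m row_base A^C%MS) <= A :&: A^C)%MS.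
  by rewrite sub_capmx cA.
rewrite capmx_compl submx0 mulmxA => /eqP E.
have rC : (r <= \rank A^C%MS)%N.
  by rewrite mxrank_compl; have := rank_leq_row A; lia.
have /row_freeP[Q QE] := row_base_free A^C%MS.
move: E => /(congr1 (mulmx^~ Q)); rewrite mul0mx -mulmxA QE mulmx1.
move=> /(congr1 (mulmx^~ (pid_mx r : 'M_(_, r)))); rewrite mul0mx -mulmxA pid_mx_id //.
by rewrite pid_mx_1 mulmx1.
Qed.

Variable V : lmodType K.

Definition lcomb k (b : 'I_k -> V) (c : 'rV[K]_k) : V := \sum_i c 0 i *: b i.
Definition inspan k (b : 'I_k -> V) (v : V) : Prop := exists c, v = lcomb b c.
Definition lfree k (b : 'I_k -> V) : Prop := forall c, lcomb b c = 0 -> c = 0.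
Definition subspace (S : set V) : Prop :=
  S 0 /\ forall a u v, S u -> S v -> S (a *: u + v).
Definition dims (S : set V) (k : nat) : Prop :=
  exists2 b : 'I_k -> V, (forall v, S v <-> inspan b v) & lfree b.

Lemma lcomb_is_linear k (b : 'I_k -> V) a c d :
  lcomb b (a *: c + d) = a *: lcomb b c + lcomb b d.
Proof.
rewrite /lcomb scaler_sumr -big_split; apply: eq_bigr => i _.
by rewrite !mxE scalerDl scalerA.
Qed.

Lemma lcomb0 k (b : 'I_k -> V) : lcomb b 0 = 0.
Proof. by rewrite /lcomb big1 // => i _; rewrite mxE scale0r. Qed.

Lemma lcombZ k (b : 'I_k -> V) a c : lcomb b (a *: c) = a *: lcomb b c.
Proof. by rewrite -[a *: c]addr0 lcomb_is_linear lcomb0 addr0. Qed.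

Lemma lcombD k (b : 'I_k -> V) c d : lcomb b (c + d) = lcomb b c + lcomb b d.
Proof. by rewrite -{1}[c]scale1r lcomb_is_linear scale1r. Qed.

Lemma lcombB k (b : 'I_k -> V) c d : lcomb b (c - d) = lcomb b c - lcomb b d.
Proof. by rewrite -(scaleN1r d) lcombD lcombZ scaleN1r. Qed.

Lemma lcomb_mul k l (b : 'I_k -> V) (A : 'M_(l, k)) (c : 'rV_l) :
  lcomb (fun i => lcomb b (row i A)) c = lcomb b (c *m A).
Proof.
rewrite mulmx_sum_row (big_morph _ (lcombD b) (lcomb0 b)).
by apply: eq_bigr => i _; rewrite lcombZ.
Qed.

Lemma lcomb_delta k (b : 'I_k -> V) i : lcomb b (delta_mx 0 i) = b i.
Proof.
rewrite /lcomb (bigD1 i) //= mxE !eqxx scale1r big1 ?addr0 // => j ji.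
by rewrite mxE (negPf ji) andbF scale0r.
Qed.

Lemma lcomb_recr k (b : 'I_k.+1 -> V) c :
  lcomb b c = lcomb (fun i => b (widen_ord (leqnSn k) i))
                (\row_i c 0 (widen_ord (leqnSn k) i)) + c 0 ord_max *: b ord_max.
Proof.
by rewrite /lcomb big_ord_recr /=; congr (_ + _); apply: eq_bigr => i _; rewrite mxE.
Qed.

Lemma subspace_inspan k (b : 'I_k -> V) : subspace (inspan b).
Proof.
split=> [|a _ _ [c ->] [d ->]]; first by exists 0; rewrite lcomb0.
by exists (a *: c + d); rewrite lcomb_is_linear.
Qed.

Lemma dims_subspace S k : dims S k -> subspace S.
Proof.
move=> [b bS _]; have [h0 h] := subspace_inspan b.
split=> [|a u v]; first exact/bS.
by move=> /bS hu /bS hv; apply/bS/h.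
Qed.

Lemma subspaceZ S a v : subspace S -> S v -> S (a *: v).
Proof. by move=> [h0 h] Sv; rewrite -[_ *: _]addr0; apply: h. Qed.

Lemma subspaceD S u v : subspace S -> S u -> S v -> S (u + v).
Proof. by move=> [h0 h] Su Sv; rewrite -[u]scale1r; apply: h. Qed.

Lemma subspaceB S u v : subspace S -> S u -> S v -> S (u - v).
Proof. by move=> [h0 h] Su Sv; rewrite addrC -scaleN1r; apply: h. Qed.

Lemma subspace_sum S (I : finType) (u : I -> V) :
  subspace S -> (forall i, S (u i)) -> S (\sum_i u i).
Proof.
by move=> sS Su; apply: big_ind => //; [case: sS|move=> ? ?; apply: subspaceD].
Qed.

Lemma subspace_lcomb S k (b : 'I_k -> V) c :
  subspace S -> (forall i, S (b i)) -> S (lcomb b c).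
Proof. by move=> sS Sb; apply: subspace_sum => // i; apply: subspaceZ. Qed.

Lemma dims_basis S k (b : 'I_k -> V) i :
  (forall v, S v <-> inspan b v) -> S (b i).
Proof. by move=> h; apply/h; exists (delta_mx 0 i); rewrite lcomb_delta. Qed.

(** Each vector of [w] costs at most one dimension. Given r + 1 combinations independent modulo all
    but the last vector, the coefficient rows whose combination falls into the full span lie on a
    line, and r directions can be chosen off it. *)
Lemma independent_mod_span p q r (v : 'I_q -> V) (w : 'I_p -> V) :
  lfree v -> (r + p <= q)%N ->
  exists A : 'M[K]_(r, q), forall c, inspan w (lcomb v (c *m A)) -> c = 0.
Proof.
move=> fv; elim: p w r => [|p IH] w r rpq.
  have [A AP] := @complement_rows 0 q r 0 rpq.
  exists A => c [y]; rewrite [RHS]big_ord0 => /fv cA; apply: AP.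
  by rewrite cA sub0mx.
pose w' i := w (widen_ord (leqnSn p) i).
have [] := IH w' r.+1; first by lia.
move=> A AP.
have [c0 c0P] : exists c0 : 'rV_(r.+1), forall c, inspan w (lcomb v (c *m A)) ->
    (c <= c0)%MS.
  have [[c0 c0n [y0 c0w]]|no] := pselect (exists2 c0 : 'rV_(r.+1), c0 != 0 &
      inspan w (lcomb v (c0 *m A))); last first.
    exists 0 => c cw; suff -> : c = 0 by rewrite sub0mx.
    apply/eqP/negPn/negP => c0n.
    by apply: no; exists c.
  exists c0 => c [y cw]; move: c0w cw; rewrite !lcomb_recr -/w' => c0w cw.
  set be := y0 0 ord_max in c0w; set y0' := \row_i _ in c0w.
  set y' := \row_i _ in cw.
  (* Independence modulo [w'] forces the last coordinate of this relation to be nonzero; it can then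
     cancel the last coordinate of any other relation. *)
  have be0 : be != 0.
    apply: contra_neq c0n => be0; apply: AP; rewrite c0w be0 scale0r addr0.
    by exists y0'.
  suff : c - (y 0 ord_max / be) *: c0 = 0.
    by move/subr0_eq => ->; rewrite scalemx_sub.
  apply: AP; rewrite mulmxBl -scalemxAl lcombB lcombZ cw c0w.
  exists (y' - (y 0 ord_max / be) *: y0').
  rewrite lcombB lcombZ scalerDr scalerA divfK //.
  by rewrite opprD addrACA subrr addr0.
have [] := @complement_rows 1 r.+1 r c0; first by lia.
move=> B BP; exists (B *m A) => c; rewrite mulmxA => /c0P; exact: BP.
Qed.

Lemma lfree_le p q (v : 'I_q -> V) (w : 'I_p -> V) :
  lfree v -> (forall i, inspan w (v i)) -> (q <= p)%N.
Proof.
move=> fv vw; rewrite leqNgt; apply/negP => pq.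
have [] := @independent_mod_span p q 1 v w fv; first by lia.
move=> A /(_ 1%:M) h; have : (1%:M : 'M[K]_1) 0 0 = 0.
  by rewrite h ?mxE //; apply: subspace_lcomb => //; apply: subspace_inspan.
by move/eqP; rewrite mxE oner_eq0.
Qed.

Lemma dims_uniq S k k' : dims S k -> dims S k' -> k = k'.
Proof.
move=> [b bS fb] [b' bS' fb']; apply/eqP; rewrite eqn_leq.
apply/andP; split.
  by apply: (lfree_le (w := b') fb) => i; apply/bS'; exact: dims_basis bS.
by apply: (lfree_le (w := b) fb') => i; apply/bS; exact: dims_basis bS'.
Qed.

Lemma lfree_extend k (b : 'I_k -> V) v : lfree b -> ~ inspan b v ->
  lfree (fun i : 'I_k.+1 => if unlift ord_max i is Some j then b j else v).
Proof.
move=> fb nv c; rewrite lcomb_recr unlift_none.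
set b' := fun i : 'I_k => _; have b'E : b' = b.
  apply: funext => i; rewrite /b' (_ : widen_ord _ i = lift ord_max i) ?liftK //.
  by apply: val_inj; rewrite /= /bump leqNgt ltn_ord.
rewrite b'E; set c' := \row_i _ => E.
have cm : c 0 ord_max = 0.
  apply: contra_notP nv => /eqP cm; exists ((c 0 ord_max)^-1 *: - c').
  rewrite lcombZ -(scaleN1r c') lcombZ scaleN1r (addr0_eq E) scalerA.
  by rewrite mulVf ?scale1r.
move: E; rewrite cm scale0r addr0 => /fb c'0; apply/rowP => i; rewrite mxE.
case: (unliftP ord_max i) => [j ->|-> //]; move/rowP/(_ j): c'0; rewrite !mxE.
by move<-; congr (c _ _); apply: val_inj; rewrite /= /bump leqNgt ltn_ord.
Qed.

(** A free family in S is extended as long as it does not span; the bound on lengths stops the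
    process. *)
Lemma dims_bounded S p : subspace S ->
  (forall k (b : 'I_k -> V), lfree b -> (forall i, S (b i)) -> (k <= p)%N) ->
  exists2 k, (k <= p)%N & dims S k.
Proof.
move=> sS bd.
suff H : forall m k (b : 'I_k -> V), lfree b -> (forall i, S (b i)) ->
    (p - k <= m)%N -> exists k', dims S k'.
  have [||k dk] := H p 0%N (fun _ => 0) _ _ (leq_subr _ _).
  - by move=> c _; apply/rowP => -[].
  - by case.
  exists k => //; case: (dk) => b bS fb; apply: (bd _ b) => // i.
  exact: dims_basis bS.
elim=> [|m IH] k b fb Sb pk.
all: have [h|/existsNP[v /not_implyP[Sv nv]]] := pselect (forall v, S v -> inspan b v).
1,3: by exists k, b => // v; split=> [|[c ->]]; [exact: h|exact: subspace_lcomb].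
all: have fe := lfree_extend fb nv.
all: have Se : forall i, S ((fun i : 'I_k.+1 =>
  if unlift ord_max i is Some j then b j else v) i) by move=> i; case: unliftP.
all: have kp := bd _ _ fe Se.
  by lia.
by apply: (IH _ _ fe Se); lia.
Qed.

Lemma dims_sub S S' p : subspace S -> dims S' p -> (forall v, S v -> S' v) ->
  exists2 k, (k <= p)%N & dims S k.
Proof.
move=> sS [w wS fw] SS'; apply: dims_bounded => // k b fb Sb.
by apply: (lfree_le fb) => i; apply/wS/SS'.
Qed.

Lemma dims_full S S' k : dims S k -> dims S' k -> (forall v, S v -> S' v) ->
  forall v, S' v -> S v.
Proof.
move=> [b bS fb] [w wS fw] SS' v Sv; apply: contrapT => nv.
have nv' : ~ inspan b v by move=> /bS.
have := lfree_le (w := w) (lfree_extend fb nv'); rewrite ltnn => h.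
suff : false by []. apply: h => i; case: unliftP => [j _|_]; apply/wS => //.
by apply/SS'/bS; exists (delta_mx 0 j); rewrite lcomb_delta.
Qed.

End Dimension.

(** * Dimensions of kernels, images and preimages *)

Section Maps.
Variables (K : fieldType) (U V : lmodType K) (f : {linear U -> V}).

Lemma linear_lcomb k (b : 'I_k -> U) c : f (lcomb b c) = lcomb (f \o b) c.
Proof. by rewrite linear_sum; apply: eq_bigr => i _; rewrite linearZ. Qed.

Lemma dims_preim S p : injective f -> dims S p ->
  exists2 k, (k <= p)%N & dims [set u | S (f u)]%classic k.
Proof.
move=> fI dS; have [h0 h] := dims_subspace dS.
apply: dims_bounded => [|k b fb Sb].
  by split=> [|a u v] /=; rewrite ?linear0 // linearP; apply: h.
case: dS => w wS fw; apply: (@lfree_le _ _ _ _ (f \o b) w) => [c|i].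
  2: by apply/wS; exact: Sb.
by rewrite -linear_lcomb -(linear0 f) => /fI/fb.
Qed.

Lemma dims_extension (S : set U) k1 k2 : subspace S ->
  dims (S `&` [set u | f u = 0])%classic k1 -> dims (f @` S)%classic k2 ->
  dims S (k1 + k2).
Proof.
move=> sS [b1 b1S fb1] [b2 b2S fb2].
have /choice[g gP] : forall i, exists u, S u /\ f u = b2 i.
  by move=> i; have [u Su <-] := dims_basis i b2S; exists u.
pose b i := match split i with inl i1 => b1 i1 | inr i2 => g i2 end.
have bE c : lcomb b c = lcomb b1 (lsubmx c) + lcomb g (rsubmx c).
  rewrite /lcomb big_split_ord; congr (_ + _); apply: eq_bigr => i _.
    by rewrite mxE /b (unsplitK (inl i)).
  by rewrite mxE /b (unsplitK (inr i)).
have Sb1 i : (S `&` [set u | f u = 0])%classic (b1 i) by exact: (dims_basis i b1S).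
have fg c : f (lcomb g c) = lcomb b2 c.
  by rewrite linear_lcomb; congr lcomb; apply: funext => i; have [_] := gP i.
have fb1_0 c : f (lcomb b1 c) = 0.
  by have [_] : (S `&` [set u | f u = 0])%classic (lcomb b1 c) by apply/b1S; exists c.
exists b => [u|c].
  split=> [Su|[c ->]]; last first.
    rewrite bE; apply: subspaceD => //; apply: subspace_lcomb => // i.
      by have [] := Sb1 i.
    by have [] := gP i.
  have [c2 c2E] : inspan b2 (f u) by apply/b2S; exists u.
  have [c1 c1E] : inspan b1 (u - lcomb g c2).
    apply/b1S; split; last by rewrite /= linearB /= fg c2E subrr.
    by apply: subspaceB => //; apply: subspace_lcomb => // i; have [] := gP i.
  exists (row_mx c1 c2); rewrite bE row_mxKl row_mxKr.
  by rewrite -c1E subrK.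
rewrite bE => E; have /fb2 r0 : lcomb b2 (rsubmx c) = 0.
  by rewrite -fg -[LHS]add0r -(fb1_0 (lsubmx c)) -linearD E linear0.
move: E; rewrite r0 lcomb0 addr0 => /fb1 l0.
by rewrite -(hsubmxK c) l0 r0 row_mx0.
Qed.

Lemma dims_split (S : set U) k : dims S k ->
  exists k1 k2, [/\ dims (S `&` [set u | f u = 0])%classic k1,
    dims (f @` S)%classic k2 & k = (k1 + k2)%N].
Proof.
move=> dS; have sS := dims_subspace dS.
have [|||k1 _ d1] := @dims_sub _ _ (S `&` [set u | f u = 0])%classic S k.
- split=> [|a u v [Su fu] [Sv fv]].
    by split; [case: sS|rewrite /= linear0].
  by split; [apply: sS.2|rewrite /= linearP fu fv scaler0 addr0].
- exact: dS.
- by move=> u [].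
have [||k2 _ d2] := @dims_bounded _ _ (f @` S)%classic k.
- split=> [|a _ _ [u Su <-] [v Sv <-]].
    by exists 0; [case: sS|rewrite linear0].
  by exists (a *: u + v); [apply: sS.2|rewrite linearP].
- move=> l b fb Sb; case: dS => w wS fw.
  apply: (@lfree_le _ _ _ _ b (f \o w)) => // i.
  have [u /wS[c ->] <-] := Sb i; exists c; exact: linear_lcomb.
exists k1, k2; split=> //; apply: dims_uniq dS _.
exact: dims_extension.
Qed.

Lemma dims_image (S : set U) k : injective f -> dims S k -> dims (f @` S)%classic k.
Proof.
move=> fI [b bS fb]; exists (f \o b) => [v|c].
  split=> [[u /bS[c ->] <-]|[c ->]]; first by exists c; rewrite linear_lcomb.
  by exists (lcomb b c); [apply/bS; exists c|rewrite linear_lcomb].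
by rewrite -linear_lcomb -(linear0 f) => /fI/fb.
Qed.

End Maps.

(** * Bundles on the projective line *)

Lemma mulf_divC (K : fieldType) (s q x y b a : K) : x != 0 -> y != 0 ->
  s * q = y * (b * (a * x)) -> b * a = s * (x^-1 / y) * q.
Proof.
move=> x0 y0 E; rewrite mulrAC E; field.
by rewrite x0 y0.
Qed.

Section Bundles.
Variable C : closedFieldType.
Local Notation F := (ratfun C).
Local Notation z := (zcoord C).
Local Notation c0 := (@chart0 C).
Local Notation c1 := (@chart1 C).

Lemma laurent_det n (A : 'M[F]_n) : laurent_mx A -> laurent (\det A).
Proof.
move=> lA; have lc (c : C) : laurent (c0 c%:P) by exact: laurent0.
apply: laurent_sum => s; apply: laurentM.
  by rewrite -(rmorph1 c0) -rmorphN -rmorphXn; apply: laurent0.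
elim/big_ind: _ => //; last exact: laurentM.
by rewrite -(rmorph1 c0); apply: laurent0.
Qed.

Lemma poly_unitP (p : {poly C}) : p \is a GRing.unit -> exists2 c, c != 0 & p = c%:P.
Proof.
rewrite poly_unitE => /andP[/size_poly1P[c c0n ->] _]; by exists c.
Qed.

Lemma polyC_unit (c : C) : c != 0 -> c%:P \is a GRing.unit.
Proof. by move=> c0n; rewrite poly_unitE size_polyC c0n coefC unitfE. Qed.

Lemma monomial_deg (a b : C) (d e : int) : a != 0 -> b != 0 ->
  c0 a%:P * z ^ d = c0 b%:P * z ^ e -> d = e.
Proof.
have H (c c' : C) (i j : int) : c != 0 -> c0 c%:P * z ^ i = c0 c'%:P * z ^ j ->
    i <= j.
  move=> cn E; rewrite -subr_ge0; apply: (@glue_unit _ _ c%:P c'%:P).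
    rewrite chart1C expfzDr ?zcoord_neq0 // mulrAC [z ^ j * _]mulrC -E.
    by rewrite -mulrA -expfzDr ?zcoord_neq0 // subrr expr0z mulr1.
  by rewrite polyC_eq0.
by move=> an bn E; apply/eqP; rewrite eq_le (H a b) ?(H b a).
Qed.

Lemma has_degree_uniq n (E : vbundle C n) d e :
  has_degree E d -> has_degree E e -> d = e.
Proof. by move=> [a a0 h] [b b0]; rewrite h; apply: monomial_deg. Qed.

Lemma trans_mulV n (E : vbundle C n) : trans E *m invmx (trans E) = 1%:M.
Proof. exact: mulmxV (trans_unit E). Qed.

Lemma trans_Vmul n (E : vbundle C n) : invmx (trans E) *m trans E = 1%:M.
Proof. exact: mulVmx (trans_unit E). Qed.

Lemma has_degree_ex n (E : vbundle C n) : exists d, has_degree E d.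
Proof.
have [|c cn [e h]] := laurent_unit (laurent_det (@trans_laurent _ _ E))
    (laurent_det (@trans_inv_laurent _ _ E)).
  by rewrite -det_mulmx trans_mulV det1.
by exists e, c.
Qed.

Lemma unitmx_map (f : {rmorphism {poly C} -> F}) n (P : 'M_n) :
  P \in unitmx -> map_mx f P \in unitmx.
Proof. by rewrite !unitmxE det_map_mx; apply: rmorph_unit. Qed.

(* Birkhoff-Grothendieck: once the rows of P z^N T are reduced, the matrix of  *)
(* reversed polynomials is invertible at w = 0, and its determinant is, up to *)
(* a constant, a power of z; hence it is invertible over C[w].                *)
Lemma birkhoff_grothendieck n (E : vbundle C n) :
  exists e : 'I_n -> int, exists P Q : 'M[{poly C}]_n,
    [/\ P \in unitmx, Q \in unitmx &
        trans E = map_mx c0 P *m zdiag C e *m map_mx c1 Q].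
Proof.
have [N [M TM]] := laurent_clear (@trans_laurent _ _ E).
have [P uP rP] := row_reduce M; set R := P *m M in rP.
have c0R : map_mx c0 R = z ^+ N *: (map_mx c0 P *m trans E).
  by rewrite map_mxM -TM -scalemxAr.
have uc0P : map_mx c0 P \in unitmx by apply: unitmx_map.
have zN : z ^+ N != 0 by rewrite expf_neq0 ?zcoord_neq0.
have uR : map_mx c0 R \in unitmx.
  have zu : z ^+ N \is a GRing.unit by rewrite unitfE.
  by rewrite c0R (unitmxZ _ zu) unitmx_mul uc0P (trans_unit E).
have nz i : rowsize R i != 0%N.
  apply: contraL uR => /eqP Ri; rewrite -row_free_unit -kermx_eq0.
  apply/eqP => k0; suff : delta_mx 0 i = 0 :> 'rV[F]_n.
    by move/rowP/(_ i)/eqP; rewrite !mxE !eqxx oner_eq0.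
  apply/eqP; rewrite -submx0 -k0; apply/sub_kermxP; rewrite -rowE.
  by apply/rowP => j; rewrite [RHS]mxE mxE mxE (rowsize_eq0 j Ri) rmorph0.
have ul : leadmx R \in unitmx.
  rewrite -row_free_unit -kermx_eq0; apply/eqP/row_matrixP => k; rewrite row0.
  apply/rowP => i; rewrite [RHS]mxE; apply: (rP) => //.
  by rewrite -row_mul mulmx_ker row0.
have q0 : (\det (revmx R))`_0 != 0.
  rewrite -horner_coef0 -[_.[0]]/(horner_eval 0 _) -det_map_mx.
  rewrite (_ : map_mx _ _ = map_mx (horner^~ 0) (revmx R)) // revmx0.
  by rewrite -unitfE.
have [d [a a0 dT]] := has_degree_ex E.
have [b b0 dP] : exists2 c, c != 0 & \det P = c%:P by apply: poly_unitP.
pose s (i : 'I_n) : int := (rowsize R i).-1%:Z.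
have : c0 (b * a)%:P = z ^ (\sum_i s i - d - (N * n)%N%:Z) * c1 (\det (revmx R)).
  have := congr1 determinant c0R; rewrite [in LHS]revmxE det_mulmx det_zdiag.
  rewrite -/s detZ det_mulmx !det_map_mx dT dP -exprM => E1.
  rewrite !expfzDr ?zcoord_neq0 // -!invr_expz -exprnP -mulrA polyCM rmorphM.
  by apply: mulf_divC E1; rewrite ?expf_neq0 ?expfz_neq0 ?zcoord_neq0.
(* A nonzero constant is now glued to [\det (revmx R)] as a section of O(e'). The nonzero constant
   term of the latter forces e' >= 0, and it equals the coefficient of degree e' of a constant, so
   e' = 0 and the determinant is constant. *)
set e' := (X in z ^ X) => E1.
have [h1 h2 h3] := glue_coef E1.
have e0 : 0 <= e'.
  by rewrite leNgt; apply/negP => lt; move: q0; rewrite h3 ?eqxx.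
have e'0 : e' = 0.
  have /h1 E2 : e' = (absz e')%:Z + 0%N%:Z by lia.
  move: q0; rewrite -E2 coefC; case: (absz e' =P 0%N) => [|_]; first by lia.
  by rewrite eqxx.
have uL : revmx R \in unitmx.
  rewrite unitmxE; suff -> : \det (revmx R) = (b * a)%:P.
    by rewrite polyC_unit ?mulf_neq0.
  by apply: (@chart1_inj C); rewrite chart1C E1 e'0 expr0z mul1r.
exists (fun i => s i - N%:Z), (invmx P), (revmx R).
split; rewrite ?unitmx_inv //.
have : map_mx c0 P *m trans E = z ^- N *: map_mx c0 R.
  by rewrite c0R scalerA (mulVf zN) scale1r.
move=> /(congr1 (mulmx (map_mx c0 (invmx P)))).
rewrite mulmxA -map_mxM mulVmx // map_mx1 mul1mx => ->.
rewrite (revmxE R) -mulmxA; congr (_ *m _). rewrite scalemxAl.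
congr (_ *m _); apply/matrixP => i j; rewrite !mxE.
case: eqP => _; rewrite ?mulr0n ?mulr0 ?mulr1n //.
by rewrite mulrC expfzDr ?zcoord_neq0 // exprnN.
Qed.

Lemma degree_BG n (E : vbundle C n) d (e : 'I_n -> int) (P Q : 'M[{poly C}]_n) :
  P \in unitmx -> Q \in unitmx ->
  trans E = map_mx c0 P *m zdiag C e *m map_mx c1 Q -> has_degree E d ->
  d = \sum_i e i.
Proof.
move=> uP uQ TE hd; apply: has_degree_uniq hd _.
have [b b0 dP] : exists2 c, c != 0 & \det P = c%:P by apply: poly_unitP.
have [a a0 dQ] : exists2 c, c != 0 & \det Q = c%:P by apply: poly_unitP.
exists (b * a); first by rewrite mulf_neq0.
rewrite TE !det_mulmx det_zdiag !det_map_mx dP dQ polyCM rmorphM /=.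
by rewrite mulrAC chart1C.
Qed.

(** Up to nonzero scalars the determinants of [D0] and [D1] form a nonzero section of O(d - d').
    When the degrees agree this is a nonzero constant, so both matrices are invertible. *)
Lemma degree_change n (E E' : vbundle C n) (D0 D1 : 'M[{poly C}]_n) d d' :
  map_mx c0 D0 *m trans E' = trans E *m map_mx c1 D1 ->
  minj D0 -> minj D1 -> has_degree E d -> has_degree E' d' ->
  d' <= d /\ (d' = d -> D0 \in unitmx /\ D1 \in unitmx).
Proof.
move=> DE /minj_det D00 /minj_det D10 [a a0 dE] [b b0 dE'].
have E1 : c0 (b *: \det D0) = z ^ (d - d') * c1 (a *: \det D1).
  have := congr1 determinant DE; rewrite !det_mulmx dE dE' !det_map_mx.
  rewrite -!mul_polyC !rmorphM /= chart1C expfzDr ?zcoord_neq0 // => E1.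
  have -> : c0 b%:P * c0 (\det D0) = c0 (\det D0) * (c0 b%:P * z ^ d') * z ^ (- d').
    rewrite -!mulrA -expfzDr ?zcoord_neq0 // subrr expr0z mulr1.
    by rewrite mulrC.
  by rewrite E1; ring.
have nz : b *: \det D0 != 0 by rewrite scaler_eq0 negb_or b0.
have := glue_unit E1 nz; split; first by lia.
move=> dd; move: E1; rewrite dd subrr expr0z mul1r => /glue_const[h1 h2].
have c00 : (b *: \det D0)`_0 != 0.
  by apply: contraNneq nz => h; rewrite h1 h.
rewrite !unitmxE; split.
  rewrite (_ : \det D0 = b^-1 *: (b *: \det D0)).
    by rewrite h1 -mul_polyC -polyCM polyC_unit ?mulf_neq0 ?invr_eq0.
  by rewrite scalerA mulVf // scale1r.
rewrite (_ : \det D1 = a^-1 *: (a *: \det D1)).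
  by rewrite h2 -mul_polyC -polyCM polyC_unit ?mulf_neq0 ?invr_eq0.
by rewrite scalerA mulVf // scale1r.
Qed.

Lemma hom_minj m n (E' : vbundle C m) (E : vbundle C n) (f : bhom E' E) :
  subbundle_map f -> minj (hom0 f) /\ minj (hom1 f).
Proof. by move=> /(_ 0)[h h']; split; apply: minj_eval; eauto. Qed.

Lemma rank_eval_linv m n (A : 'M[{poly C}]_(m, n)) (L : 'M_(n, m)) (x : C) :
  L *m A = 1%:M -> \rank (map_mx (fun p : {poly C} => p.[x]) A) = n.
Proof.
move=> LA; apply/eqP; rewrite eqn_leq rank_leq_col /=.
have := congr1 (map_mx (horner_eval x)) LA; rewrite map_mxM map_mx1 => E.
by rewrite -[X in (X <= _)%N](mxrank1 C n) -E mxrankM_maxr.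
Qed.

(** The image of M saturates to the direct summand spanned by the block [Ig] of [compress];
    injectivity of M and independence of the rows of [Pg *m M] bound its rank from both sides by
    m. *)
Lemma saturate_chart m n (M : 'M[{poly C}]_(n, m)) : minj M ->
  exists (h : 'M_(n, m)) (L : 'M_(m, n)) (D : 'M_m),
    [/\ L *m h = 1%:M, M = h *m D & minj D].
Proof.
move=> iM; case: (compress M) => m1 m2 Pk Pg Ik Ig E1 _ E2 _ _ kM gM _.
have ME : M = Ig *m (Pg *m M).
  by rewrite -{1}[M]mul1mx -E1 mulmxDl -mulmxA kM mulmx0 add0r mulmxA.
have m12 : m2 = m.
  apply/eqP; rewrite eqn_leq (minj_leq gM) /=.
  by apply: (@minj_leq _ _ _ (Pg *m M)); apply: (@minj_mulr _ _ _ _ Ig); rewrite -ME.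
subst m2; exists Ig, Pg, (Pg *m M); split=> //.
by apply: (@minj_mulr _ _ _ _ Ig); rewrite -ME.
Qed.

(** The saturated images on the two charts are glued by [T]. The left inverses [L0] and [L1] express
    [T] and its inverse without denominators, so both are Laurent. *)
Lemma saturation m n (E' : vbundle C m) (E : vbundle C n) (f : bhom E' E) :
  minj (hom0 f) -> minj (hom1 f) ->
  exists (E2 : vbundle C m) (h : bhom E2 E) (D : bhom E' E2),
    [/\ subbundle_map h, hom0 f = hom0 h *m hom0 D, hom1 f = hom1 h *m hom1 D,
        minj (hom0 D) & minj (hom1 D)].
Proof.
move=> /saturate_chart[h0 [L0 [D0 [L0h f0E iD0]]]].
move=> /saturate_chart[h1 [L1 [D1 [L1h f1E iD1]]]].
have uD0 : map_mx c0 D0 \in unitmx.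
  by rewrite unitmxE det_map_mx unitfE chart0_eq0; apply/minj_det.
have uD1 : map_mx c1 D1 \in unitmx.
  by rewrite unitmxE det_map_mx unitfE chart1_eq0; apply/minj_det.
pose T := map_mx c0 D0 *m trans E' *m invmx (map_mx c1 D1).
have uT : T \in unitmx by rewrite !unitmx_mul uD0 trans_unit unitmx_inv.
have hT : map_mx c0 h0 *m T = trans E *m map_mx c1 h1.
  rewrite /T !mulmxA -map_mxM -f0E hom_glue f1E map_mxM -!mulmxA (mulmxV uD1).
  by rewrite mulmx1.
have TE : T = map_mx c0 L0 *m trans E *m map_mx c1 h1.
  by rewrite -mulmxA -hT mulmxA -map_mxM L0h map_mx1 mul1mx.
have TVE : invmx T = map_mx c1 L1 *m invmx (trans E) *m map_mx c0 h0.
  apply: (can_inj (mulmxK uT)); rewrite (mulVmx uT) -!mulmxA hT.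
  by rewrite (mulmxA _ (trans E)) trans_Vmul mul1mx -map_mxM L1h map_mx1.
have lT : laurent_mx T.
  rewrite TE; apply: laurent_mulmx; last exact: laurent_mx1.
  by apply: laurent_mulmx; [exact: laurent_mx0|exact: trans_laurent].
have lTV : laurent_mx (invmx T).
  rewrite TVE; apply: laurent_mulmx; last exact: laurent_mx0.
  by apply: laurent_mulmx; [exact: laurent_mx1|exact: trans_inv_laurent].
pose E2 := VBundle uT lT lTV.
have DT : map_mx c0 D0 *m trans E' = trans E2 *m map_mx c1 D1.
  by rewrite -[trans E2]/T /T (mulmxKV uD1).
exists E2, (@BHom _ _ _ E2 E h0 h1 hT), (BHom DT); split=> //= x.
by split; apply: rank_eval_linv; eauto.
Qed.

End Bundles.

(** * Spaces of sections as vector spaces over C *)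

Local Open Scope classical_set_scope.

(* restriction of scalars from {poly C} to C, as done by cscale *)
Definition resC (C : closedFieldType) (M : lmodType {poly C}) : Type := M.

Section ResC.
Variables (C : closedFieldType) (M : lmodType {poly C}).

HB.instance Definition _ := GRing.Zmodule.copy (resC M) M.

Definition resC_scale (a : C) (x : resC M) : resC M := a%:P *: (x : M).

Fact resC_scaleA a b x : resC_scale a (resC_scale b x) = resC_scale (a * b) x.
Proof. by rewrite /resC_scale scalerA polyCM. Qed.
Fact resC_scale1 : left_id 1 resC_scale.
Proof. by move=> x; rewrite /resC_scale scale1r. Qed.
Fact resC_scaleDr : right_distributive resC_scale +%R.
Proof. by move=> a x y; rewrite /resC_scale scalerDr. Qed.
Fact resC_scaleDl x : {morph resC_scale^~ x : a b / a + b}.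
Proof. by move=> a b; rewrite /resC_scale polyCD scalerDl. Qed.

HB.instance Definition _ := GRing.Zmodule_isLmodule.Build C (resC M)
  resC_scaleA resC_scale1 resC_scaleDr resC_scaleDl.

End ResC.

Definition sections (C : closedFieldType) (n : nat) : lmodType C :=
  resC ('cV[{poly C}]_n * 'cV[{poly C}]_n)%type.

(** No gluing condition is imposed, so the same linear map serves for homomorphisms, for changes of
    basis and for inclusions and projections of blocks. *)
Definition secmul (C : closedFieldType) m n (A B : 'M[{poly C}]_(n, m))
  (s : sections C m) : sections C n := (A *m s.1, B *m s.2).

Section SecMul.
Variables (C : closedFieldType) (m n : nat) (A B : 'M[{poly C}]_(n, m)).

Fact secmul_is_linear : linear (secmul A B).
Proof.
by move=> a s t; congr pair; rewrite /= mulmxDr -scalemxAr.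
Qed.

HB.instance Definition _ := GRing.isLinear.Build C (sections C m) (sections C n)
  *:%R (secmul A B) secmul_is_linear.

Lemma secmul_inj : minj A -> minj B -> injective (secmul A B).
Proof. by move=> iA iB [s1 s2] [t1 t2] [/(minjI iA) -> /(minjI iB) ->]. Qed.

End SecMul.

Section Sections.
Variable C : closedFieldType.
Local Notation F := (ratfun C).
Local Notation z := (zcoord C).
Local Notation c0 := (@chart0 C).
Local Notation c1 := (@chart1 C).

Lemma secmulM m n p (A B : 'M[{poly C}]_(n, m)) (A' B' : 'M_(p, n)) s :
  secmul A' B' (secmul A B s) = secmul (A' *m A) (B' *m B) s.
Proof. by rewrite /secmul /= !mulmxA. Qed.

Lemma secmul1 n (s : sections C n) : secmul 1%:M 1%:M s = s.
Proof. by case: s => s t; rewrite /secmul /= !mul1mx. Qed.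

Lemma has_dimP n (V : set (chart_vec C n)) k :
  has_dim V k <-> dims (V : set (sections C n)) k.
Proof.
split=> [[b [bV fb]]|[b bV fb]]; exists b.
- move=> v; rewrite (bV v); split=> [[c ->]|[c ->]]; last by exists (c 0).
  by exists (\row_i c i); apply: eq_bigr => i _; rewrite mxE.
- by move=> c /fb h; apply/rowP => i; rewrite mxE; apply: h.
split=> [s|c c0E i].
  rewrite (bV s); split=> [[c ->]|[c ->]]; first by exists (c 0).
  by exists (\row_i c i); apply: eq_bigr => i _; rewrite mxE.
have /rowP/(_ i) : (\row_i c i) = 0.
  by apply: fb; rewrite -[RHS]c0E; apply: eq_bigr => j _; rewrite mxE.
by rewrite !mxE.
Qed.

(** For a subsheaf and a space V of sections of the ambient bundle this is the intersection of V
    with the sections of the subsheaf, the largest space a subsystem on it can carry. *)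
Definition pull m n (A B : 'M[{poly C}]_(n, m)) (V : set (sections C n)) :
  set (sections C m) := [set s | V (secmul A B s)].

Lemma H0_subspace n (E : vbundle C n) : subspace (H0 E : set (sections C n)).
Proof.
split; first by rewrite /H0 /= !map_mx0 mulmx0.
move=> a s t hs ht.
change (map_mx c0 (a%:P *: s.1 + t.1) =
  trans E *m map_mx c1 (a%:P *: s.2 + t.2)).
by rewrite !map_mxD !map_mxZ /= chart1C mulmxDr -scalemxAr -(hs : _ = _) -(ht : _ = _).
Qed.

Lemma cs_subspace n (X : cohsys C n) : subspace (cs_space X : set (sections C n)).
Proof. by split; [exact: cs_space0|exact: cs_space_lin]. Qed.

Lemma pull_H0 m n (E' : vbundle C m) (E : vbundle C n) (f : bhom E' E) s :
  minj (hom0 f) -> pull (hom0 f) (hom1 f) (H0 E) s <-> H0 E' s.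
Proof.
move=> i0; rewrite /pull /H0 /= !map_mxM mulmxA -hom_glue -mulmxA.
by split=> [/(minj_chart0I i0)|->].
Qed.

Lemma linearmx_le (K : fieldType) p q k (v : 'I_k -> 'M[K]_(p, q)) :
  lfree v -> (k <= p * q)%N.
Proof.
move=> fv; pose M := \matrix_i mxvec (v i).
have : row_free M.
  rewrite -kermx_eq0; apply/eqP/row_matrixP => i; rewrite row0; apply: fv.
  apply: (can_inj mxvecK); rewrite linear0.
  transitivity (row i (kermx M *m M)); last by rewrite mulmx_ker row0.
  rewrite row_mul mulmx_sum_row linear_sum; apply: eq_bigr => j _.
  by rewrite linearZ rowK.
by move=> /eqP <-; apply: rank_leq_col.
Qed.

Definition linesum n (b : int) : 'M[F]_n := zdiag C (fun _ => b).

Lemma linesumE n b : linesum n b = (z ^ b)%:M.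
Proof. by apply/matrixP => i j; rewrite !mxE. Qed.

(* Subsheaves of O(b)^n split into line bundles O(e_j) with e_j <= b. *)
Lemma sub_linesum m n (E' : vbundle C m) (E : vbundle C n) (f : bhom E' E)
    (b : nat) d' :
  trans E = linesum n b%:Z -> minj (hom0 f) -> minj (hom1 f) ->
  has_degree E' d' ->
  [/\ d' <= m%:Z * b%:Z,
      forall k, dims (H0 E' : set (sections C m)) k -> (k <= m * b.+1)%N &
      d' = m%:Z * b%:Z -> exists P Q (A : 'M[C]_(n, m)),
       [/\ P \in unitmx, Q \in unitmx, hom0 f *m P = map_mx polyC A,
           hom1 f *m Q = map_mx polyC A &
           trans E' = map_mx c0 P *m linesum m b%:Z *m invmx (map_mx c1 Q)]].
Proof.
move=> TE i0 i1 dE'; have [e [P [Q [uP uQ TE']]]] := birkhoff_grothendieck E'.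
pose p := hom0 f *m P; pose q := hom1 f *m invmx Q.
have pq i j : c0 (p i j) = z ^ (b%:Z - e j) * c1 (q i j).
  have := hom_glue f; rewrite TE' TE !mulmxA -map_mxM -/p => E1.
  have {E1} : map_mx c0 p *m zdiag C e = linesum n b%:Z *m map_mx c1 q.
    rewrite [in RHS]map_mxM mulmxA -E1 -mulmxA -map_mxM mulmxV // map_mx1.
    by rewrite mulmx1.
  move/matrixP/(_ i j); rewrite mul_mx_diag mul_diag_mx !mxE => E1.
  apply: (mulIf (expfz_neq0 (e j) (zcoord_neq0 C))); rewrite E1 mulrAC.
  by rewrite -expfzDr ?zcoord_neq0 // subrK.
have ip : minj p by apply: minjM => //; apply: minj_unit.
(* Column j of [p] is nonzero by generic injectivity, and its nonzero entries are sections of O(b -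
   e_j). *)
have eb j : 0 <= b%:Z - e j.
  have [i pn] : exists i, p i j != 0.
    apply: contrapT => /forallNP h.
    have /(minjI ip)/colP/(_ j)/eqP : p *m delta_mx j 0 = p *m (0 : 'cV_m).
      rewrite mulmx0 -colE; apply/colP => i; rewrite [LHS]mxE [RHS]mxE.
      by have /negP := h i; rewrite negbK => /eqP.
    by rewrite !mxE !eqxx oner_eq0.
  exact: glue_unit (pq i j) pn.
have dE := degree_BG uP uQ TE' dE'.
have mb : m%:Z * b%:Z - d' = \sum_j (b%:Z - e j).
  rewrite big_split /= sumrN -dE sumr_const card_ord -mulr_natl.
  by rewrite natz.
split.
- by rewrite -subr_ge0 mb sumr_ge0.
- move=> k [v vH fv].
  (* In split coordinates the entries of a section are polynomials of degree at most e_i <= b, so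
     their first b + 1 coefficients determine it. *)
  pose cf (s : sections C m) : 'M[C]_(m, b.+1) :=
    \matrix_(i, j) ((invmx P *m s.1) i 0)`_j.
  have cfl : linear cf.
    move=> a s t.
    have E1 : invmx P *m (a *: s + t).1 =
        a%:P *: (invmx P *m s.1) + invmx P *m t.1.
      by rewrite -[(_ + _).1]/(a%:P *: s.1 + t.1) mulmxDr -scalemxAr.
    apply/matrixP => i j; rewrite mxE E1 3![in RHS]mxE.
    by rewrite mxE [X in X + _]mxE mul_polyC coefD coefZ [cf t i j]mxE.
  pose cfL : {linear sections C m -> 'M[C]_(m, b.+1)} :=
    HB.pack cf (GRing.isLinear.Build _ _ _ _ cf cfl).
  apply: (@linearmx_le _ _ _ _ (cfL \o v)) => c; rewrite -linear_lcomb => c0E.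
  apply: fv; have : H0 E' (lcomb v c) by apply/vH; exists c.
  move: c0E; move: (lcomb v c) => s /= s0; rewrite /H0 /= TE' => sE.
  have sz i : (size ((invmx P *m s.1) i 0)%R <= b.+1)%N.
    have : map_mx c0 (invmx P *m s.1) = zdiag C e *m map_mx c1 (Q *m s.2).
      have PP : map_mx c0 (invmx P) *m map_mx c0 P = 1%:M.
        by rewrite -map_mxM mulVmx // map_mx1.
      by rewrite map_mxM sE map_mxM -!mulmxA (mulmxA _ (map_mx c0 P)) PP mul1mx.
    rewrite mul_diag_mx => /matrixP/(_ i 0) E1.
    have [||h _ //] := @glue_size _ (e i) ((invmx P *m s.1) i 0) ((Q *m s.2) i 0) b.+1.
      by move: E1; rewrite !mxE.
    by have := eb i; lia.
  have s10 : s.1 = 0.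
    suff Ps0 : invmx P *m s.1 = 0.
      by rewrite -[s.1]mul1mx -(mulmxV uP) -mulmxA Ps0 mulmx0.
    apply/colP => i; rewrite [RHS]mxE; apply/polyP => l; rewrite coef0.
    have [lb|h] := ltnP l b.+1; last by rewrite nth_default // (leq_trans (sz i)).
    by move/matrixP/(_ i (Ordinal lb)): s0; rewrite [LHS]mxE [RHS]mxE.
  have s20 : s.2 = 0.
    apply: (@map_chart1_inj C); apply: (can_inj (mulKmx (trans_unit E'))).
    by rewrite TE' -sE s10 !map_mx0 mulmx0.
  by rewrite (surjective_pairing s) s10 s20.
(* Nonnegative terms b - e_j with sum zero all vanish, so the entries of the map are sections of O,
   that is, constants. *)
move=> dmb; have e_b j : e j = b%:Z.
  have := mb; rewrite dmb subrr => /esym/eqP; rewrite psumr_eq0 //.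
  by move=> /allP/(_ j); rewrite mem_index_enum => /(_ isT) /=; lia.
have pqc i j : p i j = ((p i j)`_0)%:P /\ q i j = ((p i j)`_0)%:P.
  by apply: glue_const; rewrite pq e_b subrr expr0z mul1r.
exists P, (invmx Q), (\matrix_(i, j) (p i j)`_0); split; rewrite ?unitmx_inv //.
- apply/matrixP => i j; rewrite [RHS]mxE [X in _ = X%:P]mxE.
  exact: (pqc i j).1.
- apply/matrixP => i j; rewrite [RHS]mxE [X in _ = X%:P]mxE.
  exact: (pqc i j).2.
rewrite TE'; congr (_ *m _ *m _).
  by apply/matrixP => i j; rewrite !mxE e_b.
have E1 : map_mx c1 Q *m map_mx c1 (invmx Q) = 1%:M.
  by rewrite -map_mxM mulmxV // map_mx1.
have uQ1' : map_mx c1 (invmx Q) \in unitmx by apply: unitmx_map; rewrite unitmx_inv.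
by rewrite -[RHS]mul1mx -E1 mulmxK.
Qed.

End Sections.

(** * Extensions of bundles and their subsheaves *)

Section Extensions.
Variable C : closedFieldType.
Local Notation F := (ratfun C).
Local Notation c0 := (@chart0 C).
Local Notation c1 := (@chart1 C).

(** The transpose of [compress]: a basis of the source whose first block lies in the kernel of N and
    whose second block maps injectively. *)
Lemma compress_cols t m (N : 'M[{poly C}]_(t, m)) :
  exists m1 m2 (P : 'M_(m, m1 + m2)) (P' : 'M_(m1 + m2, m)) (G : 'M_(t, m2)),
    [/\ P *m P' = 1%:M, P' *m P = 1%:M, N *m P = row_mx 0 G, minj G
      & (m1 + m2)%N = m].
Proof.
case: (compress N^T) => m1 m2 Pk Pg Ik Ig E1 Ek Eg Ekg Egk kN gN mE.
exists m1, m2, (row_mx Pk^T Pg^T), (col_mx Ik^T Ig^T), (Pg *m N^T)^T; split=> //.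
- by rewrite mul_row_col -!trmx_mul -linearD E1 /= trmx1.
- rewrite mul_col_row -!trmx_mul Ek Eg Ekg Egk !trmx1 !trmx0.
  by rewrite -scalar_mx_block.
- rewrite mul_mx_row -[in LHS](trmxK N) -!trmx_mul kN trmx0.
  by rewrite !trmx_mul trmxK.
Qed.

Lemma minj_col0 m1 m2 p (K : 'M[{poly C}]_(m1, p)) :
  minj (col_mx K (0 : 'M_(m2, p))) -> minj K.
Proof.
move=> [L [d d0]]; rewrite -(hsubmxK L) mul_row_col mulmx0 addr0 => LK.
by exists (lsubmx L); exists d.
Qed.

(** As the lower left block of [T] vanishes, the upper left block of TV T and the lower right block
    of T TV are single products, so the diagonal blocks of [TV] invert those of [T]. *)
Lemma vbundle_block m1 m2 (T TV : 'M[F]_(m1 + m2)) :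
  T *m TV = 1%:M -> laurent_mx T -> laurent_mx TV -> dlsubmx T = 0 ->
  exists (E : vbundle C (m1 + m2)) (E1 : vbundle C m1) (E2 : vbundle C m2),
    [/\ trans E = T, trans E1 = ulsubmx T & trans E2 = drsubmx T].
Proof.
move=> TTV lT lTV dl; have TVT := mulmx1C TTV.
have lsub m n p q (A : 'M[F]_(m + n, p + q)) : laurent_mx A ->
    laurent_mx (ulsubmx A) /\ laurent_mx (drsubmx A).
  by rewrite -{1}[A]submxK => /laurent_block[].
have E1 : ulsubmx TV *m ulsubmx T = 1%:M.
  have := congr1 ulsubmx TVT.
  rewrite -{1}[TV]submxK -{1}[T]submxK mulmx_block block_mxKul dl mulmx0 addr0.
  by move=> ->; apply/matrixP => i j; rewrite !mxE (inj_eq (@lshift_inj _ _)).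
have E2 : drsubmx T *m drsubmx TV = 1%:M.
  have := congr1 drsubmx TTV.
  rewrite -{1}[TV]submxK -{1}[T]submxK mulmx_block block_mxKdr dl mul0mx add0r.
  by move=> ->; apply/matrixP => i j; rewrite !mxE (inj_eq (@rshift_inj _ _)).
have mk n (A B : 'M[F]_n) : A *m B = 1%:M -> laurent_mx A -> laurent_mx B ->
    exists E : vbundle C n, trans E = A.
  move=> AB lA lB; have [uA _] := mulmx1_unit AB.
  have VE : invmx A = B by rewrite -[B]mul1mx -(mulVmx uA) -mulmxA AB mulmx1.
  by rewrite -VE in lB; exists (VBundle uA lA lB).
have [lT1 lT2] := lsub _ _ _ _ T lT; have [lV1 lV2] := lsub _ _ _ _ TV lTV.
have [E EE] := mk _ _ _ TTV lT lTV.
have [E' EE'] := mk _ _ _ (mulmx1C E1) lT1 lV1.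
have [E'' EE''] := mk _ _ _ E2 lT2 lV2.
by exists E, E', E''.
Qed.

Lemma has_degree_block m1 m2 (E : vbundle C (m1 + m2)) (E1 : vbundle C m1)
    (E2 : vbundle C m2) B d1 d2 :
  trans E = block_mx (trans E1) B 0 (trans E2) ->
  has_degree E1 d1 -> has_degree E2 d2 -> has_degree E (d1 + d2).
Proof.
move=> EE [a a0 h1] [b b0 h2]; exists (a * b); first by rewrite mulf_neq0.
rewrite EE det_ublock h1 h2 polyCM rmorphM expfzDr ?zcoord_neq0 //.
exact: mulrACA.
Qed.

Lemma has_degree_iso n (E E' : vbundle C n) (A B : 'M[{poly C}]_n) d :
  map_mx c0 A *m trans E' = trans E *m map_mx c1 B ->
  A \in unitmx -> B \in unitmx -> has_degree E' d -> has_degree E d.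
Proof.
move=> AB uA uB dE'; have [d1 dE] := has_degree_ex E.
have [le1 _] := degree_change AB (minj_unit uA) (minj_unit uB) dE dE'.
have BA : map_mx c0 (invmx A) *m trans E = trans E' *m map_mx c1 (invmx B).
  have uA0 : map_mx c0 A \in unitmx by apply: unitmx_map.
  have uB1 : map_mx c1 B \in unitmx by apply: unitmx_map.
  have eA : map_mx c0 (invmx A) *m map_mx c0 A = 1%:M.
    by rewrite -map_mxM mulVmx // map_mx1.
  have eB : map_mx c1 B *m map_mx c1 (invmx B) = 1%:M.
    by rewrite -map_mxM mulmxV // map_mx1.
  rewrite -[trans E]mulmx1 -eB (mulmxA (trans E)) -AB -!mulmxA !mulmxA eA.
  by rewrite mul1mx.
have uA' : invmx A \in unitmx by rewrite unitmx_inv.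
have uB' : invmx B \in unitmx by rewrite unitmx_inv.
have [le2 _] := degree_change BA (minj_unit uA') (minj_unit uB') dE' dE.
by have -> : d = d1 by apply/eqP; rewrite eq_le le1 le2.
Qed.

Lemma has_degree_base_change l m (E : vbundle C m) (E' : vbundle C l)
    (A B : 'M[{poly C}]_(m, l)) (A' B' : 'M_(l, m)) d :
  l = m -> A *m A' = 1%:M -> B *m B' = 1%:M ->
  map_mx c0 A *m trans E' = trans E *m map_mx c1 B ->
  has_degree E' d -> has_degree E d.
Proof.
move=> lm; subst l => AA' BB' AB.
by apply: (has_degree_iso AB); [case: (mulmx1_unit AA')|case: (mulmx1_unit BB')].
Qed.

Lemma bhom_iso_unit n (E' E : vbundle C n) (f : bhom E' E) :
  hom0 f \in unitmx -> hom1 f \in unitmx -> bhom_iso f.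
Proof.
move=> u0 u1.
have gl : map_mx c0 (invmx (hom0 f)) *m trans E =
    trans E' *m map_mx c1 (invmx (hom1 f)).
  have e0 : map_mx c0 (invmx (hom0 f)) *m map_mx c0 (hom0 f) = 1%:M.
    by rewrite -map_mxM (mulVmx u0) map_mx1.
  have e1 : map_mx c1 (hom1 f) *m map_mx c1 (invmx (hom1 f)) = 1%:M.
    by rewrite -map_mxM (mulmxV u1) map_mx1.
  rewrite -[trans E]mulmx1 -e1 (mulmxA (trans E)) -hom_glue.
  by rewrite -!mulmxA !mulmxA e0 mul1mx.
exists (BHom gl); split.
- exact: (mulVmx u0).
- exact: (mulVmx u1).
- exact: (mulmxV u0).
- exact: (mulmxV u1).
Qed.

Definition inl_sec n1 n2 : sections C n1 -> sections C (n1 + n2) :=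
  secmul (col_mx 1%:M 0) (col_mx 1%:M 0).
Definition pr2_sec n1 n2 : sections C (n1 + n2) -> sections C n2 :=
  secmul (row_mx 0 1%:M) (row_mx 0 1%:M).
HB.instance Definition _ n1 n2 := GRing.Linear.on (@inl_sec n1 n2).
HB.instance Definition _ n1 n2 := GRing.Linear.on (@pr2_sec n1 n2).

Lemma inl_secE n1 n2 (s : sections C n1) :
  inl_sec n2 s = (col_mx s.1 0, col_mx s.2 0).
Proof. by congr pair; rewrite mul_col_mx mul1mx mul0mx. Qed.

Lemma pr2_secE n1 n2 (s : sections C (n1 + n2)) :
  pr2_sec s = (dsubmx s.1, dsubmx s.2).
Proof.
congr pair; [rewrite -{1}[s.1]vsubmxK|rewrite -{1}[s.2]vsubmxK].
all: by rewrite mul_row_col mul0mx add0r mul1mx.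
Qed.

Lemma inl_sec_inj n1 n2 : injective (@inl_sec n1 n2).
Proof.
have h : minj (col_mx 1%:M 0 : 'M[{poly C}]_(n1 + n2, n1)).
  by apply: (@minj_linv _ _ _ _ (row_mx 1%:M 0)); rewrite mul_row_col !mul1mx mul0mx addr0.
exact: secmul_inj.
Qed.

Definition sub_space n1 n2 (V : set (sections C (n1 + n2))) :
  set (sections C n1) := [set u | V (inl_sec n2 u)].
Definition quo_space n1 n2 (V : set (sections C (n1 + n2))) :
  set (sections C n2) := @pr2_sec n1 n2 @` V.

Lemma inl_sub_space n1 n2 (V : set (sections C (n1 + n2))) :
  @inl_sec n1 n2 @` sub_space V = V `&` [set u | pr2_sec u = 0].
Proof.
apply/seteqP; split=> [_ [u Vu <-]|u [Vu /=]].
  by split=> //; rewrite /= pr2_secE inl_secE /= !col_mxKd.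
rewrite pr2_secE => -[u1 u2].
have uE : inl_sec n2 (usubmx u.1, usubmx u.2) = u.
  by rewrite inl_secE /= -{1}u1 -{1}u2 !vsubmxK -surjective_pairing.
by exists (usubmx u.1, usubmx u.2); rewrite /sub_space /= uE.
Qed.

Lemma dims_subquo n1 n2 (V : set (sections C (n1 + n2))) k : dims V k ->
  exists k1 k2, [/\ dims (sub_space V) k1, dims (quo_space V) k2 & k = (k1 + k2)%N].
Proof.
move=> dV; have [k1 [k2 [d1 d2 kE]]] := dims_split (@pr2_sec n1 n2) dV.
exists k1, k2; split=> //.
have [k3 _ d3] := dims_preim (@inl_sec_inj n1 n2) dV.
have := dims_image (@inl_sec_inj n1 n2) d3.
by rewrite inl_sub_space => /(dims_uniq d1) ->.
Qed.

Lemma dims_subquo_ext n1 n2 (V : set (sections C (n1 + n2))) k1 k2 :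
  subspace V -> dims (sub_space V) k1 -> dims (quo_space V) k2 -> dims V (k1 + k2).
Proof.
move=> sV d1 d2; apply: (dims_extension (f := @pr2_sec n1 n2)) => //.
by have := dims_image (@inl_sec_inj n1 n2) d1; rewrite inl_sub_space.
Qed.

(* A subsheaf E' of an extension of E2 by E1, in bases adapted to the kernel  *)
(* EK and to the image EI of E' -> E2.                                        *)
Record subext n1 n2 (E1 : vbundle C n1) (E2 : vbundle C n2) (B : 'M[F]_(n1, n2))
    (V : set (sections C (n1 + n2))) (m : nat) (d' : int) (k' : nat) := SubExt {
  se1 : nat; se2 : nat;
  seK : vbundle C se1; seI : vbundle C se2;
  sek : bhom seK E1; sei : bhom seI E2;
  seT : 'M[F]_(se1, se2);
  seH0 : 'M[{poly C}]_(n1, se2); seH1 : 'M[{poly C}]_(n1, se2);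
  sedK : int; sedI : int; sekK : nat; sekI : nat;
  se_rank : (se1 + se2)%N = m;
  se_deg : sedK + sedI = d';
  se_dim : (k' <= sekK + sekI)%N;
  se_glue : map_mx c0 (hom0 sek) *m seT + map_mx c0 seH0 *m trans seI =
            trans E1 *m map_mx c1 seH1 + B *m map_mx c1 (hom1 sei);
  se_inj : [/\ minj (hom0 sek), minj (hom1 sek), minj (hom0 sei) & minj (hom1 sei)];
  se_degK : has_degree seK sedK;
  se_degI : has_degree seI sedI;
  se_dimK : dims (pull (hom0 sek) (hom1 sek) (sub_space V)) sekK;
  se_dimI : dims (pull (hom0 sei) (hom1 sei) (quo_space V)) sekI;
  se_lift : k' = (sekK + sekI)%N ->
    forall y, pull (hom0 sei) (hom1 sei) (quo_space V) y -> exists x : sections C se1,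
      V (col_mx (hom0 sek *m x.1 + seH0 *m y.1) (hom0 sei *m y.1),
         col_mx (hom1 sek *m x.2 + seH1 *m y.2) (hom1 sei *m y.2))
}.

(* Column reduction over C[z] and over C[w] makes E' -> E2 block-shaped on both *)
(* charts, with the same sizes since the generic ranks agree.                   *)
Lemma subext_exists n1 n2 (E1 : vbundle C n1) (E2 : vbundle C n2) B
    (E : vbundle C (n1 + n2)) V k0 m (E' : vbundle C m) (f : bhom E' E) d' k' :
  trans E = block_mx (trans E1) B 0 (trans E2) ->
  dims V k0 -> minj (hom0 f) -> minj (hom1 f) ->
  has_degree E' d' -> dims (pull (hom0 f) (hom1 f) V) k' ->
  inhabited (subext E1 E2 B V m d' k').
Proof.
move=> EE dV i0 i1 dE' dk'.
pose g0 := dsubmx (hom0 f); pose g1 := dsubmx (hom1 f).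
have gT : map_mx c0 g0 *m trans E' = trans E2 *m map_mx c1 g1.
  have := congr1 dsubmx (hom_glue f); rewrite EE.
  rewrite -{1}[hom0 f]vsubmxK -{1}[hom1 f]vsubmxK !map_col_mx mul_col_mx.
  by rewrite mul_block_col !col_mxKd mul0mx add0r.
have [m1 [m2 [P0 [P0' [G0 [PP0 PP0' gP0 iG0 m12]]]]]] := compress_cols g0.
have [l1 [l2 [P1 [P1' [G1 [PP1 PP1' gP1 iG1 l12]]]]]] := compress_cols g1.
have mrank (fc : {rmorphism {poly C} -> F}) l j (g : 'M[{poly C}]_(n2, m))
    (P : 'M_(m, l + j)) (P' : 'M_(l + j, m)) (G : 'M_(n2, j)) : injective fc ->
    P *m P' = 1%:M -> P' *m P = 1%:M -> g *m P = row_mx 0 G -> minj G ->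
    \rank (map_mx fc g) = j.
  move=> fI PP PP' gP iG; rewrite -(minj_rank fI iG).
  have := congr1 (map_mx fc) gP; rewrite map_mxM map_row_mx map_mx0 => gE.
  have gE' : map_mx fc g = row_mx 0 (map_mx fc G) *m map_mx fc P'.
    by rewrite -gE -mulmxA -map_mxM PP map_mx1 mulmx1.
  have GE : map_mx fc G = map_mx fc g *m map_mx fc P *m col_mx 0 1%:M.
    by rewrite gE mul_row_col mul0mx add0r mulmx1.
  have rl : (\rank (map_mx fc g) <= \rank (map_mx fc G))%N.
    rewrite gE' (leq_trans (mxrankM_maxl _ _)) //.
    rewrite (_ : row_mx 0 _ = map_mx fc G *m row_mx 0 1%:M) ?mxrankM_maxl //.
    by rewrite mul_mx_row mulmx0 mulmx1.
  apply/eqP; rewrite eqn_leq rl GE -mulmxA; exact: mxrankM_maxl.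
have ml2 : m2 = l2.
  rewrite -(mrank c0 _ _ _ _ _ _ (@chart0_inj C) PP0 PP0' gP0 iG0).
  rewrite -(mrank c1 _ _ _ _ _ _ (@chart1_inj C) PP1 PP1' gP1 iG1).
  rewrite -[LHS](mxrankMfree _ (B := trans E')) ?row_free_unit ?(trans_unit E') //.
  have fT2 : row_full (trans E2) by rewrite row_full_unit (trans_unit E2).
  by rewrite gT (eqmxMfull _ fT2).
have ml1 : m1 = l1 by lia.
subst l2 l1.
pose T := map_mx c0 P0' *m trans E' *m map_mx c1 P1.
pose TV := map_mx c1 P1' *m invmx (trans E') *m map_mx c0 P0.
have P1P : map_mx c1 P1 *m map_mx c1 P1' = 1%:M by rewrite -map_mxM PP1 map_mx1.
have P0P : map_mx c0 P0 *m map_mx c0 P0' = 1%:M by rewrite -map_mxM PP0 map_mx1.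
have P0P' : map_mx c0 P0' *m map_mx c0 P0 = 1%:M by rewrite -map_mxM PP0' map_mx1.
have TTV : T *m TV = 1%:M.
  rewrite /T /TV -!mulmxA (mulmxA (map_mx c1 P1)) P1P mul1mx.
  by rewrite (mulmxA (trans E')) trans_mulV mul1mx.
have lT : laurent_mx T.
  apply: laurent_mulmx; last exact: laurent_mx1.
  by apply: laurent_mulmx; [exact: laurent_mx0|exact: trans_laurent].
have lTV : laurent_mx TV.
  apply: laurent_mulmx; last exact: laurent_mx0.
  by apply: laurent_mulmx; [exact: laurent_mx1|exact: trans_inv_laurent].
have GT : row_mx 0 (map_mx c0 G0) *m T = trans E2 *m row_mx 0 (map_mx c1 G1).
  rewrite -[X in row_mx X _](map_mx0 c0) -[X in _ = _ *m row_mx X _](map_mx0 c1).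
  rewrite -!map_row_mx -gP0 -gP1 !map_mxM /T -!mulmxA (mulmxA (map_mx c0 P0)).
  by rewrite P0P mul1mx !mulmxA gT.
have TE : T = block_mx (ulsubmx T) (ursubmx T) (dlsubmx T) (drsubmx T).
  by rewrite submxK.
(* The kernel block maps to zero and [G0] is generically injective, so [T] has no entry from the
   kernel block to the image block. *)
have [dl GI] : dlsubmx T = 0 /\
    map_mx c0 G0 *m drsubmx T = trans E2 *m map_mx c1 G1.
  move: GT; rewrite {1}TE mul_row_block !mul0mx !add0r mul_mx_row mulmx0.
  move=> /eq_row_mx[h ->]; split=> //.
  by apply: (minj_chart0I iG0); rewrite h mulmx0.
have [E'' [EK [EI [E''T EKT EIT]]]] := vbundle_block TTV lT lTV dl.
pose fP0 := hom0 f *m P0; pose fP1 := hom1 f *m P1.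
have fT : map_mx c0 fP0 *m T = trans E *m map_mx c1 fP1.
  rewrite /fP0 /fP1 !map_mxM /T -!mulmxA (mulmxA (map_mx c0 P0)) P0P mul1mx.
  by rewrite !mulmxA (hom_glue f).
have fP0E : fP0 = block_mx (ulsubmx fP0) (ursubmx fP0) 0 G0.
  rewrite /block_mx -gP0 mul_dsub_mx -/fP0 /ulsubmx /ursubmx hsubmxK.
  by rewrite vsubmxK.
have fP1E : fP1 = block_mx (ulsubmx fP1) (ursubmx fP1) 0 G1.
  rewrite /block_mx -gP1 mul_dsub_mx -/fP1 /ulsubmx /ursubmx hsubmxK.
  by rewrite vsubmxK.
have ifP0 : minj fP0 by apply: minjM => //; apply: minj_linv PP0'.
have ifP1 : minj fP1 by apply: minjM => //; apply: minj_linv PP1'.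
have minjK (fP : 'M[{poly C}]_(n1 + n2, m1 + m2)) G :
    fP = block_mx (ulsubmx fP) (ursubmx fP) 0 G -> minj fP -> minj (ulsubmx fP).
  move=> fE ifP; apply: (@minj_col0 _ n2).
  rewrite (_ : col_mx _ _ = fP *m col_mx 1%:M 0).
    apply: minjM => //; apply: (@minj_linv _ _ _ _ (row_mx 1%:M 0)).
    by rewrite mul_row_col mul1mx mulmx0 addr0.
  by rewrite fE mul_block_col !mulmx0 !mulmx1 !addr0 block_mxKul.
move: fT; rewrite {1}fP0E {1}fP1E TE EE dl !map_block_mx !mulmx_block !map_mx0.
rewrite !mulmx0 !mul0mx !addr0 !add0r => /eq_block_mx[KT HT _ _].
rewrite -EKT in KT; rewrite -EIT in GI HT.
have [dK dEK] := has_degree_ex EK; have [dI dEI] := has_degree_ex EI.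
have [kK [kI [dkK dkI]]] : exists kK kI,
  dims (pull (ulsubmx fP0) (ulsubmx fP1) (sub_space V)) kK /\
  dims (pull G0 G1 (quo_space V)) kI.
  have [k1 [k2 [d1 d2 _]]] := dims_subquo dV.
  have [|kK _ dkK] := dims_preim (f := secmul (ulsubmx fP0) (ulsubmx fP1)) _ d1.
    by apply: secmul_inj; [apply: (minjK _ G0)|apply: (minjK _ G1)].
  have [|kI _ dkI] := dims_preim (f := secmul G0 G1) _ d2; first exact: secmul_inj.
  by exists kK, kI.
have dP : dims (pull fP0 fP1 V) k'.
  have i0' : minj P0 by apply: minj_linv PP0'.
  have i1' : minj P1 by apply: minj_linv PP1'.
  have [|l _ dl'] := dims_preim (f := secmul P0 P1) _ dk'; first exact: secmul_inj.
  have SE : [set u | pull (hom0 f) (hom1 f) V (secmul P0 P1 u)] = pull fP0 fP1 V.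
    by apply/seteqP; split=> u; rewrite /pull /= secmulM.
  rewrite SE in dl'; have := dims_image (secmul_inj i0' i1') dl'.
  rewrite (_ : _ @` _ = pull (hom0 f) (hom1 f) V).
    by move=> /(dims_uniq dk') ->.
  apply/seteqP; split=> [_ [u Vu <-]|u Vu]; first by rewrite /pull /= secmulM.
  exists (secmul P0' P1' u); last by rewrite /= secmulM PP0 PP1 secmul1.
  by rewrite /pull /= secmulM /fP0 /fP1 -!mulmxA PP0 PP1 !mulmx1.
have [ka [kb [da db kab]]] := dims_subquo dP.
have emb (x : sections C m1) (y : sections C m2) :
    secmul fP0 fP1 (col_mx x.1 y.1, col_mx x.2 y.2) =
    (col_mx (ulsubmx fP0 *m x.1 + ursubmx fP0 *m y.1) (G0 *m y.1),
     col_mx (ulsubmx fP1 *m x.2 + ursubmx fP1 *m y.2) (G1 *m y.2)).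
  by congr pair; [rewrite /= {1}fP0E|rewrite /= {1}fP1E];
    rewrite mul_block_col mul0mx add0r.
have kaE : ka = kK.
  apply: dims_uniq da _; move: dkK; congr dims.
  have e u : secmul fP0 fP1 (inl_sec m2 u) =
      inl_sec n2 (secmul (ulsubmx fP0) (ulsubmx fP1) u).
    by have := emb u (0, 0); rewrite !inl_secE /= !mulmx0 !addr0.
  by apply/seteqP; split=> u; rewrite /sub_space /pull /= e.
(* Only an inclusion: a section of the image may come from V without coming from a section of E' in
   V. Hence the inequality [se_dim], and the lifting [se_lift] when it is an equality. *)
have qsub (y : sections C m2) : quo_space (pull fP0 fP1 V) y ->
    pull G0 G1 (quo_space V) y.
  move=> [u Vu <-]; rewrite /pull /quo_space /= in Vu *.
  exists (secmul fP0 fP1 u) => //; rewrite pr2_secE pr2_secE.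
  congr pair; [rewrite /= {1}fP0E|rewrite /= {1}fP1E].
    by rewrite -{1}[u.1]vsubmxK mul_block_col mul0mx add0r col_mxKd.
  by rewrite -{1}[u.2]vsubmxK mul_block_col mul0mx add0r col_mxKd.
have kbI : (kb <= kI)%N.
  have [k4 le4 d4] := dims_sub (dims_subspace db) dkI qsub.
  by rewrite (dims_uniq db d4).
have dKI : dK + dI = d'.
  have E''E : trans E'' = block_mx (trans EK) (ursubmx T) 0 (trans EI).
    by rewrite E''T EKT EIT -dl -TE.
  have := has_degree_block E''E dEK dEI.
  move=> dE''; apply: has_degree_uniq dE'.
  apply: (has_degree_base_change m12 PP0 PP1 _ dE'').
  rewrite E''T /T mulmxA mulmxA P0P mul1mx.
  by [].
pose K := BHom KT; pose I := BHom GI.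
have lift : k' = (kK + kI)%N ->
    forall y, pull (hom0 I) (hom1 I) (quo_space V) y -> exists x : sections C m1,
      V (col_mx (hom0 K *m x.1 + ursubmx fP0 *m y.1) (hom0 I *m y.1),
         col_mx (hom1 K *m x.2 + ursubmx fP1 *m y.2) (hom1 I *m y.2)).
  move=> kE y Vy; have kbE : kb = kI by lia.
  rewrite -kbE in dkI; have [u Vu uy] := dims_full db dkI qsub Vy.
  exists (usubmx u.1, usubmx u.2); rewrite -emb /=.
  by move: uy; rewrite pr2_secE => <- /=; rewrite !vsubmxK -surjective_pairing.
have inj : [/\ minj (hom0 K), minj (hom1 K), minj (hom0 I) & minj (hom1 I)].
  by split=> //=; [apply: (minjK _ G0)|apply: (minjK _ G1)].
have kKI : (k' <= kK + kI)%N by lia.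
by split; exact: (@SubExt _ _ E1 E2 B V m d' k' m1 m2 EK EI K I _ _ _ dK dI kK kI
  m12 dKI kKI HT inj dEK dEI dkK dkI lift).
Qed.

End Extensions.

(** * Stability *)

Section Stability.
Variable R : realType.
Local Notation C := (R[i]).

Lemma secmul_on m n (E' : vbundle C m) (E : vbundle C n) (f : bhom E' E) s :
  on_sections f s = secmul (hom0 f) (hom1 f) s.
Proof. by []. Qed.

Lemma pull_cohsys m n (X : cohsys C n) (E' : vbundle C m)
    (h : bhom E' (cs_bundle X)) : minj (hom0 h) ->
  exists X' : cohsys C m, exists f : bhom (cs_bundle X') (cs_bundle X),
    [/\ cs_bundle X' = E', hom0 f = hom0 h, hom1 f = hom1 h &
        cs_space X' = pull (hom0 h) (hom1 h) (cs_space X)].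
Proof.
move=> i0.
have sH : pull (hom0 h) (hom1 h) (cs_space X) `<=` H0 E'.
  by move=> s Vs; apply/(pull_H0 (f := h) s i0); apply: cs_space_sub Vs.
have s0 : pull (hom0 h) (hom1 h) (cs_space X) 0.
  by rewrite /pull /= (linear0 (secmul (hom0 h) (hom1 h))); apply: cs_space0.
have sl (c : C) (s t : chart_vec C m) : pull (hom0 h) (hom1 h) (cs_space X) s ->
    pull (hom0 h) (hom1 h) (cs_space X) t ->
    pull (hom0 h) (hom1 h) (cs_space X) (cscale c s + t).
  rewrite /pull /= => hs ht.
  have -> : secmul (hom0 h) (hom1 h) (cscale c s + t) =
      cscale c (secmul (hom0 h) (hom1 h) s) + secmul (hom0 h) (hom1 h) t.
    exact: (secmul_is_linear (hom0 h) (hom1 h) c s t).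
  exact: cs_space_lin.
by exists (CohSys sH s0 sl), h.
Qed.

(** Stability speaks of subbundles only. A subsheaf is replaced by its saturation, whose degree and
    space of sections can only be larger; equality is possible only if the saturation is the whole
    system. *)
Lemma stable_weak (alpha : R) n (X : cohsys C n) d k m (E' : vbundle C m)
    (f : bhom E' (cs_bundle X)) d' k' (mu : R) :
  0 < alpha -> stable alpha X -> has_type X d k -> (0 < m)%N ->
  minj (hom0 f) -> minj (hom1 f) -> has_degree E' d' ->
  dims (pull (hom0 f) (hom1 f) (cs_space X)) k' ->
  d%:~R + alpha * k%:R = mu * n%:R ->
  d'%:~R + alpha * k'%:R <= mu * m%:R /\
  (d'%:~R + alpha * k'%:R = mu * m%:R -> [/\ m = n, d' = d & k' = k]).
Proof.
move=> al0 st tX m0 i0 i1 dE' dk' hmu; have [dX /has_dimP kX] := tX.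
have [E2 [h [D [sh f0E f1E iD0 iD1]]]] := saturation i0 i1.
have [ih0 ih1] := hom_minj sh.
have mn : (m <= n)%N := minj_leq i0.
have [d2 dE2] := has_degree_ex E2.
have [d'2 _] := degree_change (hom_glue D) iD0 iD1 dE2 dE'.
have [k2 k2k dk2] := dims_preim (secmul_inj ih0 ih1) kX.
have [l lk2 dl] := dims_preim (secmul_inj iD0 iD1) dk2.
have k'l : k' = l.
  apply: (dims_uniq dk'); move: dl; congr dims.
  by apply/seteqP; split=> s; rewrite /pull /= secmulM -f0E -f1E.
have {l lk2 dl k'l} k'2 : (k' <= k2)%N by rewrite k'l.
have le1 : d'%:~R + alpha * k'%:R <= d2%:~R + alpha * k2%:R.
  by rewrite lerD // ?ler_int // ler_pM2l // ler_nat.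
have [X' [g [X'E g0E g1E X'V]]] := pull_cohsys ih0.
have sg : subsystem g.
  split=> //; first by move=> x; rewrite g0E g1E; apply: sh.
  move=> _ [s Vs <-]; rewrite secmul_on g0E g1E; rewrite X'V in Vs; exact: Vs.
have tX' : has_type X' d2 k2.
  split; first by rewrite X'E.
  by apply/has_dimP; rewrite X'V.
have [isog|niso] := pselect (cs_iso_map g); last first.
  have := st _ _ _ sg niso _ _ _ _ tX' tX.
  rewrite /slope hmu mulfK; last by rewrite pnatr_eq0; lia.
  rewrite ltr_pdivrMr ?ltr0n // => lt.
  have lt' := le_lt_trans le1 lt.
  by split=> [|E1]; [exact: ltW|rewrite E1 ltxx in lt'].
case: isog => [[g' [_ _ gg' gg1']] gV].
have nm : m = n.
  by apply/eqP; rewrite eqn_leq mn (minj_leq (minj_linv gg')).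
subst m.
have [d2d _] := degree_change (hom_glue h) ih0 ih1 dX dE2.
have le2 : d2%:~R + alpha * k2%:R <= d%:~R + alpha * k%:R.
  by rewrite lerD // ?ler_int // ler_pM2l // ler_nat.
rewrite -hmu; split=> [|E1]; first exact: le_trans le1 le2.
have h1 : d'%:~R <= d%:~R :> R by rewrite ler_int (le_trans d'2).
have h2 : k'%:R <= k%:R :> R by rewrite ler_nat (leq_trans k'2).
have h3 : alpha * k'%:R <= alpha * k%:R by rewrite ler_pM2l.
split=> //.
  by apply/eqP; rewrite -(eqr_int R); apply/eqP; lra.
apply/eqP; rewrite -(eqr_nat R); apply/eqP.
by apply: (mulfI (lt0r_neq0 al0)); lra.
Qed.

(** For positive alpha, enlarging the space of a subsystem raises its slope, so only full
    pulled-back spaces need testing. If such a space has the type of X, a proper subsystem on the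
    same bundle has strictly fewer sections. *)
Lemma stable_criterion (alpha mu : R) n (X : cohsys C n) d k :
  0 < alpha -> (0 < n)%N -> has_type X d k -> d%:~R + alpha * k%:R = mu * n%:R ->
  (forall m (E' : vbundle C m) (f : bhom E' (cs_bundle X)) d' k', (0 < m)%N ->
    minj (hom0 f) -> minj (hom1 f) -> has_degree E' d' ->
    dims (pull (hom0 f) (hom1 f) (cs_space X)) k' ->
    d'%:~R + alpha * k'%:R < mu * m%:R \/ [/\ m = n, d' = d & k' = k]) ->
  stable alpha X.
Proof.
move=> al0 n0 tX hmu H m X' f [m0 sf fV] niso d' k' d1 k1 [dX' /has_dimP kX'] tX1.
have [dX /has_dimP kX] := tX; have [dX1 /has_dimP kX1] := tX1.
rewrite (has_degree_uniq dX1 dX) (dims_uniq kX1 kX) {tX1 dX1 kX1 d1 k1}.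
have [i0 i1] := hom_minj sf.
have [k2 k2k dk2] := dims_preim (secmul_inj i0 i1) kX.
have V'V s : cs_space X' s -> pull (hom0 f) (hom1 f) (cs_space X) s.
  by move=> Vs; apply: fV; exists s.
have k'2 : (k' <= k2)%N.
  have [l le dl] := dims_sub (cs_subspace X') dk2 V'V.
  by rewrite (dims_uniq kX' dl).
rewrite /slope hmu mulfK; last by rewrite pnatr_eq0; lia.
rewrite ltr_pdivrMr ?ltr0n //.
have le1 : d'%:~R + alpha * k'%:R <= d'%:~R + alpha * k2%:R.
  by rewrite lerD2l ler_pM2l // ler_nat.
have [lt|[mn d'd k2E]] := H _ _ f d' k2 m0 i0 i1 dX' dk2.
  exact: le_lt_trans le1 lt.
subst m k2 d'; rewrite -hmu ltrD2l ltr_pM2l // ltr_nat ltn_neqAle k'2 andbT.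
apply/eqP => k'k; apply: niso; subst k'.
have [_ /(_ erefl)[u0 u1]] := degree_change (hom_glue f) i0 i1 dX dX'.
split.
  exact: bhom_iso_unit.
apply/seteqP; split=> // s Vs.
have dI := dims_image (secmul_inj i0 i1) kX'.
by apply: (dims_full dI kX _ Vs) => v [u Vu <-]; apply: V'V.
Qed.

(* K is k'n - km and D is d'n - dm for a subsystem of type (m, d', k'). *)
Lemma no_walls (a : R) (N : nat) : exists2 e : R, 0 < e &
  forall (b : R) (K : nat) (D : int), a < b -> b < a + e -> (0 < K <= N)%N ->
    D%:~R + b * K%:R <> 0.
Proof.
elim: N => [|N [e e0 IH]]; first by exists 1 => // b K D _ _; lia.
pose f : int := Num.floor (a * N.+1%:R).
have N0 : 0 < N.+1%:R :> R by rewrite ltr0n.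
have fl : a * N.+1%:R < (f + 1)%:~R.
  by rewrite /f; have := floor_itv (a * N.+1%:R); case/andP.
have fl' : f%:~R <= a * N.+1%:R by apply: floor_le_tmp.
(* The distance from a to the next b for which b times N + 1 is an integer; [f + 1] is used rather
   than a ceiling because a may itself be a wall. *)
pose e1 := ((f + 1)%:~R - a * N.+1%:R) / N.+1%:R.
have e10 : 0 < e1 by rewrite divr_gt0 // subr_gt0.
exists (Num.min e e1); first by rewrite lt_min e0.
move=> b K D ab; rewrite -ltrBlDl lt_min => /andP[be be1] /andP[K0].
rewrite leq_eqVlt => /orP[/eqP KN|KN]; last by apply: IH; rewrite -?ltrBlDl // K0.
subst K => E1.
have l1 : f%:~R < (- D)%:~R :> R.
  rewrite (le_lt_trans fl') // rmorphN /= -(ltrD2l D%:~R) subrr -E1 ltrD2l.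
  by rewrite ltr_pM2r.
have l2 : (- D)%:~R < (f + 1)%:~R :> R.
  move: be1; rewrite /e1 ltr_pdivlMr // mulrBl ltrD2r rmorphN /= => h.
  by rewrite (le_lt_trans _ h) // -(lerD2l D%:~R) subrr E1.
by move: l1 l2; rewrite !ltr_int; lia.
Qed.

(** A change of sign would put the zero -D/K inside the interval, where the hypothesis excludes it;
    a negative K is treated by negating both D and K. *)
Lemma sign_const (a e : R) (N : nat) :
  (forall (b : R) (K : nat) (D : int), a < b -> b < a + e -> (0 < K <= N)%N ->
    D%:~R + b * K%:R <> 0) ->
  forall (b c : R) (D K : int), a < b -> b < a + e -> a < c -> c < a + e ->
    `|K| <= N%:Z -> D%:~R + b * K%:~R < 0 -> D%:~R + c * K%:~R < 0.
Proof.
move=> nw b c D K ab be ac ce KN hb; rewrite ltNge; apply/negP => hc.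
have nw' (x : R) : a < x -> x < a + e -> K != 0 -> D%:~R + x * K%:~R != 0.
  move=> ax xe K0; apply/eqP => E1.
  have [Kp|Kn] := leP 0 K.
    apply: (nw x (absz K) D ax xe); first by lia.
    by rewrite -[RHS]E1; congr (_ + _ * _); rewrite natr_absz ger0_norm.
  apply: (nw x (absz K) (- D) ax xe); first by lia.
  rewrite natr_absz ltr0_norm // !rmorphN /= mulrN -opprD.
  by rewrite E1 oppr0.
have K0 : K != 0 by apply/eqP => K0; move: hb hc; rewrite K0 !mulr0; lra.
have KR0 : K%:~R != 0 :> R by rewrite intr_eq0.
pose x : R := - D%:~R / K%:~R.
have xE : D%:~R + x * K%:~R = 0 by rewrite /x divfK // subrr.
have hx : (b < x /\ x <= c) \/ (c <= x /\ x < b).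
  have [Kp|Kn] := ltP 0 (K%:~R : R); [left|right].
    by split; [rewrite -(ltr_pM2r Kp)|rewrite -(ler_pM2r Kp)]; lra.
  have {}Kn : K%:~R < 0 :> R by rewrite lt_neqAle KR0.
  by split; [rewrite -(ler_nM2r Kn)|rewrite -(ltr_nM2r Kn)]; lra.
have [ax xe] : a < x /\ x < a + e by case: hx; lra.
by have := nw' x ax xe K0; rewrite xE eqxx.
Qed.

(** The sign of D + x K, with D = d'n - dm and K = k'n - km, compares slopes at x. A negative value
    at alpha stays negative just above, and a zero value becomes negative when K < 0. Since |K| <=
    nk for every subsystem, one interval serves them all and also makes the moduli space constant
    there. *)
Lemma Gplus_nonempty (alpha mu : R) n (X : cohsys C n) d k :
  0 < alpha -> (0 < n)%N -> has_type X d k -> d%:~R + alpha * k%:R = mu * n%:R ->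
  (forall m (E' : vbundle C m) (f : bhom E' (cs_bundle X)) d' k', (0 < m)%N ->
    minj (hom0 f) -> minj (hom1 f) -> has_degree E' d' ->
    dims (pull (hom0 f) (hom1 f) (cs_space X)) k' ->
    d'%:~R + alpha * k'%:R <= mu * m%:R /\
    (d'%:~R + alpha * k'%:R = mu * m%:R ->
       (k' * n < k * m)%N \/ [/\ m = n, d' = d & k' = k])) ->
  exists2 M : set (set (cohsys C n)), is_Gplus alpha d k M & M !=set0.
Proof.
move=> al0 n0 tX hmu H.
have [e e0 nw] := no_walls alpha (n * k).
have sc := sign_const nw.
have slopeE (b : R) m d' k' : (0 < m)%N -> (slope b m d' k' < slope b n d k) =
    ((d' * n%:Z - d * m%:Z)%:~R + b * (k'%:Z * n%:Z - k%:Z * m%:Z)%:~R < 0 :> R).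
  move=> m0; rewrite /slope ltr_pdivrMr ?ltr0n // mulrAC ltr_pdivlMr ?ltr0n //.
  rewrite -subr_lt0 !rmorphB !rmorphM /= -!pmulrn.
  by congr (_ < _); ring.
have bound m k' : (m <= n)%N -> (k' <= k)%N ->
    `|k'%:Z * n%:Z - k%:Z * m%:Z| <= (n * k)%N%:Z.
  move=> mn kk; have : (k' * n <= n * k)%N by rewrite mulnC leq_mul.
  have : (k * m <= n * k)%N by rewrite mulnC leq_mul.
  by rewrite -!PoszM; lia.
have st (b c : R) (Y : cohsys C n) : alpha < b -> b < alpha + e -> alpha < c ->
    c < alpha + e -> has_type Y d k -> stable b Y -> stable c Y.
  move=> ab be ac ce tY sY m X' f sf niso d' k' d1 k1 tX' tY1.
  have [dY /has_dimP kY] := tY; have [dY1 /has_dimP kY1] := tY1.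
  have := sY _ _ _ sf niso _ _ _ _ tX' tY1.
  rewrite (has_degree_uniq dY1 dY) (dims_uniq kY1 kY) {tY1 dY1 kY1 d1 k1}.
  have [m0 sbf fV] := sf; have [i0 i1] := hom_minj sbf.
  rewrite !slopeE //; apply: sc => //; apply: bound; first exact: minj_leq i0.
  have [_ /has_dimP kX'] := tX'.
  have [l lk dl] := dims_preim (secmul_inj i0 i1) kY.
  have [|l' ll' dl'] := dims_sub (cs_subspace X') dl.
    by move=> s Vs; apply: fV; exists s.
  by rewrite (dims_uniq kX' dl') (leq_trans ll').
exists (G (alpha + e / 2) n d k).
  exists (alpha + e); first by lra.
  move=> b ab be; rewrite /G; congr image.
  apply/seteqP; split=> Y [tY sY]; split=> //.
    by apply: st sY => //; lra.
  by apply: st sY => //; lra.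
exists (cs_isomorphic X); exists X => //; split=> //.
pose b := alpha + e / 2.
have hb : alpha < b by rewrite /b; lra.
apply: (@stable_criterion _ ((d%:~R + b * k%:R) / n%:R) _ _ d k) => //.
- by rewrite (lt_trans al0).
- by rewrite divfK // pnatr_eq0; lia.
move=> m E' f d' k' m0 i0 i1 dE' dk'.
have [le eqc] := H _ _ f _ _ m0 i0 i1 dE' dk'.
have mn : (m <= n)%N := minj_leq i0.
have [_ /has_dimP kX] := tX.
have k'k : (k' <= k)%N.
  have [l lk dl] := dims_preim (secmul_inj i0 i1) kX.
  by rewrite (dims_uniq dk' dl).
have n0R : 0 < n%:R :> R by rewrite ltr0n.
have m0R : 0 < m%:R :> R by rewrite ltr0n.
set D := (d' * n%:Z - d * m%:Z); set K := (k'%:Z * n%:Z - k%:Z * m%:Z).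
have lamE (x : R) : D%:~R + x * K%:~R =
    (d'%:~R + x * k'%:R) * n%:R - (d%:~R + x * k%:R) * m%:R.
  rewrite /D /K !rmorphB !rmorphM /= -!pmulrn; ring.
suff : D%:~R + b * K%:~R < 0 \/ [/\ m = n, d' = d & k' = k].
  case=> [h|h]; [left|by right].
  by rewrite lamE subr_lt0 in h; rewrite mulrAC ltr_pdivlMr.
move: le; rewrite le_eqVlt => /orP[/eqP E1|lt].
  case: (eqc E1) => [lt|h]; [left|by right].
  have K0 : K%:~R < 0 :> R by rewrite ltrz0 /K -!PoszM; lia.
  have := lamE alpha; rewrite E1 hmu => E2.
  have : (b - alpha) * K%:~R < 0 by rewrite pmulr_rlt0 // subr_gt0.
  by move: E2; rewrite mulrAC subrr mulrBl; lra.
left; rewrite ltNge; apply/negP => hbK.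
have la : D%:~R + alpha * K%:~R < 0.
  by rewrite lamE hmu mulrAC -mulrBl pmulr_llt0 // subr_lt0.
have K0 : 0 < K%:~R :> R.
  rewrite -(pmulr_rgt0 _ (_ : 0 < b - alpha)) ?subr_gt0 // mulrBl; lra.
pose x : R := - D%:~R / K%:~R.
have xE : D%:~R + x * K%:~R = 0 by rewrite /x divfK ?subrr // lt0r_neq0.
have ax : alpha < x by rewrite -(ltr_pM2r K0); lra.
have xb : x <= b by rewrite -(ler_pM2r K0); lra.
have Ki : 0 < K by rewrite -(ltr0z R).
apply: (nw x (absz K) D) => //.
- by rewrite (le_lt_trans xb) // /b; lra.
- by move: (bound m k' mn k'k) Ki; rewrite -/K; generalize K (n * k)%N; clear; lia.
by rewrite natr_absz gtr0_norm.
Qed.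

End Stability.

(** * Extensions with independent classes *)

Lemma independent_mod_family (K : fieldType) (V : lmodType K) (I J : finType)
    (v : I -> V) (w : J -> V) (r : nat) :
  (forall c : I -> K, \sum_x c x *: v x = 0 -> forall x, c x = 0) ->
  (r + #|J| <= #|I|)%N ->
  exists A : 'I_r -> I -> K, forall (c : 'I_r -> K) (d : J -> K),
    \sum_i c i *: (\sum_x A i x *: v x) = \sum_y d y *: w y -> forall i, c i = 0.
Proof.
move=> fv rJI.
pose ev (T : finType) (k : 'I_#|T|) : T := enum_val k.
have evK (T : finType) (k : 'I_#|T|) : enum_rank (ev T k) = k by exact: enum_valK.
have E (T : finType) (f : T -> V) (c : T -> K) :
    lcomb (f \o ev T) (\row_k c (ev T k)) = \sum_x c x *: f x.
  rewrite /lcomb [RHS](reindex (ev T)) /=.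
    by apply: eq_bigr => k _; rewrite mxE.
  exact: (onW_bij _ (@enum_val_bij T)).
have fv' : lfree (v \o ev I).
  move=> c cv; apply/rowP => k; rewrite mxE.
  have := fv (fun x => c 0 (enum_rank x)); rewrite -E.
  rewrite (_ : \row_k _ = c) => [/(_ cv)/(_ (ev I k))|].
    by rewrite evK.
  by apply/rowP => l; rewrite mxE evK.
have [A AP] := independent_mod_span (w \o ev J) fv' rJI.
exists (fun i x => A i (enum_rank x)) => c d cd i.
have /rowP/(_ i) : \row_i c i = 0.
  apply: AP; exists (\row_k d (ev J k)); rewrite E -cd -lcomb_mul.
  apply: eq_bigr => j _; rewrite mxE; congr (_ *: _); rewrite -E.
  by congr lcomb; apply/rowP => l; rewrite !mxE evK.
by rewrite !mxE.
Qed.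

Section Constructions.
Variable C : closedFieldType.
Local Notation F := (ratfun C).
Local Notation z := (zcoord C).
Local Notation c0 := (@chart0 C).
Local Notation c1 := (@chart1 C).

Lemma resC_scaleE (M : lmodType {poly C}) (a : C) (x : resC M) :
  a *: x = a%:P *: (x : M) :> M.
Proof. by []. Qed.

Lemma linesum_bundle n (b : int) : exists2 E : vbundle C n,
  trans E = linesum C n b & has_degree E (n%:Z * b).
Proof.
have V1 : linesum C n b *m linesum C n (- b) = 1%:M by exact: zdiagV.
have [u _] := mulmx1_unit V1.
have VE : invmx (linesum C n b) = linesum C n (- b).
  by rewrite -[RHS]mul1mx -(mulVmx u) -mulmxA V1 mulmx1.
have l1 : laurent_mx (linesum C n b) by exact: laurent_zdiag.
have l2 : laurent_mx (invmx (linesum C n b)) by rewrite VE; exact: laurent_zdiag.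
exists (VBundle u l1 l2) => //; exists 1; first exact: oner_neq0.
by rewrite /= det_zdiag sumr_const card_ord rmorph1 mul1r -mulr_natl natz.
Qed.

Lemma extension_bundle n1 n2 (E1 : vbundle C n1) (E2 : vbundle C n2)
    (B : 'M[F]_(n1, n2)) : laurent_mx B ->
  exists E : vbundle C (n1 + n2), trans E = block_mx (trans E1) B 0 (trans E2).
Proof.
move=> lB; pose T := block_mx (trans E1) B 0 (trans E2).
pose V1 := invmx (trans E1); pose V2 := invmx (trans E2).
pose TV := block_mx V1 (- (V1 *m B *m V2)) 0 V2.
have l0 : laurent_mx (0 : 'M[F]_(n2, n1)).
  by rewrite -(map_mx0 c0); exact: laurent_mx0.
have lV1 : laurent_mx V1 by exact: trans_inv_laurent.
have lV2 : laurent_mx V2 by exact: trans_inv_laurent.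
have lT : laurent_mx T.
  by apply/laurent_block; split=> //; exact: trans_laurent.
have lTV : laurent_mx TV.
  apply/laurent_block; split=> //; apply: laurent_mxN.
  by apply: laurent_mulmx => //; apply: laurent_mulmx.
have TTV : T *m TV = 1%:M.
  rewrite mulmx_block !mulmx0 !mul0mx !add0r !addr0 mulmxN !mulmxA.
  by rewrite !trans_mulV mul1mx addNr -scalar_mx_block.
have dl : dlsubmx T = 0 by rewrite block_mxKdl.
by have [E [_ [_ [h _ _]]]] := vbundle_block TTV lT lTV dl; exists E.
Qed.

(* maps O(-1) -> E, i.e. sections of E(1), given on U0 *)
Definition twisted_section r b (T : 'M[F]_r) (M : 'M[{poly C}]_(r, b)) : Prop :=
  exists M1, map_mx c0 M = z *: (T *m map_mx c1 M1).

Lemma twisted_section_sum r b (T : 'M[F]_r) (I : finType) (c : I -> C)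
    (v : I -> resC 'M[{poly C}]_(r, b)) :
  (forall x, twisted_section T (v x)) -> twisted_section T (\sum_x c x *: v x).
Proof.
move=> h; apply: (big_ind (@twisted_section r b T)).
- by exists 0; rewrite !map_mx0 mulmx0 scaler0.
- move=> M N [M1 hM] [N1 hN]; exists (M1 + N1).
  by rewrite !map_mxD mulmxDr scalerDr hM hN.
move=> x _; have [M1 hM] := h x; exists ((c x)%:P *: M1).
rewrite (_ : map_mx c0 _ = c0 (c x)%:P *: map_mx c0 (v x)); last exact: map_mxZ.
by rewrite hM map_mxZ /= chart1C -scalemxAr !scalerA mulrC.
Qed.

(** E(1) is the sum of the O(e_i + 1), and O(e_i + 1) has max(e_i + 2, 0) >= e_i + 2 independent
    sections. The family consists of their monomials in split coordinates, placed in each of the b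
    columns. *)
Lemma twisted_sections r b (E : vbundle C r) d :
  has_degree E d -> exists (I : finType) (v : I -> resC 'M[{poly C}]_(r, b)),
    [/\ forall x, twisted_section (trans E) (v x),
        forall c : I -> C, \sum_x c x *: v x = 0 -> forall x, c x = 0 &
        b%:Z * (d + 2 * r%:Z) <= #|I|%:Z].
Proof.
move=> dE; have [e [P [Q [uP uQ TE]]]] := birkhoff_grothendieck E.
have dS := degree_BG uP uQ TE dE.
pose N i := if 0 <= e i + 2 then absz (e i + 2) else 0%N.
pose I := ('I_b * {i : 'I_r & 'I_(N i)})%type.
pose v (x : I) : resC 'M[{poly C}]_(r, b) :=
  P *m ('X^(tagged x.2) *: delta_mx (tag x.2) x.1).
exists I, v; split.
- move=> [j [i l]]; rewrite /v /=.
  have Nl : exists k : nat, e i + 1 = l%:Z + k%:Z.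
    exists (absz (e i + 1 - l%:Z)%R); have := ltn_ord l; rewrite {2}/N; case: ifP; lia.
  have [k kE] := Nl.
  exists (invmx Q *m ('X^k *: delta_mx i j)).
  have QQ : map_mx c1 Q *m map_mx c1 (invmx Q) = 1%:M.
    by rewrite -map_mxM (mulmxV uQ) map_mx1.
  rewrite TE !map_mxM -!mulmxA (mulmxA (map_mx c1 Q)) QQ mul1mx.
  rewrite scalemxAr; congr (_ *m _).
  rewrite !map_mxZ !map_delta_mx -scalemxAr scalerA.
  rewrite (_ : zdiag C e *m delta_mx i j = z ^ e i *: delta_mx i j); last first.
    apply/matrixP => i1 j1; rewrite mul_diag_mx !mxE.
    by case: eqP => [->//|_] /=; rewrite !mulr0.
  rewrite scalerA; congr (_ *: _).
  rewrite !rmorphXn /= chart0X chart1X exprVn exprnN -mulrA -expfzDr ?zcoord_neq0 //.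
  rewrite exprnP -[z in RHS]expr1z -expfzDr ?zcoord_neq0 //; congr (z ^ _).
  by lia.
- move=> c cv0 [j0 [i0 l0]].
  pose S := \sum_x (c x)%:P *: ('X^(tagged x.2) *: delta_mx (tag x.2) x.1)
    : 'M[{poly C}]_(r, b).
  have S0 : S = 0.
    apply: (minjI (minj_unit uP)); rewrite mulmx0 -[RHS]cv0 /S linear_sum /=.
    by apply: eq_bigr => x _; rewrite -scalemxAr.
  have := congr1 (fun M : 'M[{poly C}]_(r, b) => (M i0 j0)`_l0) S0.
  rewrite /S summxE coef_sum [in X in _ = X]mxE coef0.
  rewrite (bigD1 (j0, existT (fun i => 'I_(N i)) i0 l0)) //= big1 ?addr0.
    by rewrite !mxE !eqxx mulr1 coefCM coefXn eqxx mulr1.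
  move=> [j [i l]] ne; rewrite !mxE /= coefCM.
  case: (i0 =P i) => [i0i|_]; last by rewrite mulr0 coef0 mulr0.
  case: (j0 =P j) => [j0j|_]; last by rewrite andbF mulr0 coef0 mulr0.
  rewrite mulr1 coefXn; case: (nat_of_ord l0 =P l) => [l0l|_]; last by rewrite mulr0.
  case/eqP: ne; subst i j; congr (_, existT _ _ _); exact/esym/val_inj.
rewrite card_prod card_ord card_tagged sumnE big_map big_enum /=.
rewrite PoszM ler_wpM2l // dS.
have -> : \sum_i e i + 2 * r%:Z = \sum_(i < r) (e i + 2).
  by rewrite big_split /= sumr_const card_ord -[2 *+ r]mulr_natr (natz r).
rewrite (big_morph Posz PoszD (erefl _)); apply: ler_sum => i _.
by rewrite card_ord /N; case: ifP; lia.
Qed.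

(** The solution on [U0] of u_(j+1) = z u_j + f_j with u_0 = 0. *)
Fixpoint ladder0 r (f : nat -> 'cV[{poly C}]_r) (j : nat) : 'cV[{poly C}]_r :=
  if j is j'.+1 then 'X *: ladder0 f j' + f j' else 0.

(** The same recursion on [U1], run downwards: v_j = [ladder1 b g (b - j)] satisfies v_b = 0 and v_j
    = w v_(j+1) - g_j. *)
Fixpoint ladder1 r (b : nat) (g : nat -> 'cV[{poly C}]_r) (j : nat) :
    'cV[{poly C}]_r :=
  if j is j'.+1 then 'X *: ladder1 b g j' - g (b - j'.+1)%N else 0.

(** The two recursions match because f_i = z T g_i, but they start at opposite ends. The discrepancy
    is z^j times one vector independent of j, which is the cocycle of the extension. *)
Lemma ladder_glue r (T : 'M[F]_r) b f g (j : nat) :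
  (forall i, map_mx c0 (f i) = z *: (T *m map_mx c1 (g i))) -> (j <= b)%N ->
  map_mx c0 (ladder0 f j) = T *m map_mx c1 (ladder1 b g (b - j)) -
    z ^+ j *: (T *m map_mx c1 (ladder1 b g b)).
Proof.
move=> fg; elim: j => [|j IH] jb.
  by rewrite subn0 expr0 scale1r subrr map_mx0.
rewrite /= map_mxD map_mxZ /= chart0X IH ?fg; last exact: ltnW.
rewrite -(subnSK jb) /= subnSK // subKn; last exact: ltnW.
rewrite map_mxB map_mxZ /= chart1X mulmxBr -scalemxAr !scalerBr !scalerA -exprS.
rewrite mulfV ?zcoord_neq0 // scale1r addrAC; congr (_ - _).
by rewrite subrK.
Qed.

(** Sends z^j in coordinate i to [u i j] for j <= b, linearly over C only; its failure to commute
    with z records the extension class. *)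
Definition lift_map r t (b : nat) (u : 'I_t -> nat -> 'cV[{poly C}]_r)
    (y : 'cV[{poly C}]_t) : 'cV[{poly C}]_r :=
  \sum_i \sum_(j < b.+1) ((y i 0)`_j)%:P *: u i j.

Lemma lift_mapP r t b u a y y' :
  @lift_map r t b u (a%:P *: y + y') = a%:P *: lift_map b u y + lift_map b u y'.
Proof.
rewrite /lift_map scaler_sumr -big_split; apply: eq_bigr => i _.
rewrite scaler_sumr -big_split; apply: eq_bigr => j _.
by rewrite !mxE coefD coefCM polyCD polyCM scalerDl scalerA.
Qed.

Lemma lift_map0 r t b u : @lift_map r t b u 0 = 0.
Proof.
by rewrite /lift_map big1 // => i _; rewrite big1 // => j _; rewrite mxE coef0 scale0r.
Qed.

Lemma lift_map_monomial r t b u (c : 'cV[C]_t) (j : nat) : (j <= b)%N ->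
  @lift_map r t b u ('X^j *: map_mx polyC c) = \sum_i (c i 0)%:P *: u i j.
Proof.
move=> jb; apply: eq_bigr => i _.
have jb1 : (j < b.+1)%N by [].
rewrite (bigD1 (Ordinal jb1)) //= big1 ?addr0.
  by rewrite !mxE coefMC coefXn eqxx mul1r.
move=> k kj; rewrite !mxE coefMC coefXn; case: eqP => [kjE|_].
  by case/eqP: kj; apply: val_inj.
by rewrite mul0r scale0r.
Qed.

End Constructions.

(** * Extensions of copies of (O(b), H^0) by a coherent system *)

Section NonSplit.
Variable C : closedFieldType.
Local Notation F := (ratfun C).
Local Notation z := (zcoord C).
Local Notation c0 := (@chart0 C).
Local Notation c1 := (@chart1 C).

Lemma sum_sel n (f : nat -> {poly C}) m : (m < n)%N ->
  \sum_(i < n) f i * (nat_of_ord i == m)%:R = f m.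
Proof.
move=> mn; rewrite (bigD1 (Ordinal mn)) //= eqxx mulr1 big1 ?addr0 // => i im.
by case: eqP => [E1|_]; [case/eqP: im; apply: val_inj|rewrite mulr0].
Qed.

Lemma chart0_coef n (p : {poly C}) : (size p <= n)%N ->
  c0 p = \sum_(j < n) c0 (p`_j)%:P * z ^+ j.
Proof.
move=> sp; have pE : p = \poly_(j < n) p`_j.
  apply/polyP => j; rewrite coef_poly; case: ltnP => // h.
  by rewrite nth_default // (leq_trans sp).
rewrite {1}pE poly_def rmorph_sum; apply: eq_bigr => j _.
by rewrite -mul_polyC rmorphM rmorphXn.
Qed.

Lemma H0_linesumP t (E2 : vbundle C t) (b : int) (y : sections C t) :
  trans E2 = linesum C t b ->
  H0 E2 y <-> forall i, c0 (y.1 i 0) = z ^ b * c1 (y.2 i 0).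
Proof.
move=> TE; rewrite /H0 /= TE linesumE mul_scalar_mx.
split=> [/colP h i|h]; first by have := h i; rewrite !mxE.
by apply/colP => i; rewrite !mxE.
Qed.

(* Since (O(b), H^0) is (O, C)^(b+1) modulo O(-1)^b and (O, C) has no           *)
(* nontrivial extensions, its extensions by (E1, V1) form the quotient of       *)
(* H^0(E1(1))^b by the image of V1^(b+1).  A class (f_j) is realised by lifting *)
(* z^j to ladder0 f j on U0 and to ladder1 b g (b - j) on U1.  The last clause  *)
(* says that no copy of (O(b), H^0) lifts to (E, V).                            *)
Lemma nonsplit_extension r t b (E1 : vbundle C r) (V1 : set (sections C r)) d1 k1 :
  V1 `<=` H0 E1 -> dims V1 k1 -> has_degree E1 d1 ->
  (t + b.+1 * k1)%N%:Z <= b%:Z * (d1 + 2 * r%:Z) ->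
  exists (E2 : vbundle C t) (E : vbundle C (r + t)) (B : 'M[F]_(r, t))
    (V : set (sections C (r + t))),
    [/\ trans E2 = linesum C t b%:Z /\ has_degree E2 (t%:Z * b%:Z),
        trans E = block_mx (trans E1) B 0 (trans E2),
        V `<=` H0 E /\ subspace V,
        sub_space V = V1 /\ quo_space V = H0 E2 &
        forall (c : 'cV[C]_t) (h0 h1 : 'cV[{poly C}]_r),
          (forall p q, c0 p = z ^ b%:Z * c1 q ->
             V (col_mx (p *: h0) (p *: map_mx polyC c),
                col_mx (q *: h1) (q *: map_mx polyC c))) -> c = 0].
Proof.
move=> V1H dV1 dE1 cnt; have sV1 := dims_subspace dV1.
have [I [v [tv fv cI]]] := twisted_sections b dE1.
have [bas basV1 fbas] := dV1.
pose sel (j : nat) : 'cV[{poly C}]_b := \col_j' (nat_of_ord j' == j)%:R.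
(* The rows [rsel l] encode the map O(-1)^b -> O^(b+1) with cokernel O(b): the sum of the
   [eta l *m rsel l] has j-th column eta_(j+1) - z eta_j. So [w] spans the image of V1^(b+1). *)
pose rsel (l : nat) : 'rV[{poly C}]_b :=
  \row_j' ((l == j'.+1)%:R - (l == j')%:R * 'X).
pose w (x : 'I_k1 * 'I_b.+1) : resC 'M[{poly C}]_(r, b) := (bas x.1).1 *m rsel x.2.
have [|A AP] := @independent_mod_family _ _ _ _ v w t fv.
  rewrite card_prod !card_ord -lez_nat (le_trans _ cI) //.
  by rewrite mulnC.
pose Phi i : resC 'M[{poly C}]_(r, b) := \sum_x A i x *: v x.
have /choice[Psi PsiE] : forall i, exists M1,
    map_mx c0 (Phi i) = z *: (trans E1 *m map_mx c1 M1).
  by move=> i; apply: twisted_section_sum.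
pose u i j := ladder0 (fun l => (Phi i : 'M_(r, b)) *m sel l) j.
pose vb i := ladder1 b (fun l => Psi i *m sel l).
pose vv i j := vb i (b - j)%N.
pose gam i : 'cV[F]_r := - (trans E1 *m map_mx c1 (vb i b)).
have sel01 j : map_mx c0 (sel j) = map_mx c1 (sel j).
  by apply/matrixP => k l; rewrite !mxE !rmorph_nat.
have glue i j : (j <= b)%N ->
    map_mx c0 (u i j) = trans E1 *m map_mx c1 (vv i j) + z ^+ j *: gam i.
  move=> jb; rewrite scalerN; apply: ladder_glue => // l.
  by rewrite !map_mxM PsiE sel01 mulmxA -scalemxAl.
(* A section y of O(b)^t has y1 = z^b y2, so the discrepancy, written with y1 and [gam], is z^b
   [gam] applied to y2. *)
pose B : 'M[F]_(r, t) := \matrix_(k, i) (z ^ b%:Z * gam i k 0).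
have lB : laurent_mx B.
  move=> k i; rewrite mxE; apply: laurentM; first exact: laurentXz.
  rewrite /gam; apply: laurent_mxN; apply: laurent_mulmx; last exact: laurent_mx1.
  exact: trans_laurent.
have [E2 TE2 dE2] := linesum_bundle C t b%:Z.
have [E TE] := extension_bundle E1 E2 lB.
pose L0 y := lift_map b u y; pose L1 y := lift_map b vv y.
(* A section is in [V] when subtracting the chosen lift of its image leaves an element of V1. Both
   lifts are read off the coefficients of the [U0] coordinate, which indexes [u] and [vv] alike. *)
pose V : set (sections C (r + t)) := [set s |
  H0 E2 (dsubmx s.1, dsubmx s.2) /\
  V1 (usubmx s.1 - L0 (dsubmx s.1), usubmx s.2 - L1 (dsubmx s.1))].
have L00 : L0 0 = 0 by exact: lift_map0.
have L10 : L1 0 = 0 by exact: lift_map0.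
have H00 : H0 E2 (0, 0) by rewrite /H0 /= !map_mx0 mulmx0.
have V10 : V1 (0, 0) by exact: sV1.1.
exists E2, E, B, V; split=> //.
- split=> [s [yH xH]|].
    set y1 := dsubmx s.1 in yH xH; set y2 := dsubmx s.2 in yH.
    have /= xE := V1H _ xH; rewrite /H0 /= in xE.
    have yE := (H0_linesumP (y1, y2) TE2).1 yH; rewrite /= in yE.
    have sz i : (size (y1 i 0%R) <= b.+1)%N.
      by case: (@glue_size _ b%:Z (y1 i 0) (y2 i 0) b.+1 (yE i)) => //; lia.
    have LE : map_mx c0 (L0 y1) = trans E1 *m map_mx c1 (L1 y1) + B *m map_mx c1 y2.
      have -> : B *m map_mx c1 y2 = \sum_i c0 (y1 i 0) *: gam i.
        apply/colP => k; rewrite summxE mxE; apply: eq_bigr => i _.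
        by rewrite [B k i]mxE [map_mx _ _ i 0]mxE [RHS]mxE yE mulrAC.
      rewrite /L0 /L1 /lift_map !map_mx_sum mulmx_sumr -big_split; apply: eq_bigr => i _.
      rewrite !map_mx_sum mulmx_sumr (chart0_coef (sz i)) scaler_suml -big_split.
      apply: eq_bigr => j _.
      rewrite !map_mxZ /= chart1C glue -1?ltnS // scalerDr -scalemxAr.
      by rewrite scalerA.
    rewrite /H0 /= TE -[s.1]vsubmxK -[s.2]vsubmxK !map_col_mx mul_block_col mul0mx add0r.
    congr col_mx; last exact: yH.
    move: xE; rewrite -/y1 !map_mxB mulmxBr => xE.
    rewrite -[LHS](subrK (map_mx c0 (L0 y1))) xE LE addrA.
    by rewrite -[_ - _ + _]addrA addNr addr0.
  split; first by rewrite /V /= !linear0 L00 L10 !subr0.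
  move=> a s s' [h1 h2] [h3 h4]; split.
    have := (H0_subspace E2).2 a _ _ h1 h3; congr (H0 E2).
    by congr pair; rewrite /= linearP.
  have := sV1.2 a _ _ h2 h4; congr V1.
  by congr pair; rewrite /= !linearP /L0 /L1 lift_mapP scalerBr opprD addrACA.
- have VE x : V (inl_sec t x) <-> V1 x.
    rewrite inl_secE /V /= !col_mxKu !col_mxKd L00 L10 !subr0.
    by case: x => x1 x2; split=> [[]|].
  split; apply/seteqP; split=> x.
  + by move/VE.
  + by move/VE.
  + by case=> s [yH xH] <-; rewrite pr2_secE.
  + move=> xH; exists (col_mx (L0 x.1) x.1, col_mx (L1 x.1) x.2).
      rewrite /V /= !col_mxKu !col_mxKd !subrr; split=> //.
    by rewrite pr2_secE /= !col_mxKd; case: x xH.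
move=> c h0 h1 split_.
(* The lift of z^j c given by the splitting minus the chosen one: the [U0] part of an element of V1.
   By [etaS], column j of the combination of the [Phi i] is z eta_j - eta_(j+1), so the combination
   lies in the span of [w] and c = 0. *)
pose eta j : 'cV[{poly C}]_r := 'X^j *: h0 - \sum_i (c i 0)%:P *: u i j.
have /choice[y yE] : forall j : 'I_b.+1, exists y : 'rV_k1,
    (lcomb bas y).1 = eta j.
  move=> j; have jb : (j <= b)%N by rewrite -ltnS.
  have : c0 'X^j = z ^ b%:Z * c1 'X^(b - j).
    rewrite !rmorphXn /= chart0X chart1X exprVn exprnN exprnP -expfzDr ?zcoord_neq0 //.
    by congr (z ^ _); lia.
  move=> /split_[_]; rewrite /= !col_mxKu !col_mxKd => /basV1[y0 y0E].
  exists y0; rewrite -y0E /= /eta; congr (_ - _).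
  exact: lift_map_monomial.
have c_0 : forall i, c i 0 = 0.
  apply: (AP _ (fun x => - y x.2 0 x.1)).
  have -> : \sum_x (- y x.2 0 x.1) *: w x =
      \sum_(l < b.+1) - (eta l *m rsel l) :> 'M_(r, b).
    rewrite -(pair_bigA _ (fun x1 x2 => (- y x2 0 x1) *: w (x1, x2))) /=.
    rewrite exchange_big; apply: eq_bigr => l _; rewrite -yE.
    rewrite /lcomb (_ : (\sum_i _).1 = \sum_i (y l 0 i)%:P *: (bas i).1).
      rewrite mulmx_suml -sumrN; apply: eq_bigr => i _.
      rewrite resC_scaleE /w /= polyCN scaleNr -scalemxAl.
      by [].
    by elim/big_ind2: _ => // x1 x2 y1 y2 <- <-.
  have -> : \sum_i c i 0 *: (\sum_x A i x *: v x) =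
      \sum_i (c i 0)%:P *: (Phi i : 'M_(r, b)) :> 'M_(r, b) by [].
  have etaS l : eta l.+1 = 'X *: eta l -
      \sum_i (c i 0)%:P *: ((Phi i : 'M_(r, b)) *m sel l).
    rewrite /eta exprS scalerBr scalerA scaler_sumr -addrA -opprD -big_split.
    congr (_ - _); apply: eq_bigr => i _ /=.
    by rewrite scalerDr !scalerA mulrC.
  apply/matrixP => k j; pose e l := eta l k 0.
  transitivity (- (e j.+1 - e j * 'X)).
    have -> : e j.+1 = e j * 'X - \sum_i (c i 0)%:P * (Phi i : 'M_(r, b)) k j.
      rewrite /e etaS mxE [X in X + _]mxE [X in _ + X]mxE mulrC; congr (_ - _).
      rewrite summxE; apply: eq_bigr => i _; rewrite mxE; congr (_ * _).
      rewrite mxE (bigD1 j) //= mxE eqxx mulr1 big1 ?addr0 // => l lj.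
      by rewrite mxE; case: eqP => [h|_]; [case/eqP: lj; apply: val_inj|rewrite mulr0].
    rewrite addrAC subrr add0r opprK summxE.
    by apply: eq_bigr => i _; rewrite mxE.
  have jb : (j.+1 < b.+1)%N by rewrite ltnS.
  rewrite -(sum_sel e jb) -(sum_sel e (ltnW jb)) mulr_suml -sumrB -sumrN summxE.
  apply: eq_bigr => l _; rewrite mxE mxE big_ord1 [rsel l 0 j]mxE mulrBr.
  by rewrite mulrA.
by apply/colP => i; rewrite mxE.
Qed.


End NonSplit.

(** * Extensions of a coherent system by copies of (O(a), 0) *)

Section NonSplitGraph.
Variable C : closedFieldType.
Local Notation F := (ratfun C).
Local Notation z := (zcoord C).
Local Notation c0 := (@chart0 C).
Local Notation c1 := (@chart1 C).

(* As e_i <= a, H^1(E2^*(a)) = 0, so the extensions of (E2, V2) by (O(a), 0)    *)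
(* have split bundles and form the quotient of Hom(V2, H^0(O(a))) by            *)
(* Hom(E2, O(a)); V is the graph of r maps V2 -> H^0(O(a)).  The last clause    *)
(* says that these are independent modulo Hom(E2, O(a)).                        *)
Lemma nonsplit_graph r t a (E2 : vbundle C t) (V2 : set (sections C t)) d2 k
    (e : 'I_t -> int) (P Q : 'M[{poly C}]_t) :
  V2 `<=` H0 E2 -> dims V2 k -> has_degree E2 d2 ->
  P \in unitmx -> Q \in unitmx ->
  trans E2 = map_mx c0 P *m zdiag C e *m map_mx c1 Q ->
  (forall i, e i <= a%:Z) ->
  r%:Z + (t * a.+1)%N%:Z - d2 <= (a.+1 * k)%N%:Z ->
  exists (E1 : vbundle C r) (E : vbundle C (r + t)) (V : set (sections C (r + t))),
    [/\ trans E1 = linesum C r a%:Z /\ has_degree E1 (r%:Z * a%:Z),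
        trans E = block_mx (trans E1) 0 0 (trans E2),
        V `<=` H0 E /\ subspace V,
        sub_space V = [set 0] /\ quo_space V = V2 &
        forall (c : 'rV[C]_r) (h0 h1 : 'rV[{poly C}]_t),
          map_mx c0 h0 *m trans E2 = z ^ a%:Z *: map_mx c1 h1 ->
          (forall s, V s -> map_mx polyC c *m usubmx s.1 = h0 *m dsubmx s.1) ->
          c = 0].
Proof.
move=> V2H dV2 dE2 uP uQ TE2 ea cnt; have [bas basV fbas] := dV2.
(* The dimension of H^0(O(a - e_i)); as e_i <= a, the absolute value changes nothing. *)
pose N i := absz (a%:Z - e i + 1).
have NE i : (N i)%:Z = a%:Z - e i + 1 by have := ea i; rewrite /N; lia.
pose Bm : 'M[{poly C}]_(t, k) := \matrix_(i, l) (bas l).1 i 0.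
(* In the basis [bas] of V2, [v0] is a basis of Hom(V2, H^0(O(a))), and [w0] below consists of the
   restrictions to V2 of a basis of Hom(E2, O(a)), whose elements have entries of degree at most a -
   e_i in split coordinates. *)
pose v0 (x : 'I_k * 'I_a.+1) : 'rV[{poly C}]_k := 'X^(x.2) *: delta_mx 0 x.1.
pose v : _ -> resC 'rV[{poly C}]_k := v0.
pose w0 (x : {i : 'I_t & 'I_(N i)}) : 'rV[{poly C}]_k :=
  'X^(tagged x) *: (row (tag x) (invmx P) *m Bm).
pose w : _ -> resC 'rV[{poly C}]_k := w0.
have vE (c : 'I_k * 'I_a.+1 -> C) l :
    (\sum_x (c x)%:P *: v0 x) 0 l = \sum_(j < a.+1) (c (l, j))%:P * 'X^j.
  rewrite (eq_bigr (fun x => (c (x.1, x.2))%:P *: v0 (x.1, x.2))); last by case.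
  rewrite -(pair_bigA _ (fun x1 x2 => (c (x1, x2))%:P *: v0 (x1, x2))) /= summxE.
  rewrite (bigD1 l) //= [X in _ + X]big1 ?addr0 => [|l' l'l].
    rewrite summxE; apply: eq_bigr => j _.
    by rewrite !mxE !eqxx mulr1.
  rewrite summxE big1 // => j _; rewrite !mxE.
  by rewrite eq_sym (negPf l'l) andbF !mulr0.
have [||A AP] := @independent_mod_family _ _ _ _ v w r.
- move=> c cv0 [l j]; have := vE c l.
  rewrite (_ : \sum_x _ = 0); last exact: cv0.
  rewrite mxE => /(congr1 (fun p : {poly C} => p`_j)); rewrite coef0 coef_sum.
  rewrite (bigD1 j) //= coefCM coefXn eqxx mulr1 big1 ?addr0 // => i ij.
  rewrite coefCM coefXn; case: (nat_of_ord j =P i) => [h|_]; last by rewrite mulr0.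
  by case/eqP: ij; apply: val_inj.
- rewrite card_prod !card_ord card_tagged sumnE big_map big_enum /=.
  rewrite -lez_nat mulnC (le_trans _ cnt) // PoszD -addrA lerD2l.
  rewrite (big_morph Posz PoszD (erefl _)).
  under eq_bigr do rewrite card_ord NE.
  rewrite (degree_BG uP uQ TE2 dE2) big_split big_split /= sumrN !sumr_const.
  rewrite !card_ord -mulr_natr -[1 *+ t]mulr_natr natz PoszM.
  have -> : \sum_(i in 'I_t) e i = \sum_i e i by apply: eq_bigl.
  by generalize (\sum_i e i); clear; lia.
pose Phi : 'M[{poly C}]_(r, k) :=
  \matrix_(i, l) (\sum_x (A i x)%:P *: v0 x) 0 l.
pose Psi : 'M[{poly C}]_(r, k) := \matrix_(i, l) revpoly a (Phi i l).
have PhiPsi : map_mx c0 Phi = z ^ a%:Z *: map_mx c1 Psi.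
  apply/matrixP => i l; rewrite [LHS]mxE [RHS]mxE [X in _ * X]mxE [Psi i l]mxE -rev_chart0 //.
  rewrite mxE vE (leq_trans (size_sum _ _ _)) //; apply/bigmax_leqP => j _.
  rewrite mul_polyC (leq_trans (size_scale_leq _ _)) // size_polyXn.
  exact: ltn_ord.
have [E1 TE1 dE1] := linesum_bundle C r a%:Z.
have l0 : laurent_mx (0 : 'M[F]_(r, t)).
  by rewrite -(map_mx0 c0); exact: laurent_mx0.
have [E TE] := extension_bundle E1 E2 l0.
pose cc (c : 'rV[C]_k) : 'cV[{poly C}]_k := map_mx polyC c^T.
pose g (c : 'rV[C]_k) : sections C (r + t) :=
  (col_mx (Phi *m cc c) (lcomb bas c).1, col_mx (Psi *m cc c) (lcomb bas c).2).
pose V : set (sections C (r + t)) := [set s | exists c, s = g c].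
have ccP a0 c d : cc (a0 *: c + d) = a0%:P *: cc c + cc d.
  by apply/matrixP => i j; rewrite !mxE polyCD polyCM.
have cc01 c : map_mx c0 (cc c) = map_mx c1 (cc c).
  apply/matrixP => i j; rewrite [LHS]mxE [RHS]mxE [cc c i j]mxE.
  exact/esym/chart1C.
have cc0 : cc 0 = 0 by apply/matrixP => i j; rewrite !mxE.
exists E1, E, V; split=> //.
- split=> [_ [c ->]|].
    have : H0 E2 (lcomb bas c) by apply: V2H; apply/basV; exists c.
    rewrite /H0 /= TE !map_col_mx mul_block_col !mul0mx add0r addr0 => <-.
    rewrite !map_mxM PhiPsi TE1 linesumE mul_scalar_mx -scalemxAl.
    by rewrite cc01.
  split; first by exists 0; rewrite /g cc0 lcomb0 !mulmx0 !col_mx0.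
  move=> a0 _ _ [c ->] [d ->]; exists (a0 *: c + d).
  rewrite /g ccP lcomb_is_linear !mulmxDr -!scalemxAr.
  by congr pair; rewrite /= -add_col_mx -scale_col_mx.
- split; apply/seteqP; split=> x.
  + move=> [c]; rewrite inl_secE /g => -[/eq_col_mx[u0 b0] /eq_col_mx[u1 b1]].
    have /fbas c_0 : lcomb bas c = 0.
      by rewrite [lcomb bas c]surjective_pairing -b0 -b1.
    rewrite c_0 cc0 !mulmx0 in u0 u1.
    by rewrite /= [x]surjective_pairing u0 u1.
  + move=> ->; exists 0; rewrite /g cc0 lcomb0 !mulmx0 linear0.
    by rewrite !col_mx0.
  + move=> [_ [c ->] <-]; rewrite pr2_secE /g /= !col_mxKd -surjective_pairing.
    by apply/basV; exists c.
  + move=> /basV[c ->]; exists (g c); first by exists c.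
    by rewrite pr2_secE /g /= !col_mxKd -surjective_pairing.
move=> c h0 h1 h0T split_.
(* In split coordinates the homomorphism has entries in H^0(O(a - e_i)), so [h0 *m Bm] lies in the
   span of [w]. The hypothesis identifies it with the combination of the rows of [Phi] given by
   c. *)
pose p := h0 *m P.
have sp i : (size (p 0%R i) <= N i)%N.
  have QQ : map_mx c1 Q *m map_mx c1 (invmx Q) = 1%:M.
    by rewrite -map_mxM (mulmxV uQ) map_mx1.
  have pE : map_mx c0 p *m zdiag C e = z ^ a%:Z *: map_mx c1 (h1 *m invmx Q).
    rewrite !map_mxM scalemxAl -h0T TE2 -!mulmxA QQ mulmx1.
    by rewrite mulmxA.
  have E3 : c0 (p 0 i) = z ^ (a%:Z - e i) * c1 ((h1 *m invmx Q) 0 i).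
    apply: (mulIf (expfz_neq0 (e i) (zcoord_neq0 C))).
    rewrite mulrAC -expfzDr ?zcoord_neq0 // subrK.
    move/rowP/(_ i): pE; rewrite mul_mx_diag mxE [X in X * _]mxE.
    by rewrite [X in _ * X]mxE => ->; rewrite 2!mxE.
  case: (@glue_size _ (a%:Z - e i) (p 0 i) ((h1 *m invmx Q) 0 i) (N i) E3) => //.
  by rewrite NE; lia.
have c_0 : forall i, c 0 i = 0.
  apply: (AP _ (fun x => (p 0 (tag x))`_(tagged x))).
  have -> : \sum_(x : {i : 'I_t & 'I_(N i)}) (p 0 (tag x))`_(tagged x) *: w x =
      h0 *m Bm :> 'rV[{poly C}]_k.
    transitivity (\sum_(x : {i : 'I_t & 'I_(N i)})
        ((p 0 (tag x))`_(tagged x))%:P *: w0 x); first by [].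
    have <- : p *m invmx P *m Bm = h0 *m Bm by rewrite /p -(mulmxA h0) (mulmxV uP) mulmx1.
    rewrite -mulmxA mulmx_sum_row.
    transitivity (\sum_i \sum_(l < N i)
        ((p 0 i)`_l)%:P *: ('X^l *: (row i (invmx P) *m Bm))).
      by rewrite sig_big_dep; apply: eq_bigl.
    apply: eq_bigr => i _; rewrite row_mul.
    have pE : p 0 i = \sum_(l < N i) ((p 0 i)`_l)%:P * 'X^l.
      have p0E : p 0 i = \poly_(l < N i) (p 0 i)`_l.
        apply/polyP => l; rewrite coef_poly; case: ltnP => // h.
        by rewrite nth_default // (leq_trans (sp i)).
      by rewrite {1}p0E poly_def; apply: eq_bigr => l _; rewrite mul_polyC.
    rewrite {2}pE scaler_suml; apply: eq_bigr => l _.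
    by rewrite scalerA.
  apply/rowP => l; rewrite summxE.
  have := split_ (g (delta_mx 0 l)) (ex_intro _ _ erefl).
  rewrite /g /= col_mxKu col_mxKd lcomb_delta => /matrixP/(_ 0 0).
  rewrite [RHS]mxE => E4.
  transitivity (\sum_j h0 0 j * (bas l).1 j 0).
    rewrite -E4 mxE; apply: eq_bigr => i _.
    rewrite resC_scaleE mxE mxE; congr (_ * _).
    have ccd l' : cc (delta_mx 0 l) l' 0 = (l' == l)%:R.
      by rewrite !mxE eqxx /= rmorph_nat.
    have -> : (Phi *m cc (delta_mx 0 l)) i 0 = Phi i l.
      rewrite mxE (bigD1 l) //= ccd eqxx mulr1 big1 ?addr0 //.
      by move=> l' /negPf l'l; rewrite ccd l'l mulr0.
    by rewrite [Phi i l]mxE.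
  by rewrite mxE; apply: eq_bigr => j _; rewrite mxE.
by apply/rowP => i; rewrite [RHS]mxE.
Qed.

End NonSplitGraph.

(** * Rank zero, sections of O(b)^t, and line subsheaves *)

Section Preparation.
Variable C : closedFieldType.
Local Notation F := (ratfun C).
Local Notation z := (zcoord C).
Local Notation c0 := (@chart0 C).
Local Notation c1 := (@chart1 C).

Lemma dims_sections0 (S : set (sections C 0)) k : dims S k -> k = 0%N.
Proof.
move=> [b _ fb]; case: k b fb => // k b fb.
have b0 i : b i = 0.
  by rewrite [b i]surjective_pairing (flatmx0 (b i).1) (flatmx0 (b i).2).
have /rowP/(_ ord0)/eqP : (const_mx 1 : 'rV[C]_k.+1) = 0.
  by apply: fb; rewrite /lcomb big1 // => i _; rewrite b0 scaler0.
by rewrite !mxE oner_eq0.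
Qed.

Lemma has_degree0 (E : vbundle C 0) d : has_degree E d -> d = 0.
Proof.
move=> dE; apply: has_degree_uniq dE _; exists 1; first exact: oner_neq0.
by rewrite det_mx00 rmorph1 mul1r expr0z.
Qed.

Lemma dims_set0 n : dims ([set 0] : set (sections C n)) 0.
Proof.
exists (fun _ => 0) => [v|c _]; last by apply/rowP => -[].
split=> [->|[c ->]]; first by exists 0; rewrite lcomb0.
by rewrite /lcomb big_ord0.
Qed.

Lemma dims_matrix (K : fieldType) p q : dims [set: 'M[K]_(p, q)] (p * q).
Proof.
have E (c : 'rV[K]_(p * q)) :
    lcomb (fun i => vec_mx (delta_mx 0 i)) c = vec_mx c :> 'M_(p, q).
  rewrite [in RHS](row_sum_delta c) linear_sum; apply: eq_bigr => i _.
  by rewrite linearZ.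
exists (fun i => vec_mx (delta_mx 0 i)) => [v|c].
  by split=> // _; exists (mxvec v); rewrite E mxvecK.
by rewrite E => /(congr1 mxvec); rewrite vec_mxK linear0.
Qed.

Lemma dims_H0_linesum t b (E : vbundle C t) :
  trans E = linesum C t b%:Z -> dims (H0 E : set (sections C t)) (t * b.+1).
Proof.
move=> TE.
pose f (M : 'M[C]_(t, b.+1)) : sections C t :=
  (\col_i \sum_j (M i j)%:P * 'X^j, \col_i \sum_j (M i j)%:P * 'X^(b - j)).
have fl : linear f.
  move=> a M N; congr pair; apply/colP => i; rewrite !mxE mulr_sumr -big_split;
  by apply: eq_bigr => j _; rewrite !mxE polyCD polyCM mulrDl mulrA.
pose fL : {linear 'M[C]_(t, b.+1) -> sections C t} :=
  HB.pack f (GRing.isLinear.Build _ _ _ _ f fl).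
have coefE (M : 'M[C]_(t, b.+1)) i (j : 'I_b.+1) :
    (\sum_l (M i l)%:P * 'X^l)`_j = M i j.
  rewrite coef_sum (bigD1 j) //= coefCM coefXn eqxx mulr1 big1 ?addr0 // => l lj.
  rewrite coefCM coefXn; case: (nat_of_ord j =P l) => [h|_]; last by rewrite mulr0.
  by case/eqP: lj; apply: val_inj.
have fI : injective fL.
  move=> M N /(congr1 fst) /= /colP E1; apply/matrixP => i j.
  by have := E1 i; rewrite !mxE => /(congr1 (fun p : {poly C} => p`_j)); rewrite !coefE.
have := dims_image fI (dims_matrix C t b.+1); congr dims.
apply/seteqP; split=> [_ [M _ <-]|y /(H0_linesumP y TE) yE].
  apply/(H0_linesumP _ TE) => i; rewrite /= !mxE !rmorph_sum mulr_sumr.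
  apply: eq_bigr => j _; rewrite !rmorphM !rmorphXn /= chart0X chart1X chart1C.
  rewrite mulrCA exprVn exprnN -expfzDr ?zcoord_neq0 //; congr (_ * _).
  by rewrite exprnP; congr (z ^ _); have := ltn_ord j; lia.
have sz i : (size (y.1 i 0%R) <= b.+1)%N.
  by case: (@glue_size _ b%:Z (y.1 i 0) (y.2 i 0) b.+1 (yE i)) => //; lia.
pose M : 'M[C]_(t, b.+1) := \matrix_(i, j) (y.1 i 0)`_j; exists M => //.
have y1E : (fL M).1 = y.1.
  apply/colP => i; rewrite mxE.
  have yP : y.1 i 0 = \poly_(j < b.+1) (y.1 i 0)`_j.
    apply/polyP => j; rewrite coef_poly; case: ltnP => // h.
    by rewrite nth_default // (leq_trans (sz i)).
  by rewrite [RHS]yP poly_def; apply: eq_bigr => j _; rewrite mxE mul_polyC.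
suff y2E : (fL M).2 = y.2.
  by rewrite [RHS]surjective_pairing -y1E -y2E.
apply/colP => i; apply: (@chart1_inj C).
apply: (mulfI (expfz_neq0 b%:Z (zcoord_neq0 C))); rewrite -yE -y1E.
rewrite /= ![in LHS]mxE [in RHS]mxE !rmorph_sum mulr_sumr.
apply: eq_bigr => j _; rewrite !rmorphM !rmorphXn /= chart0X chart1X chart1C.
rewrite mulrCA exprVn exprnN -expfzDr ?zcoord_neq0 //; congr (_ * _).
by rewrite exprnP; congr (z ^ _); have := ltn_ord j; lia.
Qed.

Lemma cohsys_of n (E : vbundle C n) (V : set (sections C n)) :
  V `<=` H0 E -> subspace V ->
  exists X : cohsys C n, cs_bundle X = E /\ cs_space X = V.
Proof. by move=> VH [V0 Vl]; exists (CohSys VH V0 Vl). Qed.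

Lemma subline_BG t (E : vbundle C t) (e : 'I_t -> int) (P Q : 'M[{poly C}]_t) i :
  P \in unitmx -> Q \in unitmx ->
  trans E = map_mx c0 P *m zdiag C e *m map_mx c1 Q ->
  exists (L : vbundle C 1) (f : bhom L E),
    [/\ has_degree L (e i), minj (hom0 f) & minj (hom1 f)].
Proof.
move=> uP uQ TE; have [L TL dL] := linesum_bundle C 1 (e i).
have QQ : map_mx c1 Q *m map_mx c1 (invmx Q) = 1%:M.
  by rewrite -map_mxM (mulmxV uQ) map_mx1.
have gl : map_mx c0 (col i P) *m trans L = trans E *m map_mx c1 (col i (invmx Q)).
  rewrite TL TE linesumE mul_mx_scalar !colE !map_mxM !map_delta_mx.
  rewrite -!mulmxA (mulmxA (map_mx c1 Q)) QQ mul1mx scalemxAr; congr (_ *m _).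
  apply/matrixP => j k; rewrite mul_diag_mx !mxE.
  by case: eqP => [->|_] //=; rewrite !mulr0.
have mcol (U : 'M[{poly C}]_t) : U \in unitmx -> minj (col i U).
  move=> uU; rewrite colE; apply: minjM; first exact: minj_unit.
  apply: (@minj_linv _ _ _ _ (delta_mx 0 i)); rewrite mul_delta_mx.
  by apply/matrixP => j k; rewrite !ord1 !mxE.
exists L, (BHom gl); split=> /=; first by rewrite mul1r in dL.
  exact: mcol.
by apply: mcol; rewrite unitmx_inv.
Qed.

End Preparation.

(** * Stability of the extensions *)

(** The removed part of rank s + 1 has ratio a of sections to rank, above the ratio of the whole, so
    removing it lowers the ratio. *)
Lemma slope_ltn (k k' a s n : nat) :
  (k' + a * s.+1)%N = k -> (k < a * (n + s.+1))%N -> (k' * (n + s.+1) < k * n)%N.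
Proof.
move=> <- lt; have : ((k' + a * s.+1) * s.+1 < a * (n + s.+1) * s.+1)%N.
  by rewrite ltn_pmul2r.
lia.
Qed.

Section Cases.
Variable R : realType.
Local Notation C := (R[i]).
Local Notation z := (zcoord C).
Local Notation c0 := (@chart0 C).
Local Notation c1 := (@chart1 C).

(** The kernel or image part of a subsheaf may have rank 0, where all invariants vanish. *)
Lemma stable_weak0 (alpha : R) n (X : cohsys C n) d k m (E' : vbundle C m)
    (f : bhom E' (cs_bundle X)) d' k' (mu : R) :
  0 < alpha -> stable alpha X -> has_type X d k ->
  minj (hom0 f) -> minj (hom1 f) -> has_degree E' d' ->
  dims (pull (hom0 f) (hom1 f) (cs_space X)) k' ->
  d%:~R + alpha * k%:R = mu * n%:R ->
  d'%:~R + alpha * k'%:R <= mu * m%:R /\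
  (d'%:~R + alpha * k'%:R = mu * m%:R ->
     [/\ m = 0%N, d' = 0 & k' = 0%N] \/ [/\ m = n, d' = d & k' = k]).
Proof.
move=> al0 st tX i0 i1 dE' dk' hmu.
have [m0|m0] := posnP m.
  subst m; rewrite (has_degree0 dE') (dims_sections0 dk') !mulr0 addr0.
  by split=> // _; left.
have [h1 h2] := stable_weak al0 st tX m0 i0 i1 dE' dk' hmu.
by split=> // /h2; right.
Qed.

(** Here [b.+1] is the a of the theorem. The part of E' in X1 is bounded by stability and the part
    in O(b)^t by splitting; only ties need the independence of the classes. *)
Lemma case_a (alpha : R) r t b k (X1 : cohsys C r) :
  0 < alpha -> (0 < r)%N -> (b.+1 * t <= k)%N -> (k < b.+1 * (r + t))%N ->
  alpha * (b.+1%:R * (r + t)%:R - k%:R) = r%:R ->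
  (t + b.+1 * (k - b.+1 * t) <= b * (b.+1 * r + 2 * r))%N ->
  has_type X1 (b.+1 * r)%N%:Z (k - b.+1 * t) -> stable alpha X1 ->
  exists2 M : set (set (cohsys C (r + t))),
    is_Gplus alpha ((b.+1 * r)%N%:Z + t%:Z * b%:Z) k M & M !=set0.
Proof.
move=> al0 r0 atk kan alE cnt tX1 st1; have [dX1 /has_dimP kX1] := tX1.
have [|E2 [E [B [V [[TE2 dE2] TE [VH sV] [subV quoV] NS]]]]] :=
    @nonsplit_extension _ r t b (cs_bundle X1) _ _ _ (@cs_space_sub _ _ X1) kX1 dX1.
  have -> : b%:Z * ((b.+1 * r)%N%:Z + 2 * r%:Z) = (b * (b.+1 * r + 2 * r))%N%:Z.
    by clear; lia.
  by rewrite lez_nat.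
have [X [XE XV]] := cohsys_of VH sV.
have kV : dims V k.
  have dq : dims (quo_space V) (t * b.+1) by rewrite quoV; apply: dims_H0_linesum.
  have ds : dims (sub_space V) (k - b.+1 * t) by rewrite subV.
  by have := dims_subquo_ext sV ds dq; rewrite (mulnC t) subnK.
(* The slope of (O(b), H^0); the equation for alpha makes it the slope of X1 too. *)
pose mu : R := b%:R + alpha * b.+1%:R.
have alE' : alpha * k%:R = alpha * b.+1%:R * (r%:R + t%:R) - r%:R.
  by move: alE; rewrite natrD; lra.
have kR : (k - b.+1 * t)%N%:R = k%:R - b.+1%:R * t%:R :> R by rewrite natrB // natrM.
have hmu1 : (b.+1 * r)%N%:Z%:~R + alpha * (k - b.+1 * t)%N%:R = mu * r%:R.
  rewrite kR -pmulrn natrM mulrBr alE' /mu -[b.+1]addn1 natrD; ring.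
have hmu : ((b.+1 * r)%N%:Z + t%:Z * b%:Z)%:~R + alpha * k%:R = mu * (r + t)%N%:R.
  rewrite alE' -PoszM -PoszD -pmulrn !natrD !natrM /mu -[b.+1]addn1 natrD; ring.
have tX : has_type X ((b.+1 * r)%N%:Z + t%:Z * b%:Z) k.
  split; first by rewrite XE; apply: (has_degree_block TE dX1 dE2).
  by apply/has_dimP; rewrite XV.
apply: (Gplus_nonempty (mu := mu) al0 _ tX hmu); first by rewrite addn_gt0 r0.
rewrite XE XV => m E' f d' k' m0 i0 i1 dE' dk'.
have [se] := subext_exists TE kV i0 i1 dE' dk'.
case: se => m1 m2 EK EI fK fI T H0' H1' dK dI kK kI m12 dKI k'le glue
  [iK0 iK1 iI0 iI1] dEK dEI dkK dkI lift.
rewrite subV in dkK; rewrite quoV in dkI lift.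
have [leK eqK] := stable_weak0 al0 st1 tX1 iK0 iK1 dEK dkK hmu1.
have [dIle kIle constI] := sub_linesum TE2 iI0 iI1 dEI.
have pullI : pull (hom0 fI) (hom1 fI) (H0 E2) = H0 EI.
  by apply/seteqP; split=> s /(pull_H0 s iI0).
rewrite pullI in dkI lift; have {}kIle := kIle _ dkI.
have dIR : dI%:~R <= m2%:R * b%:R :> R.
  by rewrite (le_trans (_ : _ <= (m2%:Z * b%:Z)%:~R)) ?ler_int // -PoszM -pmulrn natrM.
have kIR : kI%:R <= m2%:R * b.+1%:R :> R by rewrite -natrM ler_nat.
have k'R : k'%:R <= kK%:R + kI%:R :> R by rewrite -natrD ler_nat.
have mR : m%:R = m1%:R + m2%:R :> R by rewrite -m12 natrD.
have dR : d'%:~R = dK%:~R + dI%:~R :> R by rewrite -dKI rmorphD.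
have a1 : alpha * kI%:R <= alpha * (m2%:R * b.+1%:R) by rewrite ler_pM2l.
have a2 : alpha * k'%:R <= alpha * (kK%:R + kI%:R) by rewrite ler_pM2l.
have muE : mu * m%:R = mu * m1%:R + m2%:R * b%:R + alpha * (m2%:R * b.+1%:R).
  by rewrite mR /mu; ring.
rewrite muE dR; rewrite mulrDr in a2.
split=> [|eqt]; first by lra.
(* The slope bound is the sum of four inequalities, so a tie makes each an equality. *)
have e1 : dI%:~R = m2%:R * b%:R :> R by lra.
have e2 : alpha * kI%:R = alpha * (m2%:R * b.+1%:R) by lra.
have e3 : dK%:~R + alpha * kK%:R = mu * m1%:R by lra.
have e4 : alpha * k'%:R = alpha * (kK%:R + kI%:R) by rewrite mulrDr; lra.
have aI := mulfI (lt0r_neq0 al0).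
have {}e4 : k' = (kK + kI)%N.
  by apply/eqP; rewrite -(eqr_nat R) natrD (aI _ _ e4).
have {}e2 : kI = (m2 * b.+1)%N.
  by apply/eqP; rewrite -(eqr_nat R) natrM (aI _ _ e2).
have {}e1 : dI = m2%:Z * b%:Z.
  by apply/eqP; rewrite -(eqr_int R) e1 -PoszM -pmulrn natrM.
have m2t : (m2 <= t)%N := minj_leq iI0.
(* If K is all of X1, then E' is everything or misses s + 1 copies of (O(b), H^0), and its ratio
   k'/m is smaller. *)
case: (eqK e3) => -[m1E dKE kKE]; last first.
  have [m2E|m2lt] := eqVneq m2 t.
    right; split; [lia| |].
      by rewrite -dKI dKE e1 m2E.
    by rewrite e4 kKE e2 m2E; lia.
  left; have lt : (m2 < t)%N by lia.
  have [s tE] : exists s, t = (m2 + s.+1)%N by exists (t - m2).-1; lia.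
  have kE : (k' + b.+1 * s.+1 = k)%N by rewrite e4 kKE e2; nia.
  rewrite -m12 m1E tE addnA; apply: (slope_ltn kE).
  by rewrite -addnA -tE.
(* If K = 0, a copy of (O(b), H^0) in the constant direction [col j0 A] lifts to (E, V); [NS] forces
   this direction to vanish, against injectivity. *)
exfalso; subst m1; have m2p : (0 < m2)%N by lia.
have [P [Q [A [uP uQ GP GQ TI]]]] := constI e1.
pose j0 := Ordinal m2p.
have GPj : hom0 fI *m col j0 P = map_mx polyC (col j0 A).
  by rewrite colE mulmxA GP -colE map_col.
have GQj : hom1 fI *m col j0 Q = map_mx polyC (col j0 A).
  by rewrite colE mulmxA GQ -colE map_col.
have cA : col j0 A = 0.
  apply: (NS _ (H0' *m col j0 P) (H1' *m col j0 Q)) => p q pq.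
  have [|x] := lift e4 (p *: col j0 P, q *: col j0 Q).
    rewrite -pullI; apply/(H0_linesumP _ TE2) => i.
    rewrite /= -!scalemxAr GPj GQj [X in c0 X]mxE [X in c1 X]mxE.
    rewrite !rmorphM /= pq -mulrA; congr (_ * (_ * _)).
    by rewrite [X in c0 X]mxE [X in c1 X]mxE chart1C.
  rewrite /= -!scalemxAr GPj GQj (flatmx0 x.1) (flatmx0 x.2) !mulmx0 !add0r.
  by [].
have iGP : minj (hom0 fI *m P) by apply: minjM => //; apply: minj_unit.
have /(minjI iGP)/colP/(_ j0)/eqP :
    hom0 fI *m P *m delta_mx j0 0 = hom0 fI *m P *m (0 : 'cV_m2).
  by rewrite mulmx0 -mulmxA -colE GPj cA map_mx0.
by rewrite !mxE !eqxx oner_eq0.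
Qed.

(** Here [a.+1] is the a of the theorem: it is the degree of the line bundles in E1 and the slope of
    X2. *)
Lemma case_b (alpha : R) r t a k (X2 : cohsys C t) :
  0 < alpha -> (0 < r)%N -> (0 < k)%N -> alpha * k%:R = t%:R ->
  (r + 2 * t <= a.+2 * k)%N ->
  has_type X2 (a%:Z * t%:Z) k -> stable alpha X2 ->
  exists2 M : set (set (cohsys C (r + t))),
    is_Gplus alpha (r%:Z * a.+1%:Z + a%:Z * t%:Z) k M & M !=set0.
Proof.
move=> al0 r0 k0 alE cnt tX2 st2; have [dX2 /has_dimP kX2] := tX2.
pose mu : R := a.+1%:R.
have hmu2 : (a%:Z * t%:Z)%:~R + alpha * k%:R = mu * t%:R.
  by rewrite alE -PoszM -pmulrn natrM /mu -addn1 natrD; ring.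
have [e [P [Q [uP uQ TE2]]]] := birkhoff_grothendieck (cs_bundle X2).
(* Stability of X2 is tested on the summand O(e_i), whose slope is at least e_i. *)
have ea i : e i <= a.+1%:Z.
  have [L [f [dL i0 i1]]] := subline_BG i uP uQ TE2.
  have [l _ dl] := dims_preim (secmul_inj i0 i1) kX2.
  have [+ _] := stable_weak0 al0 st2 tX2 i0 i1 dL dl hmu2.
  have : 0 <= alpha * l%:R by rewrite mulr_ge0 // ltW.
  by rewrite mulr1 -(ler_int R) -pmulrn /mu; lra.
have [|E1 [E [V [[TE1 dE1] TE [VH sV] [subV quoV] NS]]]] :=
    @nonsplit_graph _ r t a.+1 (cs_bundle X2) _ _ _ _ _ _ (@cs_space_sub _ _ X2)
      kX2 dX2 uP uQ TE2 ea.
  by rewrite -PoszM; lia.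
have [X [XE XV]] := cohsys_of VH sV.
have kV : dims V k.
  have ds : dims (sub_space V) 0 by rewrite subV; apply: dims_set0.
  have dq : dims (quo_space V) k by rewrite quoV.
  by have := dims_subquo_ext sV ds dq.
have hmu : (r%:Z * a.+1%:Z + a%:Z * t%:Z)%:~R + alpha * k%:R = mu * (r + t)%N%:R.
  by rewrite rmorphD /= -addrA hmu2 -PoszM -pmulrn natrM natrD /mu; ring.
have tX : has_type X (r%:Z * a.+1%:Z + a%:Z * t%:Z) k.
  split; first by rewrite XE; apply: (has_degree_block TE dE1 dX2).
  by apply/has_dimP; rewrite XV.
apply: (Gplus_nonempty (mu := mu) al0 _ tX hmu); first by rewrite addn_gt0 r0.
rewrite XE XV => m E' f d' k' m0 i0 i1 dE' dk'.
have [se] := subext_exists TE kV i0 i1 dE' dk'.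
case: se => m1 m2 EK EI fK fI T H0' H1' dK dI kK kI m12 dKI k'le glue
  [iK0 iK1 iI0 iI1] dEK dEI dkK dkI lift.
rewrite subV in dkK; rewrite quoV in dkI lift.
have kK0 : kK = 0%N.
  have [l] := dims_preim (secmul_inj iK0 iK1) (dims_set0 C r).
  by rewrite leqn0 => /eqP -> /(dims_uniq dkK).
have [leI eqI] := stable_weak0 al0 st2 tX2 iI0 iI1 dEI dkI hmu2.
have [dKle _ constK] := sub_linesum TE1 iK0 iK1 dEK.
rewrite kK0 add0n in k'le lift.
have dKR : dK%:~R <= m1%:R * a.+1%:R :> R.
  by rewrite (le_trans (_ : _ <= (m1%:Z * a.+1%:Z)%:~R)) ?ler_int // -PoszM -pmulrn natrM.
have k'R : k'%:R <= kI%:R :> R by rewrite ler_nat.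
have mR : m%:R = m1%:R + m2%:R :> R by rewrite -m12 natrD.
have dR : d'%:~R = dK%:~R + dI%:~R :> R by rewrite -dKI rmorphD.
have a2 : alpha * k'%:R <= alpha * kI%:R by rewrite ler_pM2l.
have muE : mu * m%:R = mu * m2%:R + m1%:R * a.+1%:R by rewrite mR /mu; ring.
rewrite muE dR; split=> [|eqt]; first by lra.
have e1 : dK%:~R = m1%:R * a.+1%:R :> R by lra.
have e3 : dI%:~R + alpha * kI%:R = mu * m2%:R by lra.
have e4 : alpha * k'%:R = alpha * kI%:R by lra.
have {}e4 : k' = kI.
  by apply/eqP; rewrite -(eqr_nat R) (mulfI (lt0r_neq0 al0) e4).
have {}e1 : dK = m1%:Z * a.+1%:Z.
  by apply/eqP; rewrite -(eqr_int R) e1 -PoszM -pmulrn natrM.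
have m1r : (m1 <= r)%N := minj_leq iK0.
(* If I = 0 then k' = 0, while k and m are positive. Otherwise I is all of X2 and only K can be
   proper. *)
case: (eqI e3) => -[m2E dIE kIE].
  by left; rewrite e4 kIE mul0n muln_gt0 k0.
have [m1E|m1ne] := eqVneq m1 r.
  right; split; [lia| |by rewrite e4].
  by rewrite -dKI e1 dIE m1E.
have {}m1r : (m1 < r)%N by rewrite ltn_neqAle m1ne.
exfalso; subst m2.
have [P1 [Q1 [A [uP1 uQ1 KP KQ TK]]]] := constK e1.
have [_ /(_ dIE)[uG0 uG1]] := degree_change (hom_glue fI) iI0 iI1 dX2 dEI.
(* The proper constant subspace spanned by A is killed by a nonzero functional c. Pushing the
   extension out along c kills K, and [H0'], [H1'] then provide a splitting over E2, which [NS]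
   excludes. *)
have [c cn cA] : exists2 c : 'rV[C]_r, c != 0 & c *m A = 0.
  have : kermx A != 0.
    rewrite kermx_eq0 /row_free; apply: contraL m1r => /eqP rA.
    by rewrite -leqNgt -rA rank_leq_col.
  move=> /rowV0Pn[c /sub_kermxP cA cn]; by exists c.
pose cp : 'rV[{poly C}]_r := map_mx polyC c.
have cK0 : cp *m hom0 fK = 0.
  by rewrite -[hom0 fK](mulmxK uP1) KP mulmxA -map_mxM cA map_mx0 mul0mx.
have c01 : map_mx c0 cp = map_mx c1 cp.
  apply/matrixP => i j; rewrite [LHS]mxE [RHS]mxE [cp i j]mxE.
  exact/esym/chart1C.
case/eqP: cn.
apply: (NS c (cp *m H0' *m invmx (hom0 fI)) (cp *m H1' *m invmx (hom1 fI))).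
  have e0 : map_mx c0 (invmx (hom0 fI)) *m map_mx c0 (hom0 fI) = 1%:M.
    by rewrite -map_mxM (mulVmx uG0) map_mx1.
  have e5 : map_mx c1 (hom1 fI) *m map_mx c1 (invmx (hom1 fI)) = 1%:M.
    by rewrite -map_mxM (mulmxV uG1) map_mx1.
  have TIE : trans (cs_bundle X2) = map_mx c0 (hom0 fI) *m trans EI *m
      map_mx c1 (invmx (hom1 fI)).
    by rewrite hom_glue -mulmxA e5 mulmx1.
  rewrite TIE !map_mxM -!mulmxA (mulmxA (map_mx c0 (invmx _))) e0 mul1mx.
  have := congr1 (mulmx (map_mx c0 cp)) glue.
  rewrite mulmxDr !mulmxA -[in X in X + _]map_mxM cK0 map_mx0 !mul0mx add0r addr0.
  rewrite TE1 linesumE mul_scalar_mx -scalemxAr => E5.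
  by rewrite E5 -scalemxAl c01.
move=> s Vs.
pose y := secmul (invmx (hom0 fI)) (invmx (hom1 fI)) (pr2_sec s).
have Gy : secmul (hom0 fI) (hom1 fI) y = pr2_sec s.
  by rewrite /y secmulM (mulmxV uG0) (mulmxV uG1) secmul1.
have [|x Vx] := lift e4 y; first by rewrite /pull /= Gy -quoV; exists s.
have [y0 y1] : hom0 fI *m y.1 = dsubmx s.1 /\ hom1 fI *m y.2 = dsubmx s.2.
  by have := Gy; rewrite pr2_secE => -[].
rewrite y0 y1 in Vx; set s' := (X in V X) in Vx.
(* V meets the sections of E1 only in 0, so an element of V is determined by its image in E2 and the
   lift obtained is s itself. *)
have ss' : s' = s.
  pose d : sections C (r + t) := (s' : sections C (r + t)) - s.
  have Vd : V d := subspaceB sV Vx Vs.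
  have dE : inl_sec t (usubmx d.1, usubmx d.2) = d.
    rewrite inl_secE [RHS]surjective_pairing; congr pair.
      by rewrite -[RHS]vsubmxK; congr col_mx; rewrite /= linearB /= col_mxKd subrr.
    by rewrite -[RHS]vsubmxK; congr col_mx; rewrite /= linearB /= col_mxKd subrr.
  have : sub_space V (usubmx d.1, usubmx d.2) by rewrite /sub_space /= dE.
  rewrite subV => d0; apply/eqP; rewrite -subr_eq0 -/d -dE.
  by rewrite (d0 : _ = 0) linear0.
rewrite -{1}ss' /= col_mxKu mulmxDr mulmxA cK0 mul0mx add0r mulmxA.
by rewrite -y0 !mulmxA (mulmxKV uG0).
Qed.

End Cases.

(** * Reduction of the numerical hypotheses to the two cases *)

Theorem theorem3p4 (R : realType) (n a t k : nat) (alpha_c : R)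
  (hn : (0 < n)%N) (hk : (0 < k)%N) (ha : (2 <= a)%N)
  (ht : (1 <= t)%N) (htn : (t <= n - 1)%N)
  (halpha : alpha_c =
     Num.max (t%:R / k%:R) ((n%:R - t%:R) / (a%:R * n%:R - k%:R)))
  (hab :
     [/\ (a * t <= k < a * n)%N,
         ((a%:Z - 1) * t%:Z <=
            a%:Z * (a%:Z * n%:Z - k%:Z) + (a%:Z - 2) * n%:Z)%R
       & G alpha_c (n - t) (a%:Z * (n%:Z - t%:Z)) (k - a * t) !=set0]
     \/
     [/\ (k <= a * t)%N,
         (t%:Z <= (a%:Z + 1) * k%:Z - n%:Z)%R
       & G alpha_c t ((a%:Z - 1) * t%:Z) k !=set0]) :
  exists2 M : set (set (cohsys R[i] n)),
    is_Gplus alpha_c (a%:Z * n%:Z - t%:Z) k M & M !=set0.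
Proof.
have [r [rE r0]] : exists r, n = (r + t)%N /\ (0 < r)%N.
  by exists (n - t)%N; lia.
have [b aE] : exists b, a = b.+2 by exists (a - 2)%N; lia.
clear hn htn ha; subst n.
have kR : 0 < k%:R :> R by rewrite ltr0n.
have tR : 0 < t%:R :> R by rewrite ltr0n.
have rR : 0 < r%:R :> R by rewrite ltr0n.
have rtR : (r + t)%:R - t%:R = r%:R :> R by rewrite natrD addrK.
rewrite rtR in halpha.
case: hab => [[/andP[atk kan] cnt [_ [X1 [tX1 st1] _]]]|[kat cnt [_ [X2 [tX2 st2] _]]]].
- have dR : 0 < a%:R * (r + t)%:R - k%:R :> R by rewrite subr_gt0 -natrM ltr_nat.
  (* Cross-multiplying, the comparison of the two fractions is a t n <= k n, which follows from a t
     <= k. *)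
  have alE : alpha_c = r%:R / (a%:R * (r + t)%:R - k%:R).
    rewrite halpha; apply/max_idPr.
    rewrite ler_pdivrMr // mulrAC ler_pdivlMr //.
    have : a%:R * t%:R <= k%:R :> R by rewrite -natrM ler_nat.
    rewrite natrD => h.
    have : a%:R * t%:R * (r%:R + t%:R) <= k%:R * (r%:R + t%:R) :> R.
      by rewrite ler_pM2r // addr_gt0.
    lra.
  have rtE : ((r + t) - t)%N = r by rewrite addnK.
  rewrite rtE in X1 tX1 st1.
  have dE : a%:Z * ((r + t)%N%:Z - t%:Z) = (a * r)%N%:Z :> int.
    by rewrite PoszD addrK PoszM.
  rewrite dE in tX1.
  have -> : a%:Z * (r + t)%N%:Z - t%:Z = (a * r)%N%:Z + t%:Z * b.+1%:Z.
    by rewrite aE; lia.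
  (* The degree [b.+1] of the quotient line bundles is a - 1. *)
  subst a; apply: (@case_a R alpha_c r t b.+1 k X1) => //.
  + by rewrite alE divr_gt0.
  + by rewrite alE divfK // lt0r_neq0.
  by move: cnt; clear -atk; nia.
have kan : (k < a * (r + t))%N by rewrite (leq_ltn_trans kat) // ltn_pmul2l; lia.
have dR : 0 < a%:R * (r + t)%:R - k%:R :> R by rewrite subr_gt0 -natrM ltr_nat.
(* With k <= a t the same comparison goes the other way. *)
have alE : alpha_c = t%:R / k%:R.
  rewrite halpha; apply/max_idPl.
  rewrite ler_pdivrMr // mulrAC ler_pdivlMr //.
  have : k%:R <= a%:R * t%:R :> R by rewrite -natrM ler_nat.
  rewrite natrD => h.
  have : k%:R * (r%:R + t%:R) <= a%:R * t%:R * (r%:R + t%:R) :> R.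
    by rewrite ler_pM2r // addr_gt0.
  lra.
have dE : (a%:Z - 1) * t%:Z = b.+1%:Z * t%:Z :> int by rewrite aE; lia.
rewrite dE in tX2.
have -> : a%:Z * (r + t)%N%:Z - t%:Z = r%:Z * b.+2%:Z + b.+1%:Z * t%:Z.
  by rewrite aE; lia.
apply: (@case_b R alpha_c r t b.+1 k X2) => //.
- by rewrite alE divr_gt0.
- by rewrite alE divfK // lt0r_neq0.
by move: cnt; rewrite aE; clear; nia.
Qed.
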